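(* Let $A$ and $B$ be finite, non-empty subsets of an abelian group $G$. A necessary and sufficient condition for both $$|A+B|\le |A|+|B|-1$$ and $$\text{either } \pi(A+B)=\{0\},\ \text{ or } \mu(A,B)=1$$ to hold simultaneously is that either the pair $(A,B)$ is elementary, or there exist non-empty subsets $A_0\subseteq A$, $B_0\subseteq B$ and a finite, non-zero, proper subgroup $H<G$ such that, writing $\overline A:=\varphi_{G/H}(A)$ and $\overline B:=\varphi_{G/H}(B)$, we have (i) each of $A_0,B_0$ is contained in an $H$-coset, $|A_0+B_0|=|A_0|+|B_0|-1$, and either $\pi(A_0+B_0)=\{0\}$ or $\mu(A_0,B_0)=1$; (ii) each of $A\setminus A_0$ and $B\setminus B_0$ is a (possibly, empty) union of $H$-cosets; (iii) the pair $(\overline A,\overline B)$ is elementary (in $G/H$), and $A_0+B_0+H$, considered as an element of $G/H$, has a unique representation as a sum of an element of $\overline A$ and an element of $\overline B$.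
   Context: All groups are abelian and written additively; $A+B:=\{a+b: a\in A,\ b\in B\}$, $g+A:=\{g\}+A$, $-A:=\{-a: a\in A\}$, $g-A:=g+(-A)$. For a subgroup $H\le G$, $\varphi_{G/H}:G\to G/H$ denotes the canonical homomorphism. The period of $S\subseteq G$ is the subgroup $\pi(S):=\{g\in G: S+g=S\}$; $S$ is aperiodic if $\pi(S)=\{0\}$. For finite $A,B\subseteq G$ and $c\in G$ let $\nu_c(A,B):=\#\{(a,b)\in A\times B: c=a+b\}$ and $\mu(A,B):=\min\{\nu_c(A,B): c\in A+B\}$. ''Either ... or'' is inclusive. An arithmetic progression in $G$ with difference $d\in G$ is a set of the form $\{g+d,g+2d,\ldots,g+kd\}$ with $g\in G$ and $k$ a positive integer not exceeding the order of $d$ in $G$ (so one-element sets and cosets of finite cyclic subgroups are arithmetic progressions; the empty set is not). A pair $(A,B)$ of finite subsets of an abelian group $G$ is elementary if at least one of the following holds: (I) $\min\{|A|,|B|\}=1$ (with $A,B$ non-empty); (II) $A$ and $B$ are arithmetic progressions sharing a common difference $d\in G$, the order of which in $G$ is at least $|A|+|B|-1$; (III) $A=g_1+(H_1\cup\{0\})$ and $B=g_2-(H_2\cup\{0\})$, where $g_1,g_2\in G$ and $H_1,H_2$ are non-empty subsets of a subgroup $H\le G$ such that $H=H_1\cup H_2\cup\{0\}$ is a partition of $H$; moreover, $c:=g_1+g_2$ is the only element of $A+B$ with $\nu_c(A,B)=1$; (IV) $A=g_1+H_1$ and $B=g_2-H_2$, where $g_1,g_2\in G$ and $H_1,H_2$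 are non-empty, aperiodic subsets of a subgroup $H\le G$ such that $H=H_1\cup H_2$ is a partition of $H$; moreover, $\mu(A,B)\ge 2$. *)

(* Defs.v *)
From mathcomp Require Import all_boot all_order all_algebra.
From mathcomp Require Import finmap.

Set Implicit Arguments.
Unset Strict Implicit.
Unset Printing Implicit Defensive.

Import GRing.Theory.

Local Open Scope fset_scope.
Local Open Scope quotient_scope.
Local Open Scope ring_scope.

Definition sumset (G : zmodType) (A B : {fset G}) : {fset G} :=
  [fset a + b | a in A, b in B].

Definition oppset (G : zmodType) (A : {fset G}) : {fset G} :=
  [fset - a | a in A].

Definition translate (G : zmodType) (g : G) (A : {fset G}) : {fset G} :=
  sumset [fset g] A.

Definition period (G : zmodType) (S : {fset G}) : {pred G} :=
  [pred g | translate g S == S].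

Definition aperiodic (G : zmodType) (S : {fset G}) : Prop :=
  period S =i pred1 0.

Definition nu (G : zmodType) (c : G) (A B : {fset G}) : nat :=
  #|` [fset p in A `*` B | c == p.1 + p.2]|.

(* Every [nu c A B] is at most [#|` A| * #|` B|], so for non-empty [A] and [B]
   the default value of the iterated minimum has no effect. *)
Definition mu (G : zmodType) (A B : {fset G}) : nat :=
  \big[minn/(#|` A| * #|` B|)%N]_(c <- sumset A B) nu c A B.

(* The order of [d] is at least [k]; this holds for all [k] when [d] has
   infinite order. *)
Definition order_ge (G : zmodType) (d : G) (k : nat) : Prop :=
  forall n : nat, (0 < n)%N -> d *+ n = 0 -> (k <= n)%N.

Definition arith_prog (G : zmodType) (d : G) (S : {fset G}) : Prop :=
  exists (g : G) (k : nat),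
    [/\ (0 < k)%N, order_ge d k & S = [fset g + d *+ i | i in iota 1 k]].

Definition elementary_I (G : zmodType) (A B : {fset G}) : Prop :=
  minn #|` A| #|` B| = 1%N.

Definition elementary_II (G : zmodType) (A B : {fset G}) : Prop :=
  exists d : G,
    [/\ arith_prog d A, arith_prog d B & order_ge d (#|` A| + #|` B| - 1)%N].

Definition elementary_III (G : zmodType) (A B : {fset G}) : Prop :=
  exists (g1 g2 : G) (H : zmodClosed G) (H1 H2 : {fset G}),
    [/\ [/\ H1 != fset0, H2 != fset0,
            [disjoint H1 & H2], 0 \notin H1 & 0 \notin H2],
        H =i H1 `|` H2 `|` [fset 0],
        A = translate g1 (H1 `|` [fset 0]),
        B = translate g2 (oppset (H2 `|` [fset 0])) &
        forall c : G, c \in sumset A B /\ nu c A B = 1%N <-> c = g1 + g2].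

Definition elementary_IV (G : zmodType) (A B : {fset G}) : Prop :=
  exists (g1 g2 : G) (H : zmodClosed G) (H1 H2 : {fset G}),
    [/\ [/\ H1 != fset0, H2 != fset0, aperiodic H1, aperiodic H2 &
            [disjoint H1 & H2]],
        H =i H1 `|` H2,
        A = translate g1 H1,
        B = translate g2 (oppset H2) &
        (2 <= mu A B)%N].

Definition elementary (G : zmodType) (A B : {fset G}) : Prop :=
  [\/ elementary_I A B, elementary_II A B, elementary_III A B |
      elementary_IV A B].

Notation "{ 'quot' H }" := (@Quotient.quot _ H) : type_scope.

(* Here and below an [H]-coset is given by an element of [{quot H}]. *)
Definition in_coset (G : zmodType) (H : zmodClosed G) (S : {fset G}) : Prop :=
  exists q : {quot H}, forall x : G, x \in S -> \pi_{quot H} x = q.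

Definition union_of_cosets (G : zmodType) (H : zmodClosed G) (S : {fset G}) :
    Prop :=
  exists C : {pred {quot H}}, forall x : G, (x \in S) = (\pi_{quot H} x \in C).

Definition finite_subgroup (G : zmodType) (H : zmodClosed G) : Prop :=
  exists F : {fset G}, H =i F.

Definition quot_image (G : zmodType) (H : zmodClosed G) (S : {fset G}) :
    {fset {quot H}} :=
  [fset \pi_{quot H} x | x in S].

(* Main.v *)
Require Import Defs.
From HB Require Import structures.
From mathcomp Require Import all_boot all_order all_algebra.
From mathcomp Require Import finmap zify.
From Stdlib Require Import Classical.

(** This is Kemperman's structure theorem, in the form in which the pair of images
    modulo the subgroup is elementary.  Call [(A, B)] critical if it satisfies the two
    conditions of the theorem.

    Decompositions.  [decomp A B A0 B0 H] expresses inside the group that [A] and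
    [B] are unions of [H]-cosets except for the parts [A0] and [B0], that the
    coset of [A0 + B0] has a unique representation modulo [H], and that the images
    modulo [H] attain the bound.  In this situation [A + B] is a periodic set
    together with [A0 + B0], whence [(A, B)] is critical if and only if
    [(A0, B0)] is ([decomp_critical], [critical_decomp]).  As elementary pairs are
    critical ([elementary_critical]), this shows that the condition is sufficient.

    Necessity is based on Kneser's theorem [kneser]: if [F] is the period of
    [A + B], then [|A + B| >= |A + F| + |B + F| - |F|].  It shows that a
    decomposition exists as soon as one of the summands of an aperiodic critical
    pair is periodic outside a part of one coset ([quasi_decomp]), and that if one
    summand is an arithmetic progression, then so is the other, or it is periodic
    in that sense ([ap_summand]).  So it suffices to find such a summand.

    For an aperiodic sum this is done with the isoperimetric method.  If [A + B]
    misses sufficiently many elements of the group [K] generated, then either some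
    subgroup has a boundary [|X + B| - |X|] smaller than that of a point, and the
    classes modulo this subgroup show that [A] is quasi-periodic, or the smallest
    sets with boundary [|B| - 1] and at least two elements, the atoms, are cosets
    or Sidon sets, and [B] is quasi-periodic, or a progression in the case of
    two-element atoms ([ap_or_quasi_periodic_summand]).  If [A + B] misses fewer
    elements than the larger summand has, say [A], then [(A, B)] is replaced by
    the pair consisting of the missing elements and [-B], unless there is only one
    missing element, which leads to type IV or again to a progression or a
    quasi-periodic summand ([one_missing]).  If the sum is periodic and some sum
    has a unique representation, then Kneser's bound confines the holes of [A] and
    [B] to one coset of the period each; this is a decomposition, unless each of
    [A] and [B] lies in one coset, which leads to type III, to type II, or to a
    decomposition modulo a smaller group ([full_coset]).  Altogether a critical
    pair is elementary or decomposes ([critical_elementary_or_splits]).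

    Finally, in a decomposition with [H] as large as possible the pair of images
    is elementary, by induction on [|A| + |B|] ([critical_structure]). *)

Set Implicit Arguments.
Unset Strict Implicit.
Unset Printing Implicit Defensive.

Import GRing.Theory.

Local Open Scope fset_scope.
Local Open Scope ring_scope.


(** * Identities in abelian groups, by reflection *)

Inductive zexpr := ZVar of nat | ZZero | ZAdd of zexpr & zexpr | ZOpp of zexpr.

Section ZmodReflection.
Variable G : zmodType.

Fixpoint zeval (env : seq G) (e : zexpr) : G :=
  match e with
  | ZVar i => env`_i
  | ZZero => 0
  | ZAdd e1 e2 => zeval env e1 + zeval env e2
  | ZOpp e1 => - zeval env e1
  end.

(** The number of occurrences of a variable with positive ([b = true]) or
    negative sign; keeping the two apart avoids integer coefficients. *)
Fixpoint zcount (b : bool) (e : zexpr) (i : nat) : nat :=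
  match e with
  | ZVar j => (b && (i == j))%:R%N
  | ZZero => 0%N
  | ZAdd e1 e2 => (zcount b e1 i + zcount b e2 i)%N
  | ZOpp e1 => zcount (~~ b) e1 i
  end.

Fixpoint zbound (e : zexpr) : nat :=
  match e with
  | ZVar j => j.+1
  | ZZero => 0%N
  | ZAdd e1 e2 => maxn (zbound e1) (zbound e2)
  | ZOpp e1 => zbound e1
  end.

Lemma zevalE (env : seq G) (e : zexpr) (n : nat) : (zbound e <= n)%N ->
  zeval env e + \sum_(i < n) env`_i *+ zcount false e i
    = \sum_(i < n) env`_i *+ zcount true e i.
Proof.
elim: e => [j||e1 IH1 e2 IH2|e IH] /=.
- move=> jn; rewrite big1 ?addr0 => [|i _]; last by rewrite mulr0n.
  rewrite (bigD1 (Ordinal jn)) //= eqxx mulr1n big1 ?addr0 // => i ij.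
  by have -> : (i == j :> nat) = false by apply/negbTE; rewrite -val_eqE in ij.
- by move=> _; rewrite !big1 ?addr0 // => i _; rewrite mulr0n.
- rewrite geq_max => /andP[h1 h2]; rewrite -!(eq_bigr _ (fun i _ => esym (mulrnDr _ _ _))).
  by rewrite !big_split /= addrACA IH1 // IH2.
- by move=> h; rewrite -IH // addrA addNr add0r.
Qed.

Lemma zeval_eq (env : seq G) (e1 e2 : zexpr) :
  all (fun i => zcount true e1 i + zcount false e2 i
                == zcount true e2 i + zcount false e1 i)%N
      (iota 0 (maxn (zbound e1) (zbound e2))) ->
  zeval env e1 = zeval env e2.
Proof.
set n := maxn _ _ => /allP h.
have h1 := zevalE env (leq_maxl (zbound e1) (zbound e2)).
have h2 := zevalE env (leq_maxr (zbound e1) (zbound e2)).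
apply: (addIr (\sum_(i < n) env`_i *+ zcount false e1 i
               + \sum_(i < n) env`_i *+ zcount false e2 i)).
rewrite addrA h1 [X in _ = _ + X]addrC addrA h2 -!big_split /=.
apply: eq_bigr => i _; rewrite -!mulrnDr; congr (_ *+ _); apply/eqP/h.
by rewrite mem_iota /= add0n.
Qed.
End ZmodReflection.

Ltac zmem x l :=
  match l with
  | ?y :: ?l' => match x with y => true | _ => zmem x l' end
  | _ => false
  end.
Ltac zatoms t l :=
  lazymatch t with
  | (?a + ?b)%R => let l1 := zatoms a l in zatoms b l1
  | (- ?a)%R => zatoms a l
  | 0%R => l
  | _ => lazymatch zmem t l with true => l | false => constr:(t :: l) end
  end.
Ltac zindex x l :=
  match l with
  | ?y :: ?l' => match x with y => constr:(0%N)
                 | _ => let n := zindex x l' in constr:(n.+1) end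
  end.
Ltac zreify t l :=
  lazymatch t with
  | (?a + ?b)%R =>
      let ea := zreify a l in let eb := zreify b l in constr:(ZAdd ea eb)
  | (- ?a)%R => let ea := zreify a l in constr:(ZOpp ea)
  | 0%R => constr:(ZZero)
  | _ => let i := zindex t l in constr:(ZVar i)
  end.
Ltac zmod :=
  lazymatch goal with
  | |- @eq ?T ?x ?y =>
      let l0 := zatoms x (@nil T) in let l := zatoms y l0 in
      let ex := zreify x l in let ey := zreify y l in
      exact: (@zeval_eq _ l ex ey isT)
  end.

(** Linear arithmetic on cardinals: everything but the arithmetic hypotheses is
    dropped first, for otherwise [lia] examines the whole context. *)
Ltac clia :=
  repeat match goal with x := _ |- _ => clearbody x end;
  repeat match goal with
  | H : ?P |- _ =>
      lazymatch type of P with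
      | Prop =>
          lazymatch P with
          | is_true (leq _ _) => fail
          | is_true (~~ (leq _ _)) => fail
          | @eq nat _ _ => fail
          | _ => clear H
          end
      end
  end;
  lia.

Lemma ex_least (P : nat -> Prop) : (exists n, P n) ->
  exists2 n, P n & forall m, P m -> (n <= m)%N.
Proof.
case=> k; have [j] := ubnP k; elim: j k => // j IHj k ltk Pk.
have [[i [lti Pi]]|hn] := classic (exists i, (i < k)%N /\ P i).
  by apply: (IHj i) => //; apply: leq_trans lti _.
by exists k => // i Pi; rewrite leqNgt; apply/negP => lti; apply: hn; exists i.
Qed.

Lemma ex_smallest (T : Type) (f : T -> nat) (P : T -> Prop) : (exists x, P x) ->
  exists2 x, P x & forall y, P y -> (f x <= f y)%N.
Proof.
move=> [x Px]; have [|n [y [Py ey]] h] := @ex_least (fun n => exists y, P y /\ f y = n).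
  by exists (f x), x.
by exists y => // z Pz; rewrite ey; apply: h; exists z.
Qed.

(** * Sumsets, cosets and periods *)

Notation "A :+: B" := (sumset A B) (at level 50, left associativity) : fset_scope.

Section Sumsets.
Variable G : zmodType.
Implicit Types (A B C S X Y H K F : {fset G}) (a b c d g h x y z : G).

Lemma sumsetP A B x :
  reflect (exists a b, [/\ a \in A, b \in B & x = a + b]) (x \in A :+: B).
Proof.
apply: (iffP (imfset2P _ _ _ _ _)) => [[a aA [b bB ->]]|[a [b [aA bB ->]]]].
  by exists a, b.
by exists a => //; exists b.
Qed.

Lemma mem_sumset A B a b : a \in A -> b \in B -> a + b \in A :+: B.
Proof. by move=> aA bB; apply/sumsetP; exists a, b. Qed.

Lemma sumset_sub A B S :
  (forall a b, a \in A -> b \in B -> a + b \in S) -> A :+: B `<=` S.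
Proof. by move=> h; apply/fsubsetP => x /sumsetP[a [b [aA bB ->]]]; apply: h. Qed.

Lemma sumsetC A B : A :+: B = B :+: A.
Proof.
by apply/fsetP => x; apply/sumsetP/sumsetP => -[a [b [? ? ->]]]; exists b, a; split; rewrite // addrC.
Qed.

Lemma sumsetA A B C : A :+: (B :+: C) = A :+: B :+: C.
Proof.
apply/fsetP => x; apply/sumsetP/sumsetP.
  move=> [a [_ [aA /sumsetP[b [c [bB cC ->]]] ->]]].
  by exists (a + b), c; rewrite mem_sumset //; split => //; rewrite addrA.
move=> [_ [c [/sumsetP[a [b [aA bB ->]]] cC ->]]].
by exists a, (b + c); rewrite mem_sumset //; split => //; rewrite addrA.
Qed.

Lemma sumsetSS A A' B B' : A `<=` A' -> B `<=` B' -> A :+: B `<=` A' :+: B'.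
Proof.
move=> /fsubsetP hA /fsubsetP hB; apply: sumset_sub => a b aA bB.
by apply: mem_sumset; [apply: hA|apply: hB].
Qed.

Lemma sumsetUl A A' B : (A `|` A') :+: B = (A :+: B) `|` (A' :+: B).
Proof.
apply/eqP; rewrite eqEfsubset; apply/andP; split.
  apply: sumset_sub => a b; rewrite !inE => /orP[h|h] bB.
    by rewrite (mem_sumset h bB).
  by rewrite (mem_sumset h bB) orbT.
by rewrite fsubUset !sumsetSS ?fsubsetUl ?fsubsetUr.
Qed.

Lemma sumsetUr A B B' : A :+: (B `|` B') = (A :+: B) `|` (A :+: B').
Proof. by rewrite sumsetC sumsetUl ![_ :+: A]sumsetC. Qed.

Lemma sumset_neq0 A B : A != fset0 -> B != fset0 -> A :+: B != fset0.
Proof.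
by move=> /fset0Pn[a aA] /fset0Pn[b bB]; apply/fset0Pn; exists (a + b); rewrite mem_sumset.
Qed.

Lemma in_translate g A x : (x \in translate g A) = (x - g \in A).
Proof.
apply/sumsetP/idP => [[a [b []]]|h].
  by rewrite inE => /eqP-> bA ->; rewrite addrC addKr.
by exists g, (x - g); rewrite inE eqxx h; split => //; zmod.
Qed.

Lemma card_translate g A : #|` translate g A| = #|` A|.
Proof.
have -> : translate g A = [fset g + x | x in A].
  apply/fsetP => x; rewrite in_translate; apply/idP/imfsetP => [h|[y yA ->]].
    by exists (x - g) => //; zmod.
  by rewrite addrC addKr.
by rewrite card_imfset //=; apply: addrI.
Qed.

Lemma translateD g h A : translate g (translate h A) = translate (g + h) A.
Proof.
by apply/fsetP => x; rewrite !in_translate; congr (_ \in A); zmod.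
Qed.

Lemma translate0 A : translate 0 A = A.
Proof. by apply/fsetP => x; rewrite in_translate subr0. Qed.

Lemma sumset_translatel g A B : translate g A :+: B = translate g (A :+: B).
Proof. by rewrite /translate sumsetA. Qed.

Lemma sumset_translater g A B : A :+: translate g B = translate g (A :+: B).
Proof. by rewrite sumsetC sumset_translatel sumsetC. Qed.

Lemma in_oppset A x : (x \in oppset A) = (- x \in A).
Proof.
apply/imfsetP/idP => [[y yA ->]|h]; first by rewrite opprK.
by exists (- x); rewrite ?opprK.
Qed.

Lemma card_oppset A : #|` oppset A| = #|` A|.
Proof. by rewrite card_imfset //=; apply: oppr_inj. Qed.

Lemma oppsetK A : oppset (oppset A) = A.
Proof. by apply/fsetP => x; rewrite !in_oppset opprK. Qed.

Lemma oppset_neq0 A : (oppset A != fset0) = (A != fset0).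
Proof. by rewrite -!cardfs_gt0 card_oppset. Qed.

Lemma card_fsubset A B : (forall x, x \in A -> x \in B) -> (#|` A| <= #|` B|)%N.
Proof. by move=> h; apply/fsubset_leq_card/fsubsetP. Qed.

Lemma card_disjU A B :
  (forall x, x \in A -> x \in B -> False) -> #|` A `|` B| = (#|` A| + #|` B|)%N.
Proof.
move=> h; rewrite -cardfsUI; have -> : A `&` B = fset0; last by rewrite cardfs0 addn0.
by apply/fsetP => x; rewrite !inE; apply/negbTE/andP => -[/h].
Qed.

Lemma eq_fsub_card A B :
  (forall x, x \in A -> x \in B) -> (#|` B| <= #|` A|)%N -> A = B.
Proof.
by move=> h hc; apply/eqP; rewrite eqEfcard hc andbT; apply/fsubsetP.
Qed.

Lemma leq_card_sumsetl A B : B != fset0 -> (#|` A| <= #|` A :+: B|)%N.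
Proof.
move=> /fset0Pn[b bB]; rewrite -(card_translate b A); apply: card_fsubset => x.
by rewrite in_translate => h; apply/sumsetP; exists (x - b), b; split => //; zmod.
Qed.

Lemma leq_card_sumsetr A B : A != fset0 -> (#|` B| <= #|` A :+: B|)%N.
Proof. by move=> h; rewrite sumsetC leq_card_sumsetl. Qed.

Lemma neq0_card A x : x \in A -> (0 < #|` A|)%N.
Proof. by move=> xA; rewrite cardfs_gt0; apply/fset0Pn; exists x. Qed.

Lemma mem_neq0 A x : x \in A -> A != fset0.
Proof. by move=> xA; apply/fset0Pn; exists x. Qed.

(** An injective self-map of a finite set is onto. *)
Lemma stable_translate S d : (forall x, x \in S -> x + d \in S) -> translate d S = S.
Proof.
move=> h; apply: eq_fsub_card; last by rewrite card_translate.
by move=> y; rewrite in_translate => /h; rewrite subrK.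
Qed.

(** ** Finite subgroups and periodic sets *)

Definition subgrp H : Prop := 0 \in H /\ forall x y, x \in H -> y \in H -> x - y \in H.

Definition periodic H S : Prop := forall x h, x \in S -> h \in H -> x + h \in S.

Definition same_coset H S : Prop := forall x y, x \in S -> y \in S -> x - y \in H.

Lemma subgrp0 H : subgrp H -> 0 \in H. Proof. by case. Qed.

Lemma subgrpB H x y : subgrp H -> x \in H -> y \in H -> x - y \in H.
Proof. by case=> _; apply. Qed.

Lemma subgrpN H x : subgrp H -> x \in H -> - x \in H.
Proof. by move=> sH xH; rewrite -sub0r subgrpB // subgrp0. Qed.

Lemma subgrpNE H x : subgrp H -> (- x \in H) = (x \in H).
Proof. by move=> sH; apply/idP/idP => /(subgrpN sH); rewrite ?opprK. Qed.

Lemma subgrpD H x y : subgrp H -> x \in H -> y \in H -> x + y \in H.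
Proof. by move=> sH xH yH; rewrite -[y]opprK subgrpB // subgrpN. Qed.

Lemma subgrpDr H x y : subgrp H -> y \in H -> (x + y \in H) = (x \in H).
Proof.
move=> sH yH; apply/idP/idP => h; last exact: subgrpD.
have -> : x = x + y - y by zmod.
by apply: subgrpB.
Qed.

Lemma subgrpBC H x y : subgrp H -> (x - y \in H) = (y - x \in H).
Proof. by move=> sH; rewrite -(subgrpNE _ sH) opprB. Qed.

Lemma subgrp_neq0 H : subgrp H -> H != fset0.
Proof. by move=> sH; apply/fset0Pn; exists 0; apply: subgrp0. Qed.

Lemma subgrp_card_gt0 H : subgrp H -> (0 < #|` H|)%N.
Proof. by move=> sH; rewrite cardfs_gt0 subgrp_neq0. Qed.

Lemma subgrpI H K : subgrp H -> subgrp K -> subgrp (H `&` K).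
Proof.
move=> sH sK; split; first by rewrite inE !subgrp0.
by move=> x y; rewrite !inE => /andP[? ?] /andP[? ?]; rewrite !subgrpB.
Qed.

Definition triv : {fset G} := [fset 0].

Lemma in_triv x : (x \in triv) = (x == 0).
Proof. exact: in_fset1. Qed.

Lemma card_triv : #|` triv| = 1%N.
Proof. exact: cardfs1. Qed.

Lemma subgrp1 : subgrp triv.
Proof. by split => [|x y]; rewrite !in_triv // => /eqP-> /eqP->; rewrite subrr. Qed.

Lemma subgrp_sub_union H K F : subgrp H -> subgrp K -> subgrp F ->
  (forall x, x \in F -> (x \in H) || (x \in K)) -> {subset F <= H} \/ {subset F <= K}.
Proof.
move=> sH sK sF h; apply: NNPP => /not_or_and[].
move=> /fsubsetP/fsubsetPn[x xF xH] /fsubsetP/fsubsetPn[y yF yK].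
have := h _ xF; rewrite (negbTE xH) /= => xK.
have := h _ yF; rewrite (negbTE yK) orbF => yH.
have /orP[h1|h1] := h _ (subgrpD sF xF yF).
  by case/negP: xH; rewrite -(subgrpDr _ sH yH).
by case/negP: yK; rewrite -(subgrpDr _ sK xK) addrC.
Qed.

Lemma subgrp_sumset H K : subgrp H -> subgrp K -> subgrp (H :+: K).
Proof.
move=> sH sK; split; first by rewrite -[0]addr0 mem_sumset ?subgrp0.
move=> _ _ /sumsetP[a [b [aH bK ->]]] /sumsetP[c [d [cH dK ->]]].
have -> : a + b - (c + d) = (a - c) + (b - d) by zmod.
by rewrite mem_sumset ?subgrpB.
Qed.

Lemma subgrp_card_gt1 H : subgrp H -> H != triv -> (1 < #|` H|)%N.
Proof.
move=> sH h; rewrite ltn_neqAle subgrp_card_gt0 // andbT eq_sym.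
apply: contra h => /cardfs1P[x hx]; have := subgrp0 sH; rewrite hx in_fset1.
by move=> /eqP <-; apply/eqP.
Qed.

Lemma subgrp_nontriv H : subgrp H -> H != triv -> exists2 h, h \in H & h != 0.
Proof.
move=> sH h; have hc := subgrp_card_gt1 sH h.
have : H `\ 0 != fset0 by rewrite -cardfs_gt0; move: hc; rewrite (cardfsD1 0 H) subgrp0.
by case/fset0Pn => x; rewrite !inE => /andP[x0 xH]; exists x.
Qed.

Lemma nontriv_subgrp H h : h \in H -> h != 0 -> H != triv.
Proof. by move=> hH; apply: contraNneq => hh; rewrite -in_triv -hh. Qed.

Lemma periodicE H S x h : subgrp H -> periodic H S -> h \in H -> (x + h \in S) = (x \in S).
Proof.
move=> sH pS hH; apply/idP/idP => hx; last exact: pS.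
have -> : x = x + h + (- h) by zmod.
by apply: pS => //; apply: subgrpN.
Qed.

Lemma periodic_eq H S x y : subgrp H -> periodic H S -> x - y \in H -> (x \in S) = (y \in S).
Proof.
move=> sH pS hxy; rewrite -(periodicE y sH pS hxy); congr (_ \in S); zmod.
Qed.

Lemma periodic_sub H K S : {subset H <= K} -> periodic K S -> periodic H S.
Proof. by move=> h pS x k xS kH; apply: pS => //; apply: h. Qed.

Lemma periodicU H S X : periodic H S -> periodic H X -> periodic H (S `|` X).
Proof.
by move=> pS pX x h; rewrite !inE => /orP[/pS h1|/pX h1] hH; rewrite h1 // orbT.
Qed.

Lemma periodicI H S X : periodic H S -> periodic H X -> periodic H (S `&` X).
Proof. by move=> pS pX x h; rewrite !inE => /andP[h1 h2] hH; rewrite pS // pX. Qed.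

Lemma periodicD H S X : subgrp H -> periodic H S -> periodic H X -> periodic H (S `\` X).
Proof.
by move=> sH pS pX x h; rewrite !inE => /andP[h1 h2] hH; rewrite pS // (periodicE _ sH pX) // h1.
Qed.

Lemma periodic_sumsetl H S X : periodic H S -> periodic H (S :+: X).
Proof.
move=> pS x h /sumsetP[s [y [sS yX ->]]] hH.
by rewrite -addrA [y + h]addrC addrA mem_sumset // pS.
Qed.

Lemma periodic_sumsetr H S X : periodic H X -> periodic H (S :+: X).
Proof. by rewrite sumsetC; apply: periodic_sumsetl. Qed.

Lemma periodic_subgrp H : subgrp H -> periodic H H.
Proof. by move=> sH x h xH hH; apply: subgrpD. Qed.

Lemma periodic_closure H S : subgrp H -> periodic H (S :+: H).
Proof. by move=> sH; apply/periodic_sumsetr/periodic_subgrp. Qed.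

Lemma periodic_translate H S g : periodic H S -> periodic H (translate g S).
Proof. by move=> pS; apply: periodic_sumsetr. Qed.

Lemma mem_closure H S x : subgrp H -> x \in S -> x \in S :+: H.
Proof. by move=> sH xS; rewrite -[x]addr0 mem_sumset // subgrp0. Qed.

Lemma closureP H S x : subgrp H ->
  reflect (exists2 s, s \in S & x - s \in H) (x \in S :+: H).
Proof.
move=> sH; apply: (iffP (sumsetP _ _ _)) => [[s [h [sS hH ->]]]|[s sS hs]].
  by exists s => //; rewrite addrC addKr.
by exists s, (x - s); split => //; zmod.
Qed.

Lemma periodic_closureE H S : subgrp H -> periodic H S -> S :+: H = S.
Proof.
move=> sH pS; apply/eqP; rewrite eqEfsubset; apply/andP; split.
  by apply: sumset_sub => s h; apply: pS.
by apply/fsubsetP => x; apply: mem_closure.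
Qed.

Lemma closure_sub H S X : periodic H X -> {subset S <= X} -> {subset S :+: H <= X}.
Proof. by move=> pX h; apply/fsubsetP/sumset_sub => s k sS kH; apply: pX => //; apply: h. Qed.

Lemma leq_card_closure H S : subgrp H -> (#|` S| <= #|` S :+: H|)%N.
Proof. by move=> sH; apply: leq_card_sumsetl; apply: subgrp_neq0. Qed.

Lemma closure_card_periodic H S : subgrp H -> (#|` S :+: H| <= #|` S|)%N -> periodic H S.
Proof.
move=> sH hc; have -> : S = S :+: H; last exact: periodic_closure.
by apply: eq_fsub_card => // x; apply: mem_closure.
Qed.

Lemma subgrp_sumsetid H : subgrp H -> H :+: H = H.
Proof. by move=> sH; apply: periodic_closureE => //; apply: periodic_subgrp. Qed.

Lemma periodic_coset H a : subgrp H -> periodic H (translate a H).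
Proof. by move=> sH; apply/periodic_translate/periodic_subgrp. Qed.

Lemma coset_sub H S a : periodic H S -> a \in S -> {subset translate a H <= S}.
Proof.
move=> pS aS x; rewrite in_translate => h; have -> : x = a + (x - a) by zmod.
exact: pS.
Qed.

Lemma same_coset_sub H S X : {subset S <= X} -> same_coset H X -> same_coset H S.
Proof. by move=> h hX x y xS yS; apply: hX; apply: h. Qed.

Lemma same_coset_translate H a : subgrp H -> same_coset H (translate a H).
Proof.
move=> sH x y; rewrite !in_translate => hx hy.
have -> : x - y = (x - a) - (y - a) by zmod.
by apply: subgrpB.
Qed.

Lemma same_coset_sumset H S X : subgrp H ->
  same_coset H S -> same_coset H X -> same_coset H (S :+: X).
Proof.
move=> sH hS hX _ _ /sumsetP[a [b [aS bX ->]]] /sumsetP[c [d [cS dX ->]]].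
have -> : a + b - (c + d) = (a - c) + (b - d) by zmod.
by apply: subgrpD => //; [apply: hS|apply: hX].
Qed.

Lemma same_coset_card H S : same_coset H S -> (#|` S| <= #|` H|)%N.
Proof.
move=> hS; have [->|[a aS]] := fset_0Vmem S; first by rewrite cardfs0.
rewrite -(card_translate a H); apply: card_fsubset => x xS.
by rewrite in_translate; apply: hS.
Qed.

Lemma same_coset_in H S a : same_coset H S -> a \in S -> {subset S <= translate a H}.
Proof. by move=> hS aS x xS; rewrite in_translate; apply: hS. Qed.

Lemma periodic_dvdn H S : subgrp H -> periodic H S -> (#|` H| %| #|` S|)%N.
Proof.
move=> sH; have [n] := ubnP #|` S|; elim: n S => // n IH S ltn pS.
have [->|[a aS]] := fset_0Vmem S; first by rewrite cardfs0 dvdn0.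
have sub : translate a H `<=` S by apply/fsubsetP/coset_sub.
have pa := @periodic_coset H a sH.
have := cardfsDS sub; rewrite card_translate => hc.
have Hle : (#|` H| <= #|` S|)%N by rewrite -(card_translate a H) fsubset_leq_card.
have H0 := subgrp_card_gt0 sH.
rewrite -(subnK Hle) dvdn_add // -hc; apply: IH; last exact: periodicD.
by rewrite hc; clia.
Qed.

Lemma periodic_card_ge H S a : periodic H S -> a \in S -> (#|` H| <= #|` S|)%N.
Proof.
by move=> pS aS; rewrite -(card_translate a H); apply: card_fsubset; apply: coset_sub.
Qed.

(** ** The period *)

Definition stab S : {fset G} := [fset d in S :+: oppset S | translate d S == S].

Lemma stabP S d : S != fset0 -> reflect (forall x, x \in S -> x + d \in S) (d \in stab S).
Proof.
move=> S0; apply: (iffP idP).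
  rewrite !inE => /andP[_ /eqP h] x xS; rewrite -h in_translate.
  by have -> : x + d - d = x by zmod.
move=> h; rewrite !inE (stable_translate h) eqxx andbT.
have /fset0Pn[s sS] := S0; apply/sumsetP; exists (s + d), (- s); rewrite in_oppset opprK h //; split => //; zmod.
Qed.

Lemma stab_subgrp S : S != fset0 -> subgrp (stab S).
Proof.
move=> S0; split; first by apply/stabP => // x; rewrite addr0.
move=> d e hd he; apply/stabP => // x xS.
have h2 : translate e S = S by apply/stable_translate/stabP.
have h1 : x + d \in S by move/stabP: hd; apply.
have : x + d \in translate e S by rewrite h2.
by rewrite in_translate addrA.
Qed.

Lemma stab_periodic S : periodic (stab S) S.
Proof.
move=> x h xS; have S0 := mem_neq0 xS.
by move/(stabP _ S0); apply.
Qed.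

Lemma sub_stab H S : S != fset0 -> periodic H S -> {subset H <= stab S}.
Proof. by move=> S0 pS h hH; apply/stabP => // x xS; apply: pS. Qed.

Lemma stab_translate S g : S != fset0 -> stab (translate g S) = stab S.
Proof.
move=> S0; have T0 : translate g S != fset0 by rewrite -cardfs_gt0 card_translate cardfs_gt0.
apply/fsetP => d; apply/stabP/stabP => // h x.
  move=> xS; have := h (x + g); rewrite !in_translate addrK => /(_ xS).
  by congr (_ \in S); zmod.
rewrite !in_translate => /h; congr (_ \in S); zmod.
Qed.

Lemma aperiodicP S : S != fset0 ->
  aperiodic S <-> forall d, (forall x, x \in S -> x + d \in S) -> d = 0.
Proof.
move=> S0; split=> [h d hd|h d].
  by have := h d; rewrite !inE (stable_translate hd) eqxx => /esym/eqP.
rewrite !inE; apply/eqP/eqP => [hd|->]; last exact: translate0.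
by apply: h => x xS; rewrite -hd in_translate addrK.
Qed.

Lemma aperiodic_stab S : S != fset0 -> aperiodic S <-> stab S = triv.
Proof.
move=> S0; split=> [/(aperiodicP S0) h|h].
  apply/fsetP => d; rewrite in_triv; apply/idP/eqP => [/(stabP _ S0)|->]; first exact: h.
  by apply/stabP => // x; rewrite addr0.
apply/aperiodicP => // d hd; have : d \in stab S by apply/stabP.
by rewrite h in_triv => /eqP.
Qed.

Lemma stab_same_coset H S : subgrp H -> same_coset H S -> {subset stab S <= H}.
Proof.
move=> sH hS d; have [->|[s sS]] := fset_0Vmem S.
  by rewrite !inE => /andP[/sumsetP[x [y []]]]; rewrite inE.
move/(stabP _ (mem_neq0 sS)) => /(_ _ sS) h.
have -> : d = s + d - s by zmod.
by apply: hS.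
Qed.

End Sumsets.

Arguments triv {G}.

(** * Kneser's theorem *)

Section Kneser.
Variable G : zmodType.
Implicit Types (A B C E S X Y H K F P U V W : {fset G}) (a b c d g h x y z : G).

Definition kneser_bound A B : Prop :=
  (#|` A :+: stab (A :+: B)| + #|` B :+: stab (A :+: B)|
     <= #|` A :+: B| + #|` stab (A :+: B)|)%N.

(** A convergent: a periodic part of [A + B] that is already large enough to
    beat the bound obtained from [A :&: B] and [A :|: B]. *)
Definition convergent A B C H : Prop :=
  [/\ subgrp H, periodic H C, {subset C <= A :+: B}, C != fset0 &
      (#|` A `&` B| + #|` (A `|` B) :+: H| <= #|` C| + #|` H|)%N].

Lemma closure_hole E H K P : subgrp H -> subgrp K -> {subset K <= H} ->
  {subset P <= E :+: H} -> (forall x, x \in P -> x \in E :+: K -> False) ->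
  (#|` E :+: K| + #|` P| <= #|` E :+: H|)%N.
Proof.
move=> sH sK KH hP hd; rewrite -card_disjU => [|x h1 h2]; last exact: hd h2 h1.
apply: card_fsubset => x; rewrite inE => /orP[|/hP] //.
by apply/fsubsetP/sumsetSS => //; apply/fsubsetP.
Qed.

Lemma closure_coset X H K a x : subgrp H -> subgrp K -> {subset K <= H} ->
  x \in X :+: K -> x \in translate a H -> x \in (X `&` translate a H) :+: K.
Proof.
move=> sH sK KH /(closureP _ _ sK)[s sX hs]; rewrite in_translate => ha.
apply/closureP => //; exists s => //; rewrite !inE sX in_translate.
have -> : s - a = (x - a) - (x - s) by zmod.
by apply: subgrpB => //; apply: KH.
Qed.

Lemma card_coset_diff H X a : subgrp H -> {subset X <= translate a H} ->
  (#|` translate a H `\` X| + #|` X| = #|` H|)%N.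
Proof.
move=> sH h; rewrite -(card_translate a H) cardfsDS; last exact/fsubsetP.
by rewrite subnK // card_fsubset.
Qed.

(** The heart of the proof.  If a coset of [H] meets [A + B] without being
    contained in it, then adjoining the part of [A + B] coming from one or two
    pairs of [H]-cosets to the convergent gives a convergent with a smaller
    group. *)
Lemma convergent_smaller A B C H :
  (forall X Y, X != fset0 -> Y != fset0 ->
     (#|` X :+: Y| < #|` A :+: B|)%N -> kneser_bound X Y) ->
  convergent A B C H -> ~ periodic H (A :+: B) ->
  exists C' H', convergent A B C' H' /\ (#|` H'| < #|` H|)%N.
Proof.
move=> IH [sH pC CAB C0 hC] npAB.
have [a [b [h [aA bB hH habh]]]] : exists a b h,
    [/\ a \in A, b \in B, h \in H & a + b + h \notin A :+: B].
  apply: NNPP => hn; apply: npAB => _ h /sumsetP[a [b [aA bB ->]]] hH.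
  by apply/negPn/negP => hN; apply: hn; exists a, b, h.
set T := translate (a + b) H; set E := A `|` B.
have TC x : x \in T -> x \in C -> False.
  rewrite in_translate => hx xC; case/negP: habh; apply: CAB.
  rewrite -(periodic_eq sH pC (x := x)) //.
  have -> : x - (a + b + h) = (x - (a + b)) - h by zmod.
  by apply: subgrpB.
have TnAB : ~ {subset T <= A :+: B}.
  by move=> hT; case/negP: habh; apply: hT; rewrite in_translate addrC addKr.
(* Adjoining to [C] a piece [U] of the coset [T]. *)
have extend U K : subgrp K -> {subset K <= H} -> periodic K U ->
    {subset U <= A :+: B} -> {subset U <= T} ->
    (#|` A `&` B| + #|` E :+: K| <= #|` C| + #|` U| + #|` K|)%N ->
    convergent A B (C `|` U) K.
  move=> sK KH pU UAB UT hU; split => //.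
  - by apply: periodicU => //; apply: periodic_sub pC.
  - by move=> x; rewrite inE => /orP[/CAB|/UAB].
  - by have /fset0Pn[c cC] := C0; apply/fset0Pn; exists c; rewrite inE cC.
  - by rewrite card_disjU // => x h1 /UT /TC; apply.
set Ta := translate a H; set Tb := translate b H.
set A1 := A `&` Ta; set B1 := B `&` Tb; set A2 := A `&` Tb; set B2 := B `&` Ta.
have aTa : a \in Ta by rewrite in_translate subrr subgrp0.
have bTb : b \in Tb by rewrite in_translate subrr subgrp0.
have sI X Y : {subset X `&` Y <= X} /\ {subset X `&` Y <= Y}.
  by split=> x; rewrite inE => /andP[].
have TaE : {subset Ta <= E :+: H}.
  move=> x; rewrite in_translate => hx; apply/closureP => //; exists a => //.
  by rewrite inE aA.
have TbE : {subset Tb <= E :+: H}.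
  move=> x; rewrite in_translate => hx; apply/closureP => //; exists b => //.
  by rewrite inE bB orbT.
have cl X K c : {subset K <= H} -> {subset X `&` translate c H :+: K <= translate c H}.
  move=> KH; apply: closure_sub; last by apply sI.
  by apply: periodic_sub KH _; apply: periodic_coset.
have subT X Y c d : c + d = a + b ->
    {subset X `&` translate c H :+: (Y `&` translate d H) <= T}.
  move=> ecd; apply/fsubsetP/sumset_sub => x y; rewrite !inE !in_translate.
  move=> /andP[_ hx] /andP[_ hy].
  have -> : x + y - (a + b) = (x - c) + (y - d) by rewrite -ecd; zmod.
  exact: subgrpD.
have subAB X Y : {subset A `&` X :+: (B `&` Y) <= A :+: B}.
  by apply/fsubsetP/sumsetSS; apply/fsubsetP; apply sI.
(* The induction hypothesis for the parts of [A] and [B] in two cosets. *)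
have knes c d : c + d = a + b -> forall x y, x \in A `&` translate c H ->
    y \in B `&` translate d H ->
    let U := A `&` translate c H :+: (B `&` translate d H) in
    [/\ subgrp (stab U), {subset stab U <= H}, (#|` stab U| < #|` H|)%N &
        kneser_bound (A `&` translate c H) (B `&` translate d H)].
  move=> ecd x y xA yB U.
  have U0 : U != fset0 by apply: (@mem_neq0 _ _ (x + y)); apply: mem_sumset.
  have sU := stab_subgrp U0.
  have UH : {subset stab U <= H}.
    apply: stab_same_coset => //; apply: same_coset_sumset => //;
      exact: (same_coset_sub (proj2 (sI _ _)) (@same_coset_translate _ H _ sH)).
  split => //.
    rewrite ltnNge; apply/negP => hle; have eU := eq_fsub_card UH hle.
    apply: TnAB => z zT; apply: (subAB (translate c H) (translate d H)).
    rewrite -/U (periodic_eq sU (@stab_periodic _ U) (y := x + y)) ?mem_sumset //.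
    rewrite eU; have := subT _ _ _ _ ecd _ (mem_sumset xA yB); move: zT.
    rewrite !in_translate => h1 h2.
    have -> : z - (x + y) = (z - (a + b)) - (x + y - (a + b)) by zmod.
    exact: subgrpB.
  apply: IH; [exact: mem_neq0 xA|exact: mem_neq0 yB|].
  have : (#|` U| + #|` C| <= #|` A :+: B|)%N.
    rewrite -card_disjU => [|z /(subT _ _ _ _ ecd)]; last exact: TC.
    by apply: card_fsubset => z; rewrite inE => /orP[/subAB|/CAB].
  by move: C0; rewrite -cardfs_gt0 -/U; clia.
have mI X Y x : x \in X -> x \in Y -> x \in X `&` Y by rewrite inE => -> ->.
have [sH1 H1H ltH1 k1] := knes a b erefl a b (mI _ _ _ aA aTa) (mI _ _ _ bB bTb).
set U := A `&` Ta :+: (B `&` Tb) in sH1 H1H ltH1; set H1 := stab U in sH1 H1H ltH1.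
rewrite /kneser_bound -/U -/H1 -/A1 -/B1 in k1.
have inTa K x : subgrp K -> {subset K <= H} -> x \in Ta -> x \in E :+: K ->
    (x \in A1 :+: K) || (x \in B2 :+: K).
  move=> sK KH xT; rewrite sumsetUl inE => /orP[] hx; rewrite /A1 /B2.
    by rewrite closure_coset.
  by apply/orP; right; apply: closure_coset xT.
have inTb K x : subgrp K -> {subset K <= H} -> x \in Tb -> x \in E :+: K ->
    (x \in B1 :+: K) || (x \in A2 :+: K).
  move=> sK KH xT; rewrite sumsetUl inE => /orP[] hx; rewrite /A2 /B1.
    by apply/orP; right; apply: closure_coset xT.
  by rewrite closure_coset.
have [cv1|ncv1] := classic (convergent A B (C `|` U) H1); first by exists (C `|` U), H1.
have big1 : (#|` E :+: H| + #|` U| + #|` H1| < #|` E :+: H1| + #|` H|)%N.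
  rewrite ltnNge; apply/negP => hle; apply: ncv1; apply: extend => //.
  - exact: stab_periodic.
  - exact: subAB.
  - exact: subT.
  - by move: hC; rewrite -/E; clia.
have cdiff c X Y : {subset X <= translate c H} -> {subset Y <= translate c H} ->
    (#|` H| <= #|` translate c H `\` (X `|` Y)| + #|` X| + #|` Y|)%N.
  move=> hX hY; have sb : {subset X `|` Y <= translate c H}.
    by move=> x; rewrite inE => /orP[/hX|/hY].
  by have := card_coset_diff sH sb; have := cardfsUI X Y; clia.
(* The holes left by the closure of [E] in the two cosets. *)
pose P K L := Ta `\` ((A1 :+: K) `|` (B2 :+: L)).
pose Q K L := Tb `\` ((B1 :+: K) `|` (A2 :+: L)).
have PE K L M x : subgrp M -> {subset M <= H} -> {subset M <= K} -> {subset M <= L} ->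
    x \in P K L -> x \in E :+: M -> False.
  move=> sM MH MK ML; rewrite !in_fsetD !in_fsetU negb_or.
  move=> /andP[/andP[h1 h2] xT] /(inTa _ _ sM MH xT) /orP[] hx.
    by case/negP: h1; move: x hx {h2 xT}; apply/fsubsetP/sumsetSS => //; apply/fsubsetP.
  by case/negP: h2; move: x hx {h1 xT}; apply/fsubsetP/sumsetSS => //; apply/fsubsetP.
have QE K L M x : subgrp M -> {subset M <= H} -> {subset M <= K} -> {subset M <= L} ->
    x \in Q K L -> x \in E :+: M -> False.
  move=> sM MH MK ML; rewrite !in_fsetD !in_fsetU negb_or.
  move=> /andP[/andP[h1 h2] xT] /(inTb _ _ sM MH xT) /orP[] hx.
    by case/negP: h1; move: x hx {h2 xT}; apply/fsubsetP/sumsetSS => //; apply/fsubsetP.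
  by case/negP: h2; move: x hx {h1 xT}; apply/fsubsetP/sumsetSS => //; apply/fsubsetP.
have PH K L : {subset P K L <= E :+: H}.
  by move=> x; rewrite in_fsetD => /andP[_ /TaE].
have QH K L : {subset Q K L <= E :+: H}.
  by move=> x; rewrite in_fsetD => /andP[_ /TbE].
have holeP K L M : subgrp M -> {subset M <= H} -> {subset M <= K} -> {subset M <= L} ->
    (#|` E :+: M| + #|` P K L| <= #|` E :+: H|)%N.
  by move=> sM MH MK ML; apply: closure_hole => // x; apply: PE.
have holeQ K L M : subgrp M -> {subset M <= H} -> {subset M <= K} -> {subset M <= L} ->
    (#|` E :+: M| + #|` Q K L| <= #|` E :+: H|)%N.
  by move=> sM MH MK ML; apply: closure_hole => // x; apply: QE.
have cardP K : {subset K <= H} ->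
    (#|` H| <= #|` P K K| + #|` A1 :+: K| + #|` B2 :+: K|)%N.
  by move=> KH; apply: cdiff; apply: cl.
have cardQ K : {subset K <= H} ->
    (#|` H| <= #|` Q K K| + #|` B1 :+: K| + #|` A2 :+: K|)%N.
  by move=> KH; apply: cdiff; apply: cl.
have ltB : (#|` B1 :+: H1| < #|` B2 :+: H1|)%N.
  have := holeP H1 H1 H1 sH1 H1H (fun _ => id) (fun _ => id).
  by have := cardP _ H1H; clia.
have ltA : (#|` A1 :+: H1| < #|` A2 :+: H1|)%N.
  have := holeQ H1 H1 H1 sH1 H1H (fun _ => id) (fun _ => id).
  by have := cardQ _ H1H; clia.
have TaTb x : x \in Ta -> x \in Tb -> False.
  rewrite !in_translate => h1 h2.
  suff eT : Ta = Tb by move: ltB; rewrite /B1 /B2 eT ltnn.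
  apply/fsetP => y; rewrite !in_translate.
  have -> : y - b = (y - a) + ((x - b) - (x - a)) by zmod.
  by apply/esym/subgrpDr => //; apply: subgrpB.
have clos0 K X Y : (#|` X :+: K| < #|` Y :+: K|)%N -> exists x, x \in Y.
  have [-> |[y yY] _] := fset_0Vmem Y; last by exists y.
  suff -> : fset0 :+: K = fset0 by rewrite cardfs0.
  by apply/fsetP => x; rewrite in_fset0; apply/negP => /sumsetP[? [? []]]; rewrite in_fset0.
have [x2 x2A] := clos0 _ _ _ ltA; have [y2 y2B] := clos0 _ _ _ ltB.
have [sH2 H2H ltH2 k2] := knes b a (addrC b a) x2 y2 x2A y2B.
rewrite -/Ta -/Tb -/A2 -/B2 in sH2 H2H ltH2 k2.
set V := A2 :+: B2 in sH2 H2H ltH2; set H2 := stab V in sH2 H2H ltH2.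
rewrite /kneser_bound -/V -/H2 in k2.
have [cv2|ncv2] := classic (convergent A B (C `|` V) H2); first by exists (C `|` V), H2.
have VT : {subset V <= T} by apply: subT; rewrite addrC.
have UT : {subset U <= T} by apply: subT.
have big2 : (#|` E :+: H| + #|` V| + #|` H2| < #|` E :+: H2| + #|` H|)%N.
  rewrite ltnNge; apply/negP => hle; apply: ncv2; apply: extend => //.
  - exact: stab_periodic.
  - exact: subAB.
  - by move: hC; rewrite -/E; clia.
have holePQ K : subgrp K -> {subset K <= H} ->
    (#|` E :+: K| + #|` P K K| + #|` Q K K| <= #|` E :+: H|)%N.
  move=> sK KH; rewrite -addnA -card_disjU => [|x].
    apply: closure_hole => // x; rewrite in_fsetU => /orP[]; [exact: PH|exact: QH| |].
      exact: PE.
    exact: QE.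
  by rewrite !in_fsetD => /andP[_ h1] /andP[_ h2]; apply: TaTb h1 h2.
have sum1 : (#|` H| < #|` A2 :+: H1| + #|` B2 :+: H1|)%N.
  by have := holePQ _ sH1 H1H; have := cardP _ H1H; have := cardQ _ H1H; clia.
have sum2 : (#|` H| < #|` A1 :+: H2| + #|` B1 :+: H2|)%N.
  by have := holePQ _ sH2 H2H; have := cardP _ H2H; have := cardQ _ H2H; clia.
(* By counting, the closures under [H1 + H2] of the two pieces lying in the
   coset of [a], or of the two pieces lying in the coset of [b], meet. *)
have meet : (exists2 x, x \in A2 :+: H2 & x \in B1 :+: H1) \/
            (exists2 x, x \in A1 :+: H1 & x \in B2 :+: H2).
  have sS := subgrp_sumset sH1 sH2; set S := H1 :+: H2 in sS.
  have SH : {subset S <= H}.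
    by apply/fsubsetP/sumset_sub => x y /H1H h1 /H2H; apply: subgrpD.
  have H1S : {subset H1 <= S} by move=> x; apply: mem_closure.
  have H2S : {subset H2 <= S} by move=> x; rewrite /S sumsetC; apply: mem_closure.
  have mono X K : {subset K <= S} -> (#|` X :+: K| <= #|` X :+: S|)%N.
    by move=> KS; apply/fsubset_leq_card/sumsetSS => //; apply/fsubsetP.
  have swap X Y K L z : subgrp K -> subgrp L -> S = K :+: L ->
      z \in X :+: S -> z \in Y :+: S -> exists2 x, x \in X :+: K & x \in Y :+: L.
    move=> sK sL -> /sumsetP[x [_ [xX /sumsetP[k [l [kK lL ->]]] ->]]].
    move=> /sumsetP[y [_ [yY /sumsetP[k' [l' [k'K l'L ->]]] e]]].
    exists (x + (k - k')); first by rewrite mem_sumset // subgrpB.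
    have -> : x + (k - k') = y + (l' - l).
      have -> : x + (k - k') = x + (k + l) - (k' + l) by zmod.
      by rewrite e; zmod.
    by rewrite mem_sumset // subgrpB.
  apply: NNPP => /not_or_and[n1 n2].
  have d1 : (#|` A2 :+: S| + #|` B1 :+: S| <= #|` H|)%N.
    rewrite -card_disjU => [|z h1 h2]; last first.
      by apply: n1; apply: (swap A2 B1 H2 H1 z sH2 sH1 _ h1 h2); rewrite /S sumsetC.
    rewrite -(card_translate b H); apply: card_fsubset => x; rewrite in_fsetU.
    by case/orP; apply: cl.
  have d2 : (#|` A1 :+: S| + #|` B2 :+: S| <= #|` H|)%N.
    rewrite -card_disjU => [|z h1 h2]; last first.
      by apply: n2; apply: (swap _ _ H1 H2 z).
    rewrite -(card_translate a H); apply: card_fsubset => x; rewrite in_fsetU.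
    by case/orP; apply: cl.
  have := mono A2 _ H1S; have := mono B2 _ H1S; have := mono A1 _ H2S.
  by have := mono B1 _ H2S; clia.
set N := H1 `&` H2.
have sN : subgrp N := subgrpI sH1 sH2.
have NH1 : {subset N <= H1} by move=> x; rewrite in_fsetI => /andP[].
have NH2 : {subset N <= H2} by move=> x; rewrite in_fsetI => /andP[].
have NH : {subset N <= H} by move=> x /NH1 /H1H.
have UVT : {subset U `|` V <= T} by move=> x; rewrite in_fsetU => /orP[/UT|/VT].
have mem_per X Y K x w : subgrp K -> periodic K (X :+: Y) ->
    x \in Y :+: K -> w - x \in X :+: K -> w \in X :+: Y.
  move=> sK pXY /sumsetP[y [k [yY kK ->]]] /sumsetP[x' [l [xX lK e]]].
  have -> : w = x' + y + (k + l) by rewrite -(subrK (y + k) w) e; zmod.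
  by apply: pXY; [apply: mem_sumset|apply: subgrpD].
have pU : periodic H1 (A1 :+: B1) by apply: stab_periodic.
have pV : periodic H2 (A2 :+: B2) by apply: stab_periodic.
(* Subtracting a common point embeds what [U] and [V] miss of their coset into
   the holes of [E]. *)
have [R [hR hE]] : exists R : {fset G}, (#|` T `\` (U `|` V)| <= #|` R|)%N /\
    (#|` E :+: N| + #|` R| <= #|` E :+: H|)%N.
  case: meet => -[x h1 h2]; [exists (P H1 H2)|exists (Q H1 H2)]; split.
  - rewrite -(card_translate (- x)); apply: card_fsubset => z.
    rewrite in_translate opprK !in_fsetD !in_fsetU !negb_or => /andP[/andP[zU zV] zT].
    apply/andP; split; first (apply/andP; split).
    + by apply: contra zU => hz; apply: (mem_per A1 B1 H1 x (z + x) sH1 pU h2); rewrite addrK.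
    + rewrite /V sumsetC in zV; apply: contra zV => hz.
      by apply: (mem_per B2 A2 H2 x (z + x) sH2 _ h1); rewrite ?addrK // sumsetC.
    + move: zT (cl _ _ b H1H _ h2); rewrite !in_translate => h3 h4.
      have -> : z - a = (z + x - (a + b)) - (x - b) by zmod.
      exact: subgrpB.
  - by apply: holeP.
  - rewrite -(card_translate (- x)); apply: card_fsubset => z.
    rewrite in_translate opprK !in_fsetD !in_fsetU !negb_or => /andP[/andP[zU zV] zT].
    apply/andP; split; first (apply/andP; split).
    + rewrite /U sumsetC in zU; apply: contra zU => hz.
      by apply: (mem_per B1 A1 H1 x (z + x) sH1 _ h1); rewrite ?addrK // sumsetC.
    + by apply: contra zV => hz; apply: (mem_per A2 B2 H2 x (z + x) sH2 pV h2); rewrite addrK.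
    + move: zT (cl _ _ a H1H _ h1); rewrite !in_translate => h3 h4.
      have -> : z - b = (z + x - (a + b)) - (x - a) by zmod.
      exact: subgrpB.
  - by apply: holeQ.
exists (C `|` (U `|` V)), N; split; last first.
  by apply: leq_ltn_trans ltH1; apply: card_fsubset.
apply: extend => //.
- by apply: periodicU; [apply: periodic_sub NH1 _|apply: periodic_sub NH2 _]; apply: stab_periodic.
- by move=> x; rewrite in_fsetU => /orP[]; apply: subAB.
- by have := card_coset_diff sH UVT; move: hC; rewrite -/E -/T; clia.
Qed.

(** The bound only depends on the closures of [A] and [B] under the period of
    [A + B]. *)
Lemma kneser_closure A B : A != fset0 -> B != fset0 ->
  let F := stab (A :+: B) in
  A :+: F :+: (B :+: F) = A :+: B.
Proof.
move=> A0 B0 F; have sF : subgrp F by apply/stab_subgrp/sumset_neq0.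
rewrite -sumsetA [F :+: _]sumsetC -!sumsetA (subgrp_sumsetid sF) sumsetA.
by rewrite (periodic_closureE sF (@stab_periodic _ _)).
Qed.

Lemma convergent_bound A B C H : (forall C' H', convergent A B C' H' -> (#|` H| <= #|` H'|)%N) ->
  (forall X Y, X != fset0 -> Y != fset0 ->
     (#|` X :+: Y| < #|` A :+: B|)%N -> kneser_bound X Y) ->
  convergent A B C H -> (#|` A| + #|` B| <= #|` A :+: B| + #|` stab (A :+: B)|)%N.
Proof.
move=> hmin IH hC; have pH : periodic H (A :+: B).
  apply: NNPP => /(convergent_smaller IH hC)[C' [H' [/hmin h1 h2]]].
  by rewrite ltnNge h1 in h2.
have [sH _ CAB C0 hc] := hC.
have [c cC] := fset0Pn _ C0; have S0 := mem_neq0 (CAB _ cC).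
have := card_fsubset CAB; have := card_fsubset (sub_stab S0 pH).
have := leq_card_closure (A `|` B) sH; have := cardfsUI A B; clia.
Qed.

End Kneser.

Section KneserTheorem.
Variable G : zmodType.
Implicit Types (A B C X Y H F : {fset G}) (a b c x y : G).

Theorem kneser A B : A != fset0 -> B != fset0 -> kneser_bound A B.
Proof.
have [n] := ubnP #|` A :+: B|; elim: n A B => // n IHn A B.
have [m] := ubnP #|` A :+: stab (A :+: B)|; elim: m A B => // m IHm A B ltm ltn A0 B0.
set F := stab (A :+: B) in ltm; have sF : subgrp F by apply/stab_subgrp/sumset_neq0.
have eAB := kneser_closure A0 B0; rewrite -/F in eAB.
set A' := A :+: F in ltm eAB; set B' := B :+: F in eAB.
have FF X : X :+: F :+: F = X :+: F by rewrite -sumsetA (subgrp_sumsetid sF).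
have A'0 : A' != fset0 by apply: sumset_neq0 => //; apply: subgrp_neq0.
have B'0 : B' != fset0 by apply: sumset_neq0 => //; apply: subgrp_neq0.
suff : (#|` A'| + #|` B'| <= #|` A' :+: B'| + #|` F|)%N by rewrite eAB.
have pA : periodic F A' := periodic_closure sF.
have [cA|ncA] := classic (same_coset F A').
  by have := same_coset_card cA; have := leq_card_sumsetr B' A'0; clia.
have [a [a' [aA a'A na]]] : exists a a', [/\ a \in A', a' \in A' & a' - a \notin F].
  apply: NNPP => hn; apply: ncA => x y xA yA; apply/negPn/negP => h.
  by apply: hn; exists y, x.
have [b bB nb] : exists2 b, b \in B' & b + (a' - a) \notin B'.
  apply: NNPP => hn; case/negP: na; rewrite /F -eAB; apply/stabP.
    exact: sumset_neq0.
  move=> _ /sumsetP[x [y [xA yB ->]]]; rewrite -addrA mem_sumset //.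
  by apply/negPn/negP => h; apply: hn; exists y.
(* After a translation, [a] lies in both sets and [a'] in the first only. *)
set B1 := translate (a - b) B'.
have eB1 : #|` B1| = #|` B'| by rewrite card_translate.
have eS : A' :+: B1 = translate (a - b) (A' :+: B') by rewrite sumset_translater.
have S0 : A' :+: B' != fset0 by apply: sumset_neq0.
have stS : stab (A' :+: B1) = F by rewrite eS (stab_translate _ S0) eAB.
have cS : #|` A' :+: B1| = #|` A :+: B| by rewrite eS card_translate eAB.
have aI : a \in A' `&` B1.
  by rewrite in_fsetI aA in_translate (_ : a - _ = b) //; zmod.
have pB1 : periodic F B1 by apply/periodic_translate/periodic_closure.
have a'I : a' \notin A' `&` B1.
  by rewrite in_fsetI in_translate a'A (_ : a' - _ = b + (a' - a)) //; zmod.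
have I0 := mem_neq0 aI.
have U0 : A' `|` B1 != fset0 by apply: (@mem_neq0 _ _ a); rewrite in_fsetU aA.
rewrite -eB1 eAB -cS -{}stS; set C := (A' `&` B1) :+: (A' `|` B1).
have CS : {subset C <= A' :+: B1}.
  apply/fsubsetP/sumset_sub => x y; rewrite in_fsetI in_fsetU.
  move=> /andP[xA xB] /orP[yA|yB]; last exact: mem_sumset.
  by rewrite addrC mem_sumset.
have C0 : C != fset0 by apply: sumset_neq0.
have kC : kneser_bound (A' `&` B1) (A' `|` B1).
  have := card_fsubset CS; rewrite leq_eqVlt => /orP[/eqP eC|ltC].
    have e : C = A' :+: B1 by apply: eq_fsub_card; rewrite ?eC.
    have eF : stab C = F by rewrite e eS (stab_translate _ S0) eAB.
    apply: IHm => //; rewrite -/C ?eC ?cS // eF.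
    rewrite (periodic_closureE sF); last exact: periodicI.
    have : (A' `&` B1) `<` A'.
      by rewrite fproperE fsubsetIl; apply/fsubsetPn; exists a'.
    by move/fproper_ltn_card => h; apply: leq_trans h _; rewrite -ltnS.
  by rewrite cS in ltC; apply: (IHn _ _ _ I0 U0); apply: leq_trans ltC _; rewrite -ltnS.
have [[C1 H1] /= hC1 hmin] : exists2 p : {fset G} * {fset G}, convergent A' B1 p.1 p.2 &
    forall q, convergent A' B1 q.1 q.2 -> (#|` p.2| <= #|` q.2|)%N.
  apply: (@ex_smallest _ (fun p : {fset G} * {fset G} => #|` p.2|)).
  exists (C, stab C); split => //=.
  - exact: stab_subgrp.
  - exact: stab_periodic.
  - move: kC; rewrite /kneser_bound -/C.
    have := leq_card_closure (A' `&` B1) (stab_subgrp C0) => h1 h2.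
    by apply: leq_trans h2; rewrite leq_add2r.
apply: (convergent_bound _ _ hC1) => [C' H' h|X Y X0 Y0]; first exact: hmin (C', H') h.
rewrite cS => hXY; apply: (IHn _ _ _ X0 Y0).
by apply: leq_trans hXY _; rewrite -ltnS.
Qed.

(** The form used below: the period [F] of [A + B] satisfies
    [|F + B| - |F| <= |A + B| - |A + F|]. *)
Lemma kneser_leq A B : A != fset0 -> B != fset0 ->
  let F := stab (A :+: B) in
  (#|` A :+: F| + #|` F :+: B| <= #|` A :+: B| + #|` F|)%N.
Proof. by move=> A0 B0 /=; rewrite [stab _ :+: B]sumsetC; apply: kneser. Qed.

Lemma kneser_aperiodic A B : A != fset0 -> B != fset0 -> aperiodic (A :+: B) ->
  (#|` A| + #|` B| <= #|` A :+: B| + 1)%N.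
Proof.
move=> A0 B0 /(aperiodic_stab (sumset_neq0 A0 B0)) h.
have := kneser A0 B0; rewrite /kneser_bound h card_triv.
have := leq_card_closure A (@subgrp1 G); have := leq_card_closure B (@subgrp1 G); clia.
Qed.
End KneserTheorem.

(** * Quasi-periodic summands *)

Section QuasiPeriodic.
Variable G : zmodType.
Implicit Types (A B C S U V X Y H K F P : {fset G}) (a b c d g h x y z : G).

(** A quasi-periodic decomposition in the sense of Kemperman, with aperiodic part [S0]. *)
Definition quasi_part H S S0 : Prop :=
  [/\ S0 != fset0, S `\` S0 != fset0, {subset S0 <= S},
      periodic H (S `\` S0) & same_coset H S0].

Definition quasi_periodic S : Prop :=
  exists H S0, [/\ subgrp H, H != triv & quasi_part H S S0].

(** The decomposition of the pair [(A, B)] along [H], expressed inside the group: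
    the fourth clause says that the class of [A0 + B0] has a unique
    representation modulo [H], the last one that [(A, B)] is critical
    modulo [H].  The alternative in the first clause excludes [A = A0], [B = B0]. *)
Definition decomp A B A0 B0 H : Prop :=
  [/\ [/\ subgrp H, H != triv & A `\` A0 != fset0 \/ B `\` B0 != fset0],
      [/\ A0 != fset0, B0 != fset0, {subset A0 <= A} & {subset B0 <= B}],
      [/\ periodic H (A `\` A0), periodic H (B `\` B0), same_coset H A0 & same_coset H B0],
      (forall a b a0 b0, a \in A -> b \in B -> a0 \in A0 -> b0 \in B0 ->
         a + b - (a0 + b0) \in H -> a \in A0 /\ b \in B0) &
      (#|` A :+: B :+: H| + #|` H| = #|` A :+: H| + #|` B :+: H|)%N].

Lemma decompC A B A0 B0 H : decomp A B A0 B0 H -> decomp B A B0 A0 H.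
Proof.
case=> [[sH H1 h0] [A00 B00 sA sB] [pA pB cA cB] hu hc]; split => //.
- by split => //; case: h0; [right|left].
- move=> b a b0 a0 bB aA b0B a0A; rewrite [b + _]addrC [b0 + _]addrC => h.
  by have [] := hu _ _ _ _ aA bB a0A b0B h.
- by rewrite [B :+: A]sumsetC hc addnC.
Qed.

Lemma closure_split A F P : subgrp F -> periodic F P ->
  #|` A :+: F| = (#|` (A `&` P) :+: F| + #|` (A `\` P) :+: F|)%N.
Proof.
move=> sF pP; rewrite -{1}(fsetID P A) sumsetUl card_disjU // => x.
move=> /(closureP _ _ sF)[s]; rewrite in_fsetI => /andP[_ sP] hs.
move=> /(closureP _ _ sF)[t]; rewrite in_fsetD => /andP[tP _] ht.
case/negP: tP; rewrite -(periodic_eq sF pP ht).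
by rewrite (periodic_eq sF pP hs).
Qed.

Lemma closure_one_coset A F : subgrp F -> (#|` A :+: F| < #|` F| + #|` F|)%N ->
  same_coset F A.
Proof.
move=> sF hc x y xA yA; apply/negPn/negP => hxy; move: hc; rewrite ltnNge => /negP; apply.
rewrite -{1}(card_translate x F) -(card_translate y F) -card_disjU => [|z].
  apply: card_fsubset => z; rewrite in_fsetU !in_translate => /orP[] h.
    by apply/closureP => //; exists x.
  by apply/closureP => //; exists y.
rewrite !in_translate => h1 h2; case/negP: hxy.
have -> : x - y = (z - y) - (z - x) by zmod.
exact: subgrpB.
Qed.

Lemma card_closure_coset A F a : subgrp F -> same_coset F A -> a \in A ->
  #|` A :+: F| = #|` F|.
Proof.
move=> sF cA aA; rewrite -(card_translate a F); congr #|` _|; apply/fsetP => x.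
rewrite in_translate; apply/(closureP _ _ sF)/idP => [[s sA hs]|h]; last by exists a.
have -> : x - a = (x - s) + (s - a) by zmod.
by apply: subgrpD => //; apply: cA.
Qed.

Lemma aperiodic0 S d x : aperiodic S -> x \in S -> (forall y, y \in S -> y + d \in S) -> d = 0.
Proof. by move=> aS /mem_neq0 S0; move: aS => /(aperiodicP S0); apply. Qed.

(** If [B] is [B0] plus an [H]-periodic part [B1], then [A + B] is the periodic
    set [A + B1] with [U + B0] adjoined, where [U] consists of the [a] for which
    [a + B0] sticks out.  Kneser's bound for [A + B1], with period [F], leaves so
    little room that [U] lies in one coset of [F] and all the rest is
    [F]-periodic. *)
Lemma quasi_decomp A B B0 H : A != fset0 -> subgrp H -> H != triv ->
  aperiodic (A :+: B) -> (#|` A :+: B| + 1 <= #|` A| + #|` B|)%N ->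
  quasi_part H B B0 -> exists A0 F, decomp A B A0 B0 F.
Proof.
move=> A0 sH H1 aAB hc [B00 B10 sB0 pB1 cB0]; set B1 := B `\` B0 in B10 pB1.
have [b0 b0B] := fset0Pn _ B00; have [b1 b1B] := fset0Pn _ B10.
have [a1 a1A] := fset0Pn _ A0.
set S := A :+: B1; have S0 : S != fset0 by apply: sumset_neq0.
set F := stab S; have sF : subgrp F := stab_subgrp S0.
have pS : periodic F S by apply: stab_periodic.
have HF : {subset H <= F} by apply: sub_stab => //; apply: periodic_sumsetr.
have F1 : F != triv.
  by have [h hH h0] := subgrp_nontriv sH H1; apply: nontriv_subgrp (HF _ hH) h0.
have cB0F : same_coset F B0 by move=> x y xB yB; apply/HF/cB0.
set P := translate (- b0) S; have pP : periodic F P by apply: periodic_translate.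
have inP a b : b \in B0 -> (a \in P) = (a + b \in S).
  move=> bB; rewrite in_translate opprK; apply: (periodic_eq sF pS).
  have -> : a + b0 - (a + b) = b0 - b by zmod.
  exact: cB0F.
set U := A `\` P; set V := A `&` P.
have UA : {subset U <= A} by move=> x; rewrite in_fsetD => /andP[].
have eB : B = B1 `|` B0.
  by apply/fsetP => x; rewrite in_fsetU in_fsetD; case: (boolP (x \in B0)) => [/sB0 ->|_]; rewrite ?orbF.
have disj x : x \in S -> x \in U :+: B0 -> False.
  move=> xS /sumsetP[u [b [uU bB e]]]; move: uU.
  by rewrite in_fsetD (inP _ _ bB) -e xS.
have eAB : A :+: B = S `|` (U :+: B0).
  apply/fsetP => x; rewrite in_fsetU; apply/idP/orP => [|[]].
  - move=> /sumsetP[a [b [aA]]]; rewrite {1}eB in_fsetU => /orP[bB ->|bB ->].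
      by left; apply: mem_sumset.
    have [aP|aP] := boolP (a \in P); first by left; rewrite -inP.
    by right; rewrite mem_sumset // in_fsetD aP.
  - by move: x; apply/fsubsetP/sumsetSS => //; apply: fsubsetDl.
  - by move: x; apply/fsubsetP/sumsetSS => //; apply/fsubsetP.
have cAB : #|` A :+: B| = (#|` S| + #|` U :+: B0|)%N by rewrite eAB card_disjU.
have AB0 : A :+: B != fset0.
  by apply: sumset_neq0 => //; apply: (mem_neq0 (sB0 _ b0B)).
have [u uU] : exists u, u \in U.
  apply/fset0Pn/negP => /eqP U0; case/eqP: H1; apply/eqP.
  move: aAB => /(aperiodic_stab AB0); rewrite eAB U0.
  have -> : fset0 :+: B0 = fset0.
    by apply/fsetP => x; rewrite in_fset0; apply/negP => /sumsetP[? [? []]]; rewrite in_fset0.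
  by rewrite fsetU0 -/F => e; case/eqP: F1.
have kS : (#|` A :+: F| + #|` B1 :+: F| <= #|` S| + #|` F|)%N by apply: kneser.
have splitA := closure_split A sF pP; rewrite -/U -/V in splitA.
have cA : #|` A| = (#|` V| + #|` U|)%N by rewrite -(cardfsID P A).
have cB : #|` B| = (#|` B1| + #|` B0|)%N.
  by rewrite eB card_disjU // => x; rewrite in_fsetD => /andP[/negP].
have V1 := leq_card_closure V sF; have B1c := leq_card_closure B1 sF.
have U0 := mem_neq0 uU.
have UB0 := leq_card_sumsetl U B00; have B0F := same_coset_card cB0F.
have U1 := leq_card_closure U sF.
have cU : same_coset F U by apply: closure_one_coset => //; clia.
have eU := card_closure_coset sF cU uU.
have cUB0 : same_coset F (U :+: B0) by apply: same_coset_sumset.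
have aU : aperiodic (U :+: B0).
  apply/aperiodicP => [|d hd]; first exact: sumset_neq0.
  have ub : u + b0 \in U :+: B0 by apply: mem_sumset.
  have dF : d \in F.
    have -> : d = (u + b0 + d) - (u + b0) by zmod.
    by apply: cUB0 => //; apply: hd.
  apply: (aperiodic0 aAB (x := a1 + b1)); first by rewrite mem_sumset // eB in_fsetU b1B.
  by move=> x; rewrite eAB !in_fsetU => /orP[h|/hd ->]; rewrite ?orbT // pS.
have kU := kneser_aperiodic U0 B00 aU.
have pV : periodic F V by apply: closure_card_periodic => //; clia.
have pB : periodic F B1 by apply: closure_card_periodic => //; clia.
have eVU : A `\` U = V.
  by apply/fsetP => x; rewrite !in_fsetD in_fsetI; case: (x \in A); case: (x \in P).
exists U, F; split => //.
- by split => //; right.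
- by split => //; rewrite eVU.
- move=> a b a0 b' aA bB a0U b'B hab.
  have sS : a + b \in S -> False.
    rewrite (periodic_eq sF pS hab) -inP //.
    by move: a0U; rewrite in_fsetD => /andP[/negP].
  move: bB; rewrite eB in_fsetU => /orP[bB|bB]; first by case: sS; apply: mem_sumset.
  split=> //; rewrite in_fsetD aA andbT; apply/negP; rewrite (inP _ _ bB); exact: sS.
- have -> : A :+: B :+: F = S `|` (U :+: B0 :+: F).
    by rewrite eAB sumsetUl (periodic_closureE sF pS).
  rewrite card_disjU; last first.
    move=> x xS /(closureP _ _ sF)[y yU hy]; apply: (disj y) => //.
    by rewrite -(periodic_eq sF pS hy).
  rewrite (card_closure_coset sF cUB0 (mem_sumset uU b0B)).
  have -> : #|` B :+: F| = (#|` B1| + #|` F|)%N.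
    rewrite eB sumsetUl (periodic_closureE sF pB) card_disjU.
      by rewrite (card_closure_coset sF cB0F b0B).
    move=> x xB /(closureP _ _ sF)[y yB hy].
    have : y \in B1 by rewrite -(periodic_eq sF pB hy).
    by rewrite in_fsetD yB.
  rewrite splitA eU (periodic_closureE sF pV).
  by have := leq_card_closure V sF; rewrite (periodic_closureE sF pV); clia.
Qed.

End QuasiPeriodic.

(** * Arithmetic progressions *)

Section Progressions.
Variable G : zmodType.
Implicit Types (A B C S U V X Y H K F P : {fset G}) (a b c d g h r x y z : G).

Lemma natmulS r n : r *+ n.+1 = r + r *+ n. Proof. exact: mulrS. Qed.

Lemma natmulD r n k : r *+ (n + k) = r *+ n + r *+ k. Proof. exact: mulrnDr. Qed.

Definition prog z r (k : nat) : {fset G} := [fset z + r *+ i | i in iota 0 k].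

Lemma progP z r k x : reflect (exists2 i, (i < k)%N & x = z + r *+ i) (x \in prog z r k).
Proof.
apply: (iffP (imfsetP _ _ _ _)) => -[i /=]; rewrite ?mem_iota => hi ->; exists i => //=.
by rewrite mem_iota.
Qed.

Lemma card_prog z r k :
  (forall i j, (i < j)%N -> (j < k)%N -> r *+ (j - i) != 0) -> #|` prog z r k| = k.
Proof.
move=> h; rewrite card_in_imfset /=; first by rewrite undup_id ?iota_uniq ?size_iota.
move=> i j; rewrite !mem_iota /= !add0n => hi hj /addrI e; apply/eqP/negPn/negP.
rewrite neq_ltn => /orP[] lt.
  by case/negP: (h _ _ lt hj); rewrite mulrnBr ?(ltnW lt) // e subrr.
by case/negP: (h _ _ lt hi); rewrite mulrnBr ?(ltnW lt) // e subrr.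
Qed.

Lemma leq_card_prog z r k : (#|` prog z r k| <= k)%N.
Proof.
apply: leq_trans (leq_imfset_card _ _ _) _ => /=.
by rewrite undup_id ?iota_uniq ?size_iota.
Qed.

(** Taking [#|` S|] as the number of terms rules out repetitions. *)
Definition ap r S : Prop := exists z, S = prog z r #|` S| /\ S != fset0.

Lemma subgrpMn H x n : subgrp H -> x \in H -> x *+ n \in H.
Proof.
move=> sH xH; elim: n => [|n IH]; first by rewrite mulr0n subgrp0.
by rewrite natmulS subgrpD.
Qed.

(** If every element of [S] but [z] has its predecessor in [S], then following
    [S] from [z] gives a progression, and what remains is stable. *)
Lemma path_split S r z : z \in S -> z - r \notin S ->
  (forall x, x \in S -> x != z -> x - r \in S) ->
  exists S0, [/\ z \in S0, {subset S0 <= S}, S0 = prog z r #|` S0| &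
                 forall x, x \in S `\` S0 -> x - r \in S `\` S0].
Proof.
move=> zS zr hS; pose Q k := all (fun i => z + r *+ i \in S) (iota 0 k).
have QP k : reflect (forall i, (i < k)%N -> z + r *+ i \in S) (Q k).
  apply: (iffP allP) => h i; last by rewrite mem_iota => /h.
  by move=> hi; apply: h; rewrite mem_iota.
have inj k : Q k -> forall i j, (i < j)%N -> (j < k)%N -> r *+ (j - i) != 0.
  move=> /QP hQ i j ij jk; apply: contra zr => /eqP e.
  have -> : z - r = z + r *+ (j - i).-1.
    have e' : r + r *+ (j - i).-1 = 0 by rewrite -natmulS prednK ?subn_gt0.
    by rewrite -[z - r]addr0 -e'; zmod.
  by apply: hQ; move: ij jk; clia.
have cQ k : Q k -> #|` prog z r k| = k by move=> /inj; apply: card_prog.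
have sQ k : Q k -> {subset prog z r k <= S} by move=> /QP hQ x /progP[i hi ->]; apply: hQ.
have [||k Qk kmax] := @ex_maxnP Q #|` S|.
- by exists 1%N; apply/QP => i; case: i => // _; rewrite mulr0n addr0.
- by move=> k Qk; rewrite -{1}(cQ _ Qk); apply: card_fsubset; apply: sQ.
have Q1 : Q 1%N by apply/QP => i; case: i => // _; rewrite mulr0n addr0.
have k0 := kmax _ Q1.
have nk : z + r *+ k \notin S.
  apply/negP => h; suff /kmax : Q k.+1 by rewrite ltnn.
  by apply/QP => i; rewrite ltnS leq_eqVlt => /orP[/eqP-> //|]; apply/QP.
have zS0 : z \in prog z r k by apply/progP; exists 0%N; rewrite // mulr0n addr0.
exists (prog z r k); split => //; [exact: sQ|by rewrite cQ|].
move=> x; rewrite !in_fsetD => /andP[xN xS].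
have xz : x != z by apply: contraNneq xN => ->.
rewrite hS // andbT; apply: contra xN => /progP[i hi e].
have ex : x = z + r *+ i.+1 by rewrite natmulS -[x](subrK r) e; zmod.
move: hi; rewrite leq_eqVlt => /orP[/eqP eik|hi]; last by apply/progP; exists i.+1.
by case/negP: nk; rewrite -eik -ex.
Qed.

(** A set that grows by at most one element under [x |-> {x, x + r}] is a
    progression, or quasi-periodic with respect to a group containing [r]. *)
Lemma ap_or_quasi_periodic S r : r != 0 -> (#|` S `|` translate r S| <= #|` S| + 1)%N ->
  ~ (forall x, x \in S -> x + r \in S) -> ap r S \/ quasi_periodic S.
Proof.
move=> r0 hc nst.
have cD : (#|` S `\` translate r S| <= 1)%N.
  have := cardfsUI S (translate r S); have := cardfsID (translate r S) S.
  by rewrite card_translate; clia.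
have [z zD] : exists z, z \in S `\` translate r S.
  apply/fset0Pn/negP; rewrite fsetD_eq0 => /fsubsetP h; apply: nst.
  have e : S = translate r S by apply: eq_fsub_card => //; rewrite card_translate.
  by move=> x xS; rewrite e in_translate addrK.
have hz x : x \in S -> x != z -> x - r \in S.
  move=> xS; apply: contraNT => hx; move: cD; rewrite leq_eqVlt ltnS leqn0.
  have xD : x \in S `\` translate r S by rewrite in_fsetD in_translate hx.
  case/orP => [/cardfs1P[y e]|/eqP/cardfs0_eq e]; last by rewrite e in_fset0 in xD.
  by move: xD zD; rewrite e !in_fset1 => /eqP-> /eqP->.
move: zD; rewrite in_fsetD in_translate => /andP[zr zS].
have [S0 [zS0 sS0 eS0 st]] := path_split zS zr hz.
have [S1|S1] := eqVneq (S `\` S0) fset0.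
  left; exists z; split; last exact: mem_neq0 zS.
  suff -> : S = S0 by [].
  apply/eqP; rewrite eqEfsubset -fsetD_eq0 S1 eqxx /=; exact/fsubsetP.
right; have sH := stab_subgrp S1; set H := stab _ in sH.
have rH : r \in H.
  by rewrite -(subgrpNE _ sH); apply/stabP => // x /st.
exists H, S0; split => //; first exact: nontriv_subgrp rH r0.
split => //; [exact: mem_neq0 zS0|exact: stab_periodic|].
move=> x y; rewrite eS0 => /progP[i _ ->] /progP[j _ ->].
have -> : z + r *+ i - (z + r *+ j) = r *+ i - r *+ j by zmod.
by rewrite subgrpB ?subgrpMn.
Qed.

(** Removing the first term, [B = {0, r} + B'], and Kneser's bound for
    [(A + {0, r}) + B'] shows that [A] grows by at most one element. *)
Lemma ap_summand A B r : A != fset0 -> ap r B -> (1 < #|` B|)%N -> aperiodic (A :+: B) ->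
  (#|` A :+: B| + 1 <= #|` A| + #|` B|)%N -> ap r A \/ quasi_periodic A.
Proof.
move=> A0 [z [eB B0]] B1 aAB hc.
have AB0 : A :+: B != fset0 by apply: sumset_neq0.
have r0 : r != 0.
  apply: contraTneq B1 => er; rewrite -leqNgt -(cardfs1 z); apply: card_fsubset => x.
  by rewrite eB er => /progP[i _ ->]; rewrite mul0rn addr0 in_fset1.
apply: ap_or_quasi_periodic => //; last first.
  move=> st; case/eqP: r0; move: aAB => /(aperiodicP AB0); apply => x.
  by move=> /sumsetP[a [b [aA bB ->]]]; rewrite addrAC mem_sumset // st.
set n := #|` B| in eB B1 hc; pose B' := prog z r n.-1.
have B'0 : B' != fset0.
  by apply: (@mem_neq0 _ _ z); apply/progP; exists 0%N; rewrite ?mulr0n ?addr0 //; move: B1; clia.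
have cB' : #|` B'| = n.-1.
  have sB : {subset B <= B' `|` [fset z + r *+ n.-1]}.
    move=> x; rewrite {1}eB => /progP[i hi ->]; rewrite in_fsetU in_fset1.
    have [->|ne] := eqVneq i n.-1; first by rewrite eqxx orbT.
    by apply/orP; left; apply/progP; exists i => //; move: hi ne; clia.
  have := card_fsubset sB; have := cardfsUI B' [fset z + r *+ n.-1].
  have : (#|` B'| <= n.-1)%N.
    exact: leq_card_prog.
  by rewrite cardfs1 -/n; clia.
have eS : A :+: B = (A `|` translate r A) :+: B'.
  rewrite sumsetUl sumset_translatel -sumset_translater -sumsetUr; congr (_ :+: _).
  apply/fsetP => x; rewrite {1}eB in_fsetU in_translate; apply/progP/orP => [[i hi ->]|].
    have [e|ne] := eqVneq i n.-1; last first.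
      by left; apply/progP; exists i => //; move: hi ne; clia.
    right; apply/progP; exists i.-1; first by move: hi B1; rewrite e; clia.
    have i0 : (0 < i)%N by move: B1; rewrite e; clia.
    by rewrite -[in LHS](prednK i0) natmulS; zmod.
  case=> /progP[i hi e]; first by exists i => //; move: hi; clia.
  exists i.+1; first by move: hi; clia.
  by rewrite natmulS -[x](subrK r) e; zmod.
have X0 : A `|` translate r A != fset0 by rewrite fsetU_eq0 negb_and A0.
have := kneser_aperiodic X0 B'0; rewrite -eS cB' => /(_ aAB).
by move: hc B1; rewrite -/n; clia.
Qed.

Lemma prog_mod z r n k : (0 < n)%N -> r *+ n = 0 -> {subset prog z r k <= prog z r n}.
Proof.
move=> n0 rn x /progP[i _ ->]; apply/progP; exists (i %% n)%N; first exact: ltn_pmod.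
by rewrite {1}(divn_eq i n) natmulD mulnC mulrnA rn mul0rn add0r.
Qed.

Lemma ap_arith_prog r S : ap r S -> order_ge r #|` S| -> arith_prog r S.
Proof.
move=> [z [eS S0]] ho; exists (z - r), #|` S|; split => //; first by rewrite cardfs_gt0.
rewrite {1}eS; apply/fsetP => x; apply/progP/imfsetP => /= -[i hi ->].
  by exists i.+1; rewrite ?mem_iota //= natmulS; zmod.
move: hi; rewrite mem_iota add1n => /andP[i1 i2].
exists i.-1; first by move: i1 i2; clia.
by rewrite -[in LHS](prednK i1) natmulS; zmod.
Qed.

(** The order of the difference is large enough because [A + B] is contained in
    a coset of the cyclic group it generates. *)
Lemma ap_elementary_II A B r : ap r A -> ap r B ->
  (#|` A| + #|` B| <= #|` A :+: B| + 1)%N -> elementary_II A B.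
Proof.
move=> hA hB hc; have [z [eA A0]] := hA; have [y [eB B0]] := hB.
have ho n : (0 < n)%N -> r *+ n = 0 -> (#|` A :+: B| <= n)%N.
  move=> n0 rn; apply: leq_trans (leq_card_prog (z + y) r n).
  apply: card_fsubset => x /sumsetP[a [b [aA bB ->]]].
  apply: (@prog_mod _ _ _ (#|` A| + #|` B|)%N) => //.
  move: aA bB; rewrite {1}eA {1}eB => /progP[i hi ->] /progP[j hj ->].
  by apply/progP; exists (i + j)%N; [move: hi hj; clia|rewrite natmulD; zmod].
exists r; split.
- apply: ap_arith_prog => // n n0 rn; apply: leq_trans (ho _ n0 rn).
  exact: leq_card_sumsetl.
- apply: ap_arith_prog => // n n0 rn; apply: leq_trans (ho _ n0 rn).
  exact: leq_card_sumsetr.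
- by move=> n n0 rn; have := ho _ n0 rn; clia.
Qed.

End Progressions.

(** * Subgroups of least boundary *)

Section Boundary.
Variable G : zmodType.
Implicit Types (A B C S U V W X Y Z H F P I : {fset G}) (a b c d g h r x y z : G).
Implicit Types (K : {pred G}).

Lemma submodular X Y B :
  (#|` (X `|` Y) :+: B| + #|` (X `&` Y) :+: B| <= #|` X :+: B| + #|` Y :+: B|)%N.
Proof.
rewrite sumsetUl -[X in (_ <= X)%N]cardfsUI leq_add2l; apply: card_fsubset => z.
move=> /sumsetP[x [b [hx bB ->]]]; move: hx; rewrite !in_fsetI => /andP[xX xY].
by rewrite !mem_sumset.
Qed.

Definition subgroup K : Prop := 0 \in K /\ forall x y, x \in K -> y \in K -> x - y \in K.

Definition in_one_coset K X : Prop := forall x y, x \in X -> y \in X -> x - y \in K.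

Definition full K S : Prop := exists s, forall k, k \in K -> s + k \in S.

Lemma full_sub K S X : {subset S <= X} -> full K S -> full K X.
Proof. by move=> h [s hs]; exists s => k /hs /h. Qed.

Lemma full_translate K S g : full K (translate g S) -> full K S.
Proof.
move=> [s hs]; exists (s - g) => k /hs; rewrite in_translate; congr (_ \in S); zmod.
Qed.

(** The number [|X + B| - |X|] is the boundary of [X] with respect to [B].  The
    subgroup [H] has the least boundary among the sets [X] contained in a coset of
    [K] for which [X + B] contains no coset of [K]. *)
Definition least_boundary K B H : Prop :=
  [/\ subgrp H, {subset H <= K}, ~ full K (H :+: B) &
      forall X, X != fset0 -> in_one_coset K X -> ~ full K (X :+: B) ->
        (#|` H :+: B| + #|` X| <= #|` X :+: B| + #|` H|)%N].

Section Fibers.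
Variables (K : {pred G}) (B H : {fset G}).
Hypotheses (sK : subgroup K) (BK : in_one_coset K B) (B0 : B != fset0).
Hypothesis (lH : least_boundary K B H).

Let sH : subgrp H. Proof. by case: lH. Qed.
Let HK : {subset H <= K}. Proof. by case: lH. Qed.

Lemma same_coset_in_one X : same_coset H X -> in_one_coset K X.
Proof. by move=> cX x y xX yX; apply/HK/cX. Qed.

Lemma fiber_sub X x : same_coset H X -> x \in X -> {subset X :+: B <= translate x (H :+: B)}.
Proof.
move=> cX xX; apply/fsubsetP/sumset_sub => y b yX bB; rewrite in_translate.
have -> : y + b - x = (y - x) + b by zmod.
by apply: mem_sumset => //; apply: cX.
Qed.

Lemma fiber_nfull X : same_coset H X -> ~ full K (X :+: B).
Proof.
have [->|[x xX]] := fset_0Vmem X.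
  move=> _ [s /(_ 0)]; case: sK => h0 _ /(_ h0).
  by move=> /sumsetP[? [? []]]; rewrite in_fset0.
move=> cX /(full_sub (fiber_sub cX xX)) /full_translate.
by case: lH.
Qed.

Lemma fiber_boundary X : X != fset0 -> same_coset H X ->
  (#|` H :+: B| + #|` X| <= #|` X :+: B| + #|` H|)%N.
Proof.
move=> X0 cX; case: lH => _ _ _; apply => //; first exact: same_coset_in_one.
exact: fiber_nfull.
Qed.

(** Adjoining a coset of [H] that meets [Z]. *)
Lemma fill_coset Z x : x \in Z ->
  let C := translate x H in
  [/\ (#|` (Z `|` C) :+: B| + #|` (Z `&` C) :+: B| <= #|` Z :+: B| + #|` H :+: B|)%N,
      (#|` Z `|` C| + #|` Z `&` C| = #|` Z| + #|` H|)%N,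
      x \in Z `&` C & same_coset H (Z `&` C)].
Proof.
move=> xZ C; split.
- have -> : #|` H :+: B| = #|` C :+: B| by rewrite sumset_translatel card_translate.
  exact: submodular.
- by rewrite cardfsUI card_translate.
- by rewrite in_fsetI xZ in_translate subrr subgrp0.
- apply: same_coset_sub (same_coset_translate (a := x) sH) => y.
  by rewrite in_fsetI => /andP[].
Qed.

Lemma fill_boundary Z W : {subset Z <= W} ->
  (forall w, w \in W -> w \notin Z ->
     {subset translate w H <= W} /\ exists2 z, z \in Z & z - w \in H) ->
  (#|` W :+: B| + #|` Z| <= #|` Z :+: B| + #|` W|)%N.
Proof.
have [n] := ubnP #|` W `\` Z|; elim: n Z => // n IH Z ltn ZW hW.
have [e|[w]] := fset_0Vmem (W `\` Z).
  suff -> : W = Z by [].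
  by apply/eqP; rewrite eqEfsubset -fsetD_eq0 e eqxx; apply/fsubsetP.
move=> wD; move: (wD); rewrite in_fsetD => /andP[wZ wW].
have [hw [z zZ hz]] := hW w wW wZ.
have eC : translate z H = translate w H.
  apply/fsetP => y; rewrite !in_translate -(subgrpDr _ sH hz); congr (_ \in H); zmod.
have [h1 h2 h3 h4] := fill_coset zZ; set C := translate z H in eC h1 h2 h3 h4.
have CW : {subset C <= W} by rewrite eC.
have wC : w \in C by rewrite eC in_translate subrr subgrp0.
have := IH (Z `|` C); have h5 := fiber_boundary (mem_neq0 h3) h4.
have lt : (#|` W `\` (Z `|` C)| < n)%N.
  apply: leq_trans (_ : #|` W `\` Z| <= n)%N; last by rewrite -ltnS.
  apply: fproper_ltn_card; rewrite fproperE fsetDS ?fsubsetUl //=.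
  by apply/fsubsetPn; exists w => //; rewrite in_fsetD in_fsetU wC orbT.
move=> /(_ lt) {}IH.
have {IH} : (#|` W :+: B| + #|` Z `|` C| <= #|` (Z `|` C) :+: B| + #|` W|)%N.
  apply: IH => [y|y yW]; first by rewrite in_fsetU => /orP[/ZW|/CW].
  rewrite in_fsetU negb_or => /andP[yZ yC]; have [q1 [q q2 q3]] := hW y yW yZ.
  by split => //; exists q => //; rewrite in_fsetU q2.
clia.
Qed.

(** The period [F] of [X + B], for [X] in a coset of [H], is contained in [H]
    because [H :|: F] has the same sum with [B] as [H]. *)
Lemma fiber_stab X : X != fset0 -> same_coset H X ->
  let F := stab (X :+: B) in
  [/\ subgrp F, {subset F <= H} &
      (#|` F :+: B| + #|` X :+: F| <= #|` X :+: B| + #|` F|)%N].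
Proof.
move=> X0 cX F; have XB0 : X :+: B != fset0 by apply: sumset_neq0.
have sF : subgrp F := stab_subgrp XB0.
have [x xX] := fset0Pn _ X0.
have FB : {subset F :+: B <= H :+: B}.
  apply/fsubsetP/sumset_sub => f b fF bB.
  have : f + b \in translate (- x) (X :+: B).
    rewrite in_translate; have -> : f + b - - x = x + b + f by zmod.
    by move/(stabP _ XB0): fF; apply; apply: mem_sumset.
  rewrite in_translate => /(fiber_sub cX xX); rewrite in_translate.
  by have -> : f + b - - x - x = f + b by zmod.
split => //; last by rewrite addnC; apply: kneser_leq.
have e : (H `|` F) :+: B = H :+: B.
  by rewrite sumsetUl; apply/fsetUidPl/fsubsetP.
have [hsH hHK hnf hmin] := lH.
have := hmin (H `|` F); rewrite e => /(_ _ _ hnf) h.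
have U0 : H `|` F != fset0 by rewrite fsetU_eq0 negb_and (subgrp_neq0 sH).
have FK : {subset F <= K}.
  move=> f fF; have [b bB] := fset0Pn _ B0.
  have : x + b + f \in X :+: B by move/(stabP _ XB0): fF; apply; apply: mem_sumset.
  move=> /sumsetP[y [c [yX cB ey]]].
  have -> : f = (y - x) - (b - c) by rewrite -[LHS](addKr (x + b)) ey; zmod.
  by case: sK => _; apply; [apply/HK/cX|apply: BK].
have UK : in_one_coset K (H `|` F).
  move=> y z hy hz; case: sK => _; apply.
    by move: hy; rewrite in_fsetU => /orP[/HK|/FK].
  by move: hz; rewrite in_fsetU => /orP[/HK|/FK].
have := h U0 UK; rewrite leq_add2l => hc f fF.
have -> : H = H `|` F by apply: eq_fsub_card => // y yH; rewrite in_fsetU yH.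
by rewrite in_fsetU fF orbT.
Qed.

Lemma boundary_subgrpI I F : subgrp I -> subgrp F -> {subset I <= H} -> {subset F <= H} ->
  (#|` (I `&` F) :+: B| + (#|` I| + #|` F|) + #|` (I `|` F) :+: B|
     <= #|` I :+: B| + #|` F :+: B| + (#|` I `|` F| + #|` I `&` F|))%N.
Proof.
move=> sI sF IH FH; have := submodular I F B; have := cardfsUI I F; clia.
Qed.

(** Going through the [H]-classes of a part [X] of [Z], the periods of their sums
    with [B] are intersected; by submodularity the boundary of the intersection
    stays below that of [Z]. *)
Lemma boundary_chain Z X :
  (#|` H :+: B| + #|` Z :+: H| <= #|` Z :+: H :+: B| + #|` H|)%N ->
  {subset X <= Z} -> (forall x z, x \in X -> z \in Z -> z - x \in H -> z \in X) ->
  periodic H (Z `\` X) ->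
  exists I, [/\ subgrp I, {subset I <= H}, periodic I (X :+: B) &
                (#|` I :+: B| + #|` Z| <= #|` Z :+: B| + #|` I|)%N].
Proof.
have [n] := ubnP #|` X|; elim: n X Z => // n IH X Z ltn hZ XZ sat pZ.
have [e|[a aX]] := fset_0Vmem X.
  exists H; split => //; first by move=> x h; rewrite e => /sumsetP[? [? []]]; rewrite in_fset0.
  by move: hZ pZ; rewrite e fsetD0 => hZ /(periodic_closureE sH) eZ; rewrite eZ in hZ.
have aZ := XZ _ aX; have [h1 h2 h3 h4] := fill_coset aZ.
set C := translate a H in h1 h2 h3 h4; set Xa := Z `&` C in h1 h2 h3 h4.
have XaX : {subset Xa <= X}.
  by move=> x; rewrite in_fsetI in_translate => /andP[xZ hx]; apply: sat aX xZ hx.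
have pC : periodic H C by apply: periodic_coset.
have eZH : (Z `|` C) :+: H = Z :+: H.
  rewrite sumsetUl; apply/fsetUidPl/fsubsetP => x; rewrite (periodic_closureE sH pC).
  by rewrite in_translate => hx; apply/closureP => //; exists a.
have eD : X = (X `\` C) `|` Xa.
  apply/fsetP => x; rewrite in_fsetU in_fsetD in_fsetI; case: (boolP (x \in C)) => xC /=.
    by rewrite andbT; apply/idP/idP => [/XZ|xZ] //; apply: XaX; rewrite in_fsetI xZ.
  by rewrite andbF orbF.
have [|||||I [sI IH' pI hI]] := IH (X `\` C) (Z `|` C).
- apply: leq_trans (_ : #|` X| <= n)%N; last by rewrite -ltnS.
  apply: fproper_ltn_card; rewrite fproperE fsubsetDl /=; apply/fsubsetPn; exists a => //.
  by rewrite in_fsetD in_translate subrr subgrp0.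
- by rewrite eZH; move: hZ h2; clia.
- by move=> x; rewrite in_fsetD in_fsetU => /andP[_ /XZ ->].
- move=> x z; rewrite !in_fsetD in_fsetU => /andP[xC xX] hz hzx.
  have zC : z \notin C by rewrite (periodic_eq sH pC hzx).
  by rewrite zC; move: hz; rewrite (negbTE zC) orbF => zZ; apply: sat xX zZ hzx.
- have -> : (Z `|` C) `\` (X `\` C) = (Z `\` X) `|` C.
    apply/fsetP => x; rewrite !in_fsetD !in_fsetU !in_fsetD.
    by case: (x \in C); case: (x \in X); case: (x \in Z).
  exact: periodicU.
have Xa0 := mem_neq0 h3; have [sF FH kF] := fiber_stab Xa0 h4.
set F := stab _ in sF FH kF.
have sIF := subgrpI sI sF.
exists (I `&` F); split => //.
- by move=> x; rewrite in_fsetI => /andP[/IH'].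
- rewrite eD sumsetUl; apply: periodicU.
    by apply: periodic_sub pI => x; rewrite in_fsetI => /andP[].
  apply: (@periodic_sub _ _ F); first by move=> x; rewrite in_fsetI => /andP[].
  exact: stab_periodic.
have := boundary_subgrpI sI sF IH' FH.
have := leq_card_closure Xa sF.
have U0 : I `|` F != fset0 by rewrite fsetU_eq0 negb_and (subgrp_neq0 sI).
have cU : same_coset H (I `|` F).
  by move=> x y hx hy; apply: subgrpB => //; [move: hx|move: hy]; rewrite in_fsetU => /orP[/IH'|/FH].
have := fiber_boundary U0 cU.
have := cardfsUI I F.
by clear - h1 h2 hI kF; clia.
Qed.

Hypothesis Hsmall : forall P, subgrp P -> {subset P <= H} ->
  (#|` P :+: B| + #|` H| <= #|` H :+: B| + #|` P|)%N -> (#|` H| <= #|` P|)%N.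

Lemma fiber_boundary_lt X x : x \in X -> same_coset H X -> ~ periodic H X ->
  (#|` H :+: B| + #|` X| < #|` X :+: B| + #|` H|)%N.
Proof.
move=> xX cX npX; have X0 := mem_neq0 xX.
rewrite ltnNge; apply/negP => hle; apply: npX.
have [sF FH kF] := fiber_stab X0 cX; set F := stab _ in sF FH kF.
have FC : same_coset H F by move=> y z /FH yH /FH zH; apply: subgrpB.
have := fiber_boundary (subgrp_neq0 sF) FC; have hX := leq_card_closure X sF.
move=> hF; have pX : periodic F X by apply: closure_card_periodic => //; clia.
suff -> : H = F by [].
by apply/esym/eq_fsub_card => //; apply: Hsmall => //; clia.
Qed.

(** Two incomplete classes would make the chain of inequalities strict, for the
    union of two proper subgroups of [H] is not [H]. *)
Theorem one_incomplete_class A :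
  (#|` H :+: B| + 1 < #|` H| + #|` B|)%N -> A != fset0 -> aperiodic (A :+: B) ->
  (#|` A :+: B| + 1 <= #|` A| + #|` B|)%N ->
  (#|` H :+: B| + #|` A :+: H| <= #|` A :+: H :+: B| + #|` H|)%N ->
  ~ same_coset H A -> quasi_periodic A.
Proof.
move=> hlt A0 aAB hc hAH ncA.
have AB0 : A :+: B != fset0 by apply: sumset_neq0.
have stAB : stab (A :+: B) = triv by apply/aperiodic_stab.
have H1 : H != triv.
  apply: contraTneq hlt => ->; rewrite card_triv.
  by have := leq_card_sumsetr B (@subgrp_neq0 _ _ (@subgrp1 G)); clia.
have npA : ~ periodic H A.
  move=> pA; have [h hH /eqP[]] := subgrp_nontriv sH H1; apply/eqP.
  rewrite -in_triv -stAB; apply: (sub_stab AB0) hH; exact: periodic_sumsetl.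
have [a [h [aA hH ah]]] : exists a h, [/\ a \in A, h \in H & a + h \notin A].
  apply: NNPP => hn; apply: npA => a h aA hH; apply/negPn/negP => hN.
  by apply: hn; exists a, h.
set C := translate a H; have pC : periodic H C by apply: periodic_coset.
have aC : a \in C by rewrite in_translate subrr subgrp0.
suff pD : periodic H (A `\` C).
  exists H, (A `&` C); split => //; have e : A `\` (A `&` C) = A `\` C.
    by apply/fsetP => x; rewrite !in_fsetD in_fsetI; case: (x \in A); rewrite ?andbF.
  split; rewrite ?e //.
  - by apply: (@mem_neq0 _ _ a); rewrite in_fsetI aA.
  - apply/negP; rewrite fsetD_eq0 => /fsubsetP AC; apply: ncA.
    exact: same_coset_sub AC (@same_coset_translate _ H a sH).
  - by move=> x; rewrite in_fsetI => /andP[].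
  - by move=> x y; rewrite !in_fsetI => /andP[_ hx] /andP[_ hy]; apply: (@same_coset_translate _ H a sH).
(* Suppose that the class of [b] is incomplete, too.  The period [F] of the sum
   with [Aa] and the group [I] obtained from the other classes meet trivially, as
   [A + B] is aperiodic. *)
apply: NNPP => npD.
have [b [k [bA bC kH bk]]] : exists b k, [/\ b \in A, b \notin C, k \in H & b + k \notin A].
  apply: NNPP => hn; apply: npD => b k; rewrite !in_fsetD => /andP[bC bA] kH.
  rewrite (periodicE _ sH pC kH) bC /=; apply/negPn/negP => hN.
  by apply: hn; exists b, k.
have [h1 h2 h3 h4] := fill_coset aA; rewrite -/C in h1 h2 h3 h4.
set Z := A `|` C in h1 h2; set Aa := A `&` C in h1 h2 h3 h4.
have npAa : ~ periodic H Aa.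
  by move=> /(_ _ _ h3 hH); rewrite in_fsetI (negbTE ah).
have ltAa := fiber_boundary_lt h3 h4 npAa.
have [sF FH kF] := fiber_stab (mem_neq0 h3) h4; set F := stab _ in sF FH kF.
have hF := leq_card_closure Aa sF.
have eZH : Z :+: H = A :+: H.
  rewrite sumsetUl; apply/fsetUidPl/fsubsetP => x; rewrite (periodic_closureE sH pC).
  by rewrite in_translate => hx; apply/closureP => //; exists a.
have [||||I [sI IH pI hI]] := @boundary_chain Z (A `\` C).
- by rewrite eZH.
- by move=> x; rewrite in_fsetD in_fsetU => /andP[_ ->].
- move=> x z; rewrite !in_fsetD in_fsetU => /andP[xC xA] hz hzx.
  have zC : z \notin C by rewrite (periodic_eq sH pC hzx).
  by rewrite zC; move: hz; rewrite (negbTE zC) orbF.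
- have -> // : Z `\` (A `\` C) = C.
  apply/fsetP => x; rewrite !in_fsetD !in_fsetU.
  by case: (x \in C); case: (x \in A).
have IF : I `&` F = triv.
  apply/fsetP => d; rewrite in_triv; apply/idP/eqP => [|->]; last first.
    by rewrite in_fsetI !subgrp0.
  rewrite in_fsetI => /andP[dI dF]; apply/eqP; rewrite -in_triv -stAB.
  apply/stabP => // x.
  have -> : A = (A `\` C) `|` Aa by rewrite fsetUC fsetID.
  rewrite sumsetUl !in_fsetU => /orP[hx|hx]; first by rewrite pI.
  by rewrite (@stab_periodic _ (Aa :+: B) x d) ?orbT.
have U0 : 0 \in I `|` F by rewrite in_fsetU subgrp0.
have UH : {subset I `|` F <= H} by move=> x; rewrite in_fsetU => /orP[/IH|/FH].
have cU : same_coset H (I `|` F) by move=> x y /UH xH /UH yH; apply: subgrpB.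
have bIF := boundary_subgrpI sI sF IH FH; rewrite IF card_triv in bIF.
have trB : #|` triv :+: B| = #|` B|.
  by rewrite sumsetC (periodic_closureE (@subgrp1 G)) // => x y xB /[!in_triv] /eqP->; rewrite addr0.
rewrite trB in bIF; have cIF := cardfsUI I F; rewrite IF card_triv in cIF.
have pU : periodic H (I `|` F).
  apply: NNPP => npU; have := fiber_boundary_lt U0 cU npU.
  by clear - bIF cIF hI kF hF h1 h2 hc; clia.
(* Minimality of [H] and submodularity leave no room between [I :|: F] and [H]. *)
have HU x : x \in H -> (x \in I) || (x \in F).
  by move=> xH; rewrite -in_fsetU -[x]add0r; apply: pU.
have eqH P : subgrp P -> {subset P <= H} -> {subset H <= P} -> P = H.
  by move=> _ PH HP; apply: eq_fsub_card => //; apply: card_fsubset.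
have hU := fiber_boundary (mem_neq0 U0) cU.
case: (subgrp_sub_union sI sF sH HU) => [HI|HF]; last first.
  have eF := eqH _ sF FH HF; rewrite eF in kF hF bIF cIF hU.
  by clear - bIF cIF hI ltAa h1 h2 hc hU; clia.
have eI := eqH _ sI IH HI; rewrite eI in hI bIF cIF hU.
have bZ : b \in Z by rewrite in_fsetU bA.
have [g1 g2 g3 g4] := fill_coset bZ; set D := translate b H in g1 g2 g3 g4.
have npZb : ~ periodic H (Z `&` D).
  move=> /(_ _ _ g3 kH); rewrite in_fsetI in_fsetU (negbTE bk) orFb.
  by rewrite (periodicE _ sH pC kH) (negbTE bC).
have ltZb := fiber_boundary_lt g3 g4 npZb.
have eZD : (Z `|` D) :+: H = A :+: H.
  rewrite sumsetUl eZH; apply/fsetUidPl/fsubsetP => x.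
  rewrite (periodic_closureE sH (@periodic_coset _ H b sH)).
  by rewrite in_translate => hx; apply/closureP => //; exists b.
have := @fill_boundary (Z `|` D) (A :+: H).
rewrite -eZD => hfill.
have {hfill} : (#|` (Z `|` D) :+: H :+: B| + #|` Z `|` D| <= #|` (Z `|` D) :+: B| + #|` (Z `|` D) :+: H|)%N.
  apply: hfill => [x|w]; first exact: mem_closure.
  move=> wH _; split.
    by apply: coset_sub wH; apply: periodic_closure.
  move/(closureP _ _ sH): wH => [z zZ hz]; exists z => //.
  by rewrite subgrpBC.
rewrite eZD.
by clear - bIF cIF hI ltZb h1 h2 g1 g2 hc hU kF hF hAH; clia.
Qed.

End Fibers.
End Boundary.

(** * Applications of subgroups of least boundary *)

Section LeastBoundary.
Variable G : zmodType.
Implicit Types (A B C S U V W X Y Z H F P I : {fset G}) (a b c d g h r x y z : G).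
Implicit Types (K : {pred G}).

(** A summand contained in a coset of a finite subgroup: the smallest such
    subgroup has boundary zero, which is the least possible one. *)
Theorem coset_summand A B F : subgrp F -> same_coset F A -> (1 < #|` A|)%N ->
  ~ same_coset F B -> aperiodic (A :+: B) -> (#|` A :+: B| + 1 <= #|` A| + #|` B|)%N ->
  quasi_periodic B.
Proof.
move=> sF cA A1 ncB aAB hc; have A0 : A != fset0 by rewrite -cardfs_gt0 ltnW.
have [a aA] := fset0Pn _ A0.
have B0 : B != fset0 by apply/negP => /eqP e; apply: ncB => x y; rewrite e in_fset0.
have [H [sH cH] Hmin] : exists2 H, subgrp H /\ same_coset H A &
    forall P, subgrp P /\ same_coset P A -> (#|` H| <= #|` P|)%N.
  by apply: (@ex_smallest _ (fun P : {fset G} => #|` P|)); exists F.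
have HF : {subset H <= F}.
  have e : H `&` F = H.
    apply: eq_fsub_card => [x|]; first by rewrite in_fsetI => /andP[].
    apply: Hmin; split; first exact: subgrpI.
    by move=> x y xA yA; rewrite in_fsetI cH // cA.
  by move=> x; rewrite -e in_fsetI => /andP[].
have ncH : ~ same_coset H B by move=> h; apply: ncB => x y xB yB; apply/HF/h.
have eHA : #|` H :+: A| = #|` H| by rewrite sumsetC; apply: card_closure_coset aA.
have lH : least_boundary predT A H.
  split => //.
    move=> [s hs]; apply: ncH => x y _ _.
    have hz z : z \in H :+: A by have := hs (z - s) isT; rewrite addrC subrK.
    apply: (same_coset_sumset sH _ cH (hz x) (hz y)) => u v uH vH; exact: subgrpB.
  move=> X X0 _ _; rewrite eHA addnC leq_add2r; exact: leq_card_sumsetl.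
apply: (@one_incomplete_class _ predT A H) => //; rewrite ?[B :+: A]sumsetC //.
- move=> P sP PH hP; apply: Hmin; split => //; apply: closure_one_coset => //.
  have := subgrp_card_gt0 sP; move: hP; rewrite eHA [P :+: A]sumsetC; clia.
- by rewrite eHA; clia.
- by clia.
- by rewrite eHA addnC leq_add2r; apply: leq_card_sumsetl.
Qed.

Lemma card_filter_sum X (p : pred G) : #|` [fset x in X | p x]| = (\sum_(x <- X) p x)%N.
Proof.
rewrite card_fset_sum1 big_fset /= big_mkcond /=; apply: eq_bigr => x _.
by case: (p x).
Qed.

Lemma double_count X Y (p : G -> G -> bool) :
  (\sum_(x <- X) #|` [fset y in Y | p x y]| = \sum_(y <- Y) #|` [fset x in X | p x y]|)%N.
Proof.
under eq_bigr do rewrite card_filter_sum; rewrite exchange_big /=.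
by under [RHS]eq_bigr do rewrite card_filter_sum.
Qed.

Lemma leq_sum_fset X (f : G -> nat) n : (forall x, x \in X -> (f x <= n)%N) ->
  (\sum_(x <- X) f x <= #|` X| * n)%N.
Proof.
move=> h; rewrite card_fset_sum1 big_distrl /= !big_seq; apply: leq_sum => x xX.
by rewrite mul1n h.
Qed.

Lemma geq_sum_fset X (f : G -> nat) n : (forall x, x \in X -> (n <= f x)%N) ->
  (#|` X| * n <= \sum_(x <- X) f x)%N.
Proof.
move=> h; rewrite card_fset_sum1 big_distrl /= !big_seq; apply: leq_sum => x xX.
by rewrite mul1n h.
Qed.

Lemma full_card_arith (a b c h al be m q : nat) :
  (a + c * (q + 2) <= h * al)%N -> (al + be = m + q + 2)%N ->
  (h * m + 1 <= a + b + c)%N -> (b <= c)%N -> (h * be + 1 <= h + b)%N -> (2 <= be)%N -> False.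
Proof.
move=> h1 h2 h3 h4 h5 h6.
have h7 : (h * al + h * be = h * m + h * q + h * 2)%N by rewrite -!mulnDr h2.
have h8 : (h * 2 <= h * be)%N by rewrite leq_mul2l h6 orbT.
have h9 : (h + 1 <= c)%N by lia.
have h10 : ((h + 1) * q <= c * q)%N by rewrite leq_mul2r h9 orbT.
move: h1 h10; rewrite mulnDr mulnDl mul1n; lia.
Qed.

(** If [A + H + B] fills a coset of the finite group [K], then [C], what is
    missing from [A + B], is at least as large as [B].  Each class of [H] meeting
    [A] contains few elements of [A] if many elements of [C] lie above it; summing
    over the classes yields the bound. *)
Lemma boundary_closure K A B H : subgroup K -> in_one_coset K A -> in_one_coset K B ->
  A != fset0 -> B != fset0 ->
  least_boundary K B H -> ~ same_coset H B ->
  (forall S, full K S -> (#|` A| + #|` B| + #|` B| <= #|` S| + 1)%N) ->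
  (#|` H :+: B| + 1 <= #|` H| + #|` B|)%N -> (#|` A :+: B| + 1 <= #|` A| + #|` B|)%N ->
  (#|` H :+: B| + #|` A :+: H| <= #|` A :+: H :+: B| + #|` H|)%N.
Proof.
move=> sK AK BK A0 B0 lH ncB hK hHB hc; have [sH HK _ hmin] := lH.
set X := A :+: H; have X0 : X != fset0 by apply: sumset_neq0 => //; apply: subgrp_neq0.
have XK : in_one_coset K X.
  move=> _ _ /sumsetP[a [h [aA hH ->]]] /sumsetP[b [k [bA kH ->]]].
  have -> : a + h - (b + k) = (a - b) - (k - h) by zmod.
  by case: sK => _; apply; [apply: AK|apply/HK/subgrpB].
have [fX|nfX] := classic (full K (X :+: B)); last exact: hmin.
have [s hs] := fX; pose Kf := [fset k in translate (- s) (X :+: B) | k \in K].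
have KfE k : (k \in Kf) = (k \in K).
  rewrite !inE in_translate; apply/andP/idP => [[]|kK] //; split => //.
  by rewrite opprK addrC hs.
have sKf : subgrp Kf.
  by case: sK => h0 hB; split => [|x y]; rewrite !KfE //; apply: hB.
have hKf : (#|` A| + #|` B| + #|` B| <= #|` Kf| + 1)%N.
  by apply: hK; exists 0 => k kK; rewrite add0r KfE.
have cXB : same_coset Kf (X :+: B).
  by apply: same_coset_sumset => // x y hx hy; rewrite KfE; [apply: XK|apply: BK].
have eXB : X :+: B = translate s Kf.
  apply/esym/eq_fsub_card; last by rewrite card_translate; apply: same_coset_card.
  by move=> x; rewrite in_translate KfE => /hs; rewrite addrC subrK.
have cK : #|` X :+: B| = #|` Kf| by rewrite eXB card_translate.
have HKf : {subset H <= Kf} by move=> h /HK; rewrite KfE.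
rewrite cK leqNgt; apply/negP => hlt.
set C := (X :+: B) `\` (A :+: B).
have sAB : A :+: B `<=` X :+: B.
  by apply: sumsetSS => //; apply/fsubsetP => x; apply: mem_closure.
have cC : (#|` C| + #|` A :+: B| = #|` Kf|)%N.
  by rewrite cardfsDS // subnK ?cK // -cK fsubset_leq_card.
pose p x c := c \in translate x (H :+: B).
have S1 : (\sum_(x <- X) (#|` [fset a in A | (a - x)%R \in H]| + #|` [fset c in C | p x c]|)
             <= #|` X| * #|` H|)%N.
  apply: leq_sum_fset => x xX; set Ax := [fset a in A | a - x \in H].
  have [a aAx] : exists a, a \in Ax.
    move: xX => /(closureP _ _ sH)[a aA ha]; exists a.
    by rewrite !inE aA subgrpBC.
  have cAx : same_coset H Ax.
    move=> y z; rewrite !inE => /andP[_ hy] /andP[_ hz].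
    have -> : y - z = (y - x) - (z - x) by zmod.
    exact: subgrpB.
  have := fiber_boundary sK lH (mem_neq0 aAx) cAx.
  have : (#|` [fset c in C | p x c]| + #|` Ax :+: B| <= #|` H :+: B|)%N.
    rewrite -(card_translate x (H :+: B)) -card_disjU.
      apply: card_fsubset => y; rewrite in_fsetU => /orP[]; first by rewrite !inE => /andP[].
      move=> /sumsetP[z [b [zA bB ->]]]; move: zA; rewrite !inE => /andP[_ hz].
      rewrite in_translate; have -> : z + b - x = (z - x) + b by zmod.
      exact: mem_sumset.
    move=> y; rewrite !inE => /andP[/andP[/negP yN _] _] /sumsetP[z [b [zA bB e]]].
    apply: yN; rewrite e mem_sumset //.
    by move: zA; rewrite !inE => /andP[].
  by clia.
rewrite big_split /= (double_count X A (fun x a => a - x \in H)) in S1.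
rewrite (double_count X C p) in S1.
have S2 : (#|` A| * #|` H| <= \sum_(a <- A) #|` [fset x in X | (a - x)%R \in H]|)%N.
  apply: geq_sum_fset => a aA; rewrite -(card_translate a H); apply: card_fsubset => x.
  rewrite in_translate !inE => hx; rewrite subgrpBC // hx andbT.
  by apply/closureP => //; exists a.
have S3 : (#|` C| * (#|` X| + #|` H :+: B| - #|` Kf|) <= \sum_(c <- C) #|` [fset x in X | p x c]|)%N.
  apply: geq_sum_fset => c; rewrite in_fsetD => /andP[_ cXB'].
  set Y := translate c (oppset (H :+: B)).
  have e : [fset x in X | p x c] = X `&` Y.
    apply/fsetP => x; have hp : p x c = (x \in Y).
      by rewrite /p /Y !in_translate in_oppset opprB.
    by rewrite in_fsetI -hp !inE.
  rewrite e; have := cardfsUI X Y; rewrite card_translate card_oppset.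
  have : (#|` X `|` Y| <= #|` Kf|)%N.
    apply: same_coset_card; move: cXB' => /sumsetP[x0 [b0 [x0X b0B ec]]].
    suff hx x : x \in X `|` Y -> x - x0 \in Kf.
      move=> x y /hx xK /hx yK; have -> : x - y = (x - x0) - (y - x0) by zmod.
      exact: subgrpB.
    rewrite in_fsetU => /orP[xX|]; first by rewrite KfE XK.
    rewrite in_translate in_oppset => /sumsetP[h [b [hH bB e']]].
    have -> : x - x0 = (b0 - b) - h.
      have -> : x = c - (h + b) by rewrite -e'; zmod.
      by rewrite ec; zmod.
    by apply: subgrpB => //; [rewrite KfE; apply: BK|apply: HKf].
  by clia.
have pX : periodic H X by apply: periodic_closure.
have pHB : periodic H (H :+: B) by apply/periodic_sumsetl/periodic_subgrp.
have pKf : periodic H Kf by apply: periodic_sub HKf _; apply: periodic_subgrp.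
have /dvdnP[al eX] := periodic_dvdn sH pX.
have /dvdnP[be eHB] := periodic_dvdn sH pHB.
have /dvdnP[m eK] := periodic_dvdn sH pKf.
have h0 := subgrp_card_gt0 sH.
have be2 : (2 <= be)%N.
  rewrite leqNgt; apply/negP => lt; apply: ncB; apply: closure_one_coset => //.
  rewrite sumsetC eHB; have : (be * #|` H| <= 1 * #|` H|)%N by rewrite leq_mul2r -ltnS lt orbT.
  by clia.
have lt : (m + 1 < al + be)%N.
  by rewrite -(ltn_pmul2r h0) !mulnDl -eX -eHB -eK mul1n addnC; move: hlt; clia.
pose q := (al + be - m - 2)%N.
apply: (@full_card_arith #|` A| #|` B| #|` C| #|` H| al be m q); rewrite ?[(#|` H| * _)%N]mulnC -?eX -?eHB -?eK //.
- rewrite -(leq_pmul2r h0); apply: leq_trans S1; rewrite mulnDl leq_add //.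
  apply: leq_trans S3; rewrite -mulnA leq_mul2l; apply/orP; right.
  by rewrite eX eHB eK -mulnDl -mulnBl leq_mul2r /q; apply/orP; right; move: lt; clear; lia.
- by rewrite /q; move: lt; clear; lia.
- by move: cC hc; clia.
- by move: cC hc hKf; clia.
Qed.

End LeastBoundary.

(** * Atoms *)

Section Atoms.
Variable G : zmodType.
Implicit Types (A B C S U V W X Y Z H F P I M L N : {fset G}) (a b c d g h r x y z : G).
Implicit Types (K : {pred G}).

Lemma sumset_subsetl X Y B : {subset X <= Y} -> {subset X :+: B <= Y :+: B}.
Proof. by move=> XY; apply/fsubsetP/sumset_sub => x b /XY; apply: mem_sumset. Qed.

(** No set has a boundary smaller than that of a point. *)
Definition point_least K B : Prop := forall X, X != fset0 -> in_one_coset K X ->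
  ~ full K (X :+: B) -> (#|` X| + #|` B| <= #|` X :+: B| + 1)%N.

Definition fragment K B M : Prop :=
  [/\ (1 < #|` M|)%N, in_one_coset K M, ~ full K (M :+: B) &
      (#|` M :+: B| + 1 <= #|` M| + #|` B|)%N].

Definition atom K B M : Prop :=
  fragment K B M /\ forall X, fragment K B X -> (#|` M| <= #|` X|)%N.

(** All differences of distinct elements are distinct (a Sidon set). *)
Definition sidon M : Prop := forall g, g != 0 -> (#|` M `&` translate g M| <= 1)%N.

Lemma in_one_coset_translate K M g : in_one_coset K M -> in_one_coset K (translate g M).
Proof.
move=> cM x y; rewrite !in_translate => hx hy.
have -> : x - y = (x - g) - (y - g) by zmod.
exact: cM.
Qed.

(** If an atom [M] meets [g + M] in two points, then by submodularity the
    intersection is a smaller fragment, unless [M = g + M]. *)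
Lemma atom_coset_or_sidon K B M : subgroup K -> point_least K B -> atom K B M ->
  (forall S, full K S -> (#|` M| + #|` M| + #|` B| < #|` S| + 3)%N) ->
  (exists x H, [/\ subgrp H, H != triv & M = translate x H]) \/ sidon M.
Proof.
move=> sK kB [[M1 MK fM hM] Mmin] hK.
have M0 : M != fset0 by rewrite -cardfs_gt0 ltnW.
have key g : (1 < #|` M `&` translate g M|)%N -> forall x, x \in M -> x - g \in M.
  set X := M `&` _ => X1 x xM; set Y := M `|` translate g M.
  have X0 : X != fset0 by rewrite -cardfs_gt0 ltnW.
  have XM : {subset X <= M} by move=> y; rewrite in_fsetI => /andP[].
  have XK : in_one_coset K X by move=> y z /XM yM /XM zM; apply: MK.
  have gK : g \in K.
    have [y] := fset0Pn _ X0; rewrite in_fsetI in_translate => /andP[h1 h2].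
    have -> : g = y - (y - g) by zmod.
    exact: MK.
  have fX : ~ full K (X :+: B).
    by move/(full_sub (sumset_subsetl XM)).
  have kX := kB _ X0 XK fX.
  have hsub := submodular M (translate g M) B; rewrite -/X -/Y in hsub.
  rewrite sumset_translatel card_translate in hsub.
  have fY : ~ full K (Y :+: B) by move=> /hK; clia.
  have Y0 : Y != fset0 by rewrite fsetU_eq0 negb_and M0.
  have YK : in_one_coset K Y.
    have hy z : z \in Y -> exists2 m, m \in M & z - m \in K.
      rewrite in_fsetU => /orP[zM|]; first by exists z => //; rewrite subrr; case: sK.
      by rewrite in_translate => h; exists (z - g) => //; have -> : z - (z - g) = g by zmod.
    move=> u v /hy[m mM um] /hy[n nM vn].
    have -> : u - v = (u - m) - (v - n - (m - n)) by zmod.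
    by case: (sK) => _ sB; apply: (sB) => //; apply: (sB) => //; apply: MK.
  have kY := kB _ Y0 YK fY.
  have cXY := cardfsUI M (translate g M); rewrite card_translate -/X -/Y in cXY.
  have : (#|` M| <= #|` X|)%N by apply: Mmin; split => //; clia.
  move=> /(eq_fsub_card XM) eX; have : x \in X by rewrite eX.
  by rewrite in_fsetI in_translate => /andP[].
have [sid|nsid] := classic (sidon M); [by right|left].
have [g g0 hg] : exists2 g, g != 0 & (1 < #|` M `&` translate g M|)%N.
  apply: NNPP => hn; apply: nsid => g g0; rewrite leqNgt; apply/negP => h.
  by apply: hn; exists g.
have sH := stab_subgrp M0; set H := stab M in sH.
have inH d : (1 < #|` M `&` translate d M|)%N -> d \in H.
  by move=> /key h; rewrite -(subgrpNE _ sH); apply/stabP.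
have gH := inH _ hg; have H1 := nontriv_subgrp gH g0.
have pM : periodic H M by apply: stab_periodic.
have [x xM] := fset0Pn _ M0; exists x, H; split => //.
apply/eqP; rewrite eqEfsubset; apply/andP; split; apply/fsubsetP; last exact: coset_sub.
move=> y yM; rewrite in_translate; apply: inH.
apply: leq_trans (subgrp_card_gt1 sH H1) _; apply: (@periodic_card_ge _ _ _ y).
  by apply: periodicI => //; apply: periodic_translate.
by rewrite in_fsetI yM in_translate (_ : y - _ = x) //; zmod.
Qed.

Lemma sidon_one_coset M F : sidon M -> subgrp F -> F != triv ->
  (#|` M :+: F| + 1 <= #|` M| + #|` F|)%N -> same_coset F M.
Proof.
move=> sM sF F1 hc; apply: closure_one_coset => //; rewrite ltnNge; apply/negP => h2.
have [d dF d0] := subgrp_nontriv sF F1; have := sM _ d0.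
have := cardfsUI M (translate d M); rewrite card_translate.
have : (#|` M `|` translate d M| <= #|` M :+: F|)%N.
  apply: card_fsubset => x; rewrite in_fsetU => /orP[|]; first exact: mem_closure.
  by rewrite in_translate => h; apply/closureP => //; exists (x - d); rewrite // (_ : _ - _ = d) //; zmod.
clia.
Qed.

Lemma sidon_pair M L x y : sidon M -> x \in L -> y \in L -> x != y ->
  (#|` M| + #|` M| <= #|` L :+: M| + 1)%N.
Proof.
move=> sM xL yL xy; have := sM (y - x); rewrite subr_eq0 eq_sym => /(_ xy).
rewrite -(card_translate x (_ `&` _)) => h.
have := cardfsUI (translate x M) (translate y M); rewrite !card_translate.
have : (#|` translate x M `&` translate y M| <= 1)%N.
  apply: leq_trans h; apply: card_fsubset => z; rewrite in_fsetI !in_translate in_fsetI in_translate.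
  by have -> : z - x - (y - x) = z - y by zmod.
have : (#|` translate x M `|` translate y M| <= #|` L :+: M|)%N.
  apply: card_fsubset => z; rewrite in_fsetU !in_translate => /orP[] hz.
    by rewrite -(subrK x z) addrC mem_sumset.
  by rewrite -(subrK y z) addrC mem_sumset.
clia.
Qed.

Lemma sidon_triple M L : sidon M -> (2 < #|` L|)%N ->
  (#|` M| + #|` M| + #|` M| <= #|` L :+: M| + 3)%N.
Proof.
move=> sM L2.
have [x xL] : exists x, x \in L by apply/fset0Pn; rewrite -cardfs_gt0; clia.
have cx := cardfsD1 x L; rewrite xL in cx.
have [y] : exists y, y \in L `\ x by apply/fset0Pn; rewrite -cardfs_gt0; clia.
move=> yL; have cy := cardfsD1 y (L `\ x); rewrite yL in cy.
have [z] : exists z, z \in L `\ x `\ y by apply/fset0Pn; rewrite -cardfs_gt0; clia.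
move: yL; rewrite !in_fsetD1 => /andP[yx yL] /andP[zy /andP[zx zL]].
have i2 u v : u != v -> (#|` translate u M `&` translate v M| <= 1)%N.
  move=> uv; have := sM (v - u); rewrite subr_eq0 eq_sym => /(_ uv) h.
  rewrite -(card_translate u (_ `&` _)) in h.
  apply: leq_trans h; apply: card_fsubset => w; rewrite in_fsetI !in_translate in_fsetI in_translate.
  by have -> : w - u - (v - u) = w - v by zmod.
set T := translate x M `|` translate y M.
have h1 := cardfsUI (translate x M) (translate y M); rewrite !card_translate -/T in h1.
have h2 := cardfsUI T (translate z M); rewrite !card_translate in h2.
have h3 : (#|` T `&` translate z M| <= 2)%N.
  have e : T `&` translate z M =
      (translate x M `&` translate z M) `|` (translate y M `&` translate z M).
    by rewrite fsetIUl.
  rewrite e; have := cardfsUI (translate x M `&` translate z M) (translate y M `&` translate z M).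
  have := i2 x z; have := i2 y z; rewrite ![_ == z]eq_sym zy zx => /(_ isT) g1 /(_ isT) g2.
  clia.
have h4 : (#|` T `|` translate z M| <= #|` L :+: M|)%N.
  apply: card_fsubset => w; rewrite !in_fsetU !in_translate => /orP[/orP[]|] hw.
  - by rewrite -(subrK x w) addrC mem_sumset.
  - by rewrite -(subrK y w) addrC mem_sumset.
  - by rewrite -(subrK z w) addrC mem_sumset.
have := i2 x y; rewrite eq_sym yx => /(_ isT); clia.
Qed.

(** For a finite group [K] containing the differences of [B] this says that they
    generate [K]; for an infinite one, that they generate an infinite group. *)
Definition generating K B : Prop :=
  forall F, subgrp F -> same_coset F B -> {subset K <= F}.

Lemma periodic_full K S F x : {subset K <= F} -> periodic F S -> x \in S -> full K S.
Proof. by move=> KF pS xS; exists x => k /KF kF; apply: pS. Qed.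

(** When the atom is a coset of [H], the [H]-classes meeting [A] contain one
    element or are full.  Filling all of them but one yields a set
    [A' :|: {a}] with the same boundary, in which [A'] is periodic; Kneser's
    bound for [A' + B] then gives the structure of [B].  Counting modulo [|H|]
    shows that [a + B] is not contained in [A' + B]. *)
Lemma coset_atom K A B H : subgroup K -> in_one_coset K A -> in_one_coset K B ->
  subgrp H -> H != triv -> {subset H <= K} -> atom K B H -> point_least K B ->
  generating K B -> (1 < #|` A|)%N -> B != fset0 -> aperiodic (A :+: B) ->
  (#|` A :+: B| + 1 <= #|` A| + #|` B|)%N ->
  (forall S, full K S -> (#|` A| + #|` B| + #|` B| <= #|` S| + 1)%N) ->
  quasi_periodic B.
Proof.
move=> sK AK BK sH H1 HK [[h1 _ fH hH] Hmin] kB gB A1 B0 aAB hc hK.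
have A0 : A != fset0 by rewrite -cardfs_gt0 ltnW.
have AB0 : A :+: B != fset0 by apply: sumset_neq0.
have [b0 b0B] := fset0Pn _ B0.
have HKc : in_one_coset K H by move=> x y /HK xK /HK yK; case: sK => _; apply.
have kH := kB _ (subgrp_neq0 sH) HKc fH.
have lH : least_boundary K B H.
  by split => // X X0 XK fX; have := kB _ X0 XK fX; clia.
have ncB : ~ same_coset H B.
  move=> /(gB _ sH) KH; apply: fH; apply: (@periodic_full _ _ H (0 + b0)) => //.
    exact/periodic_sumsetl/periodic_subgrp.
  by rewrite mem_sumset // subgrp0.
have h2 := boundary_closure sK AK BK A0 B0 lH ncB hK hH hc.
have npA : ~ periodic H A.
  move=> pA; have [h hH' /eqP[]] := subgrp_nontriv sH H1; apply/eqP.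
  rewrite -in_triv; have /(aperiodic_stab AB0) <- := aAB.
  by apply: (sub_stab AB0) hH'; apply: periodic_sumsetl.
have [a [h [aA hH' ah]]] : exists a h, [/\ a \in A, h \in H & a + h \notin A].
  apply: NNPP => hn; apply: npA => a h aA hH'; apply/negPn/negP => hN.
  by apply: hn; exists a, h.
set C := translate a H; have pC : periodic H C by apply: periodic_coset.
have aC : a \in C by rewrite in_translate subrr subgrp0.
have AHC : {subset C <= A :+: H}.
  by move=> x; rewrite in_translate => hx; apply/closureP => //; exists a.
have AAH : {subset A <= A :+: H} by move=> x; apply: mem_closure.
have pAH : periodic H (A :+: H) by apply: periodic_closure.
have [g1 g2 g3 g4] := fill_coset lH aA; rewrite -/C in g1 g2 g3 g4.
set Aa := A `&` C in g1 g2 g3 g4.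
have fillW W : {subset A <= W} -> {subset W <= A :+: H} ->
    (#|` A :+: H :+: B| + #|` W| <= #|` W :+: B| + #|` A :+: H|)%N.
  move=> AW WAH; apply: (fill_boundary sK lH) => // w wAH _; split; first exact: coset_sub.
  move/(closureP _ _ sH): wAH => [z zA hz]; exists z; first exact: AW.
  by rewrite subgrpBC.
have f1 : (#|` A :+: H :+: B| + #|` A `|` C| <= #|` (A `|` C) :+: B| + #|` A :+: H|)%N.
  apply: fillW => x; rewrite in_fsetU; first by move=> ->.
  by case/orP => [/AAH|/AHC].
(* A larger incomplete class would be a fragment smaller than the atom [H]. *)
have cAa : #|` Aa| = 1%N.
  apply/eqP; rewrite eqn_leq (neq0_card g3) andbT leqNgt; apply/negP => lt.
  have hA : (#|` H| <= #|` Aa|)%N.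
    apply: Hmin; split => //; [|exact: (fiber_nfull sK lH)|clia].
    by move=> x y /(g4 x) h3 /h3 /HK.
  case/negP: ah; have sAC : {subset Aa <= C} by move=> x; rewrite in_fsetI => /andP[].
  have eAC : Aa = C by apply: eq_fsub_card => //; rewrite card_translate.
  have : a + h \in Aa by rewrite eAC pC.
  by rewrite in_fsetI => /andP[].
have /cardfs1P[a' eAa'] := introT eqP cAa.
have eAa : Aa = [fset a] by move: g3; rewrite eAa' in_fset1 => /eqP ->.
set A' := (A :+: H) `\` C; have pA' : periodic H A' by apply: periodicD.
set W := A' `|` A.
have WAH : {subset W <= A :+: H}.
  by move=> x; rewrite in_fsetU in_fsetD => /orP[/andP[_]|/AAH].
have aA' : a \notin A' by rewrite in_fsetD aC.
have eW : W = A' `|` [fset a].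
  apply/fsetP => x; rewrite !in_fsetU -eAa in_fsetI in_fsetD.
  by case: (boolP (x \in A)) => [/AAH ->|_]; case: (x \in C); rewrite ?orbF ?orbT.
have cW : #|` W| = (#|` A'| + 1)%N.
  by rewrite eW card_disjU ?cardfs1 // => x h3; rewrite in_fset1 => /eqP e; rewrite -e h3 in aA'.
(* The boundary of [W = A' :|: {a}] is squeezed between those of [A] and of a point. *)
have up : (#|` W :+: B| + #|` A| <= #|` A :+: B| + #|` W|)%N.
  apply: (fill_boundary sK lH) => [x xA|w]; first by rewrite in_fsetU xA orbT.
  rewrite in_fsetU => /orP[wA' _|->] //; split.
    by move=> x /(coset_sub pA' wA') hx; rewrite in_fsetU hx.
  move: wA'; rewrite in_fsetD => /andP[_ /(closureP _ _ sH)[z zA hz]].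
  by exists z => //; rewrite subgrpBC.
have aW : a \in W by rewrite in_fsetU aA orbT.
have [k1 k2 k3 k4] := fill_coset lH aW; rewrite -/C in k1 k2 k3 k4.
have eWC : W `&` C = [fset a].
  apply/fsetP => x; rewrite -eAa !in_fsetI in_fsetU in_fsetD.
  by case: (x \in C); rewrite ?andbF.
have eWUC : W `|` C = A :+: H.
  apply/fsetP => x; rewrite !in_fsetU in_fsetD.
  by case: (boolP (x \in C)) => [/AHC ->|_] /=; rewrite ?orbT ?orbF //; case: (boolP (x \in A)) => [/AAH ->|]; rewrite ?orbF.
have e1 : #|` [fset a] :+: B| = #|` B| by rewrite -/(translate a B) card_translate.
rewrite eWC eWUC e1 in k1; rewrite eWC eWUC cardfs1 in k2.
have eWB : (#|` W :+: B| + 1 = #|` W| + #|` B|)%N.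
  by apply/eqP; rewrite eqn_leq; apply/andP; split; clia.
have A'0 : A' != fset0.
  apply/negP; rewrite fsetD_eq0 => /fsubsetP AC; move: A1; rewrite -cAa ltnNge => /negP; apply.
  by apply: card_fsubset => x xA; rewrite in_fsetI xA AC // AAH.
set S := A' :+: B; have S0 : S != fset0 by apply: sumset_neq0.
set F := stab S; have sF : subgrp F := stab_subgrp S0.
have pS : periodic F S by apply: stab_periodic.
have HF : {subset H <= F} by apply: sub_stab => //; apply: periodic_sumsetl.
have F1 : F != triv.
  by have [d dH d0] := subgrp_nontriv sH H1; apply: nontriv_subgrp (HF _ dH) d0.
set P := translate (- a) S; have pP : periodic F P by apply: periodic_translate.
have inP b : (b \in P) = (a + b \in S) by rewrite in_translate opprK addrC.
set U := B `\` P; set V := B `&` P.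
have cB : #|` B| = (#|` V| + #|` U|)%N by rewrite -(cardfsID P B).
have cWB : #|` W :+: B| = (#|` S| + #|` U|)%N.
  rewrite -(card_translate a U) -card_disjU => [|x xS]; last first.
    by rewrite in_translate in_fsetD inP (_ : a + _ = x) ?xS //; zmod.
  congr #|` _|; rewrite eW sumsetUl; apply/fsetP => x; rewrite !in_fsetU !in_translate.
  rewrite in_fsetD inP (_ : a + (x - a) = x); last by zmod.
  by rewrite -/S; case: (x \in S).
have kS : (#|` A' :+: F| + #|` B :+: F| <= #|` S| + #|` F|)%N by apply: kneser.
have splitB := closure_split B sF pP; rewrite -/U -/V in splitB.
have lA' := leq_card_closure A' sF; have lV := leq_card_closure V sF.
have lU := leq_card_closure U sF; have H0 := subgrp_card_gt1 sH H1.
(* If [a + B] were contained in [S], then [|S| + |H| = |A'| + |H + B| + 1], where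
   all these cardinals are multiples of [|H|]. *)
have [u uU] : exists u, u \in U.
  apply/fset0Pn/negP => /eqP U0; move: cWB; rewrite U0 cardfs0 addn0 => eS.
  have d1 : (#|` H| %| #|` S|)%N by apply: periodic_dvdn => //; apply: periodic_sumsetl.
  have d2 := periodic_dvdn sH pA'.
  have d3 : (#|` H| %| #|` H :+: B|)%N.
    by apply: periodic_dvdn => //; apply/periodic_sumsetl/periodic_subgrp.
  have e : (#|` S| + #|` H| = #|` A'| + #|` H :+: B| + 1)%N by clia.
  have : (#|` H| %| #|` A'| + #|` H :+: B| + 1)%N by rewrite -e dvdn_add.
  rewrite dvdn_addr ?dvdn_add // dvdn1 => /eqP e'.
  by rewrite e' in H0.
have cU : same_coset F U.
  by apply: closure_one_coset => //; have := subgrp_card_gt0 sF; clia.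
have eU := card_closure_coset sF cU uU.
have pV : periodic F V by apply: closure_card_periodic => //; clia.
have eV : B `\` U = V.
  by apply/fsetP => x; rewrite !in_fsetD in_fsetI; case: (x \in B); case: (x \in P).
exists F, U; split => //; split; rewrite ?eV //; [exact: mem_neq0 uU| |by move=> x; rewrite in_fsetD => /andP[]].
apply/negP => /eqP V0.
have eB : B = U by apply/eqP; rewrite eqEfsubset -fsetD_eq0 eV V0 eqxx fsubsetDl.
have KF : {subset K <= F} by apply: gB => //; rewrite eB.
move: uU; rewrite in_fsetD inP => /andP[/negP uS uB]; apply: uS.
have [x xA'] := fset0Pn _ A'0.
rewrite (periodic_eq sF pS (y := x + u)); first exact: mem_sumset.
have -> : a + u - (x + u) = a - x by zmod.
apply: KF; move: xA'; rewrite in_fsetD => /andP[_ /(closureP _ _ sH)[z zA hz]].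
have -> : a - x = (a - z) - (x - z) by zmod.
by case: sK => _; apply; [apply: AK|apply: HK].
Qed.

End Atoms.

Section LargeComplement.
Variable G : zmodType.
Implicit Types (A B C S U V W X Y Z H F P I M L N : {fset G}) (a b c d g h r x y z : G).
Implicit Types (K : {pred G}).

(** Either the period of [X + M] is a group in a coset of which [M] lies, or
    [X + M] is as large as for aperiodic sums. *)
Lemma sidon_sumset M X : sidon M -> M != fset0 -> X != fset0 ->
  (#|` X| + #|` M| <= #|` X :+: M| + 1)%N \/ same_coset (stab (X :+: M)) M.
Proof.
move=> sM M0 X0; have XM0 := sumset_neq0 X0 M0; set F := stab _.
have sF : subgrp F := stab_subgrp XM0.
have kF : (#|` X :+: F| + #|` M :+: F| <= #|` X :+: M| + #|` F|)%N by apply: kneser.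
have lX := leq_card_closure X sF; have lM := leq_card_closure M sF.
have [F1|F1] := eqVneq F triv; first by rewrite F1 card_triv in kF lX lM; left; clia.
have [h|h] := leqP (#|` M :+: F| + 1)%N (#|` M| + #|` F|)%N.
  by right; apply: sidon_one_coset.
by left; clia.
Qed.

(** The smallest subgroup [N] in a coset of which [M] lies either splits [B] or
    is [K].  In the latter case [M] itself has an atom, a coset or a Sidon set
    [L]; since translates of [M] by elements of [L] meet in at most one point, and
    conversely, [L + M] is too large. *)
Lemma sidon_atom K B M : subgroup K -> in_one_coset K B -> (1 < #|` B|)%N ->
  generating K B -> point_least K B -> fragment K B M -> sidon M -> (2 < #|` M|)%N ->
  (forall S, full K S -> (#|` B| + #|` B| + #|` M| < #|` S| + 3)%N) ->
  quasi_periodic B.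
Proof.
move=> sK BK B1 gB kB [M1 MK fM hM] sM M2 hK.
have B0 : B != fset0 by rewrite -cardfs_gt0 ltnW.
have M0 : M != fset0 by rewrite -cardfs_gt0 ltnW.
have [m mM] := fset0Pn _ M0.
(* First the case in which [M] generates [K]: then [M] has an atom [L] itself. *)
have [hN|hN] := classic (exists F, [/\ subgrp F, same_coset F M & ~ {subset K <= F}]); last first.
  have gM : generating K M.
    by move=> F sF cF; apply: NNPP => nKF; apply: hN; exists F.
  have kM : point_least K M.
    move=> X X0 XK fX; have [|/gM KF] := sidon_sumset sM M0 X0; first by [].
    have XM0 := sumset_neq0 X0 M0; have [x xX] := fset0Pn _ XM0.
    case: fX; apply: periodic_full (KF (stab_subgrp XM0)) _ xX.
    exact: stab_periodic.
  have fB : fragment K M B by split; rewrite // ?[B :+: M]sumsetC // addnC; clia.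
  have [L fL Lmin] : exists2 L, fragment K M L &
      forall X, fragment K M X -> (#|` L| <= #|` X|)%N.
    by apply: (@ex_smallest _ (fun P : {fset G} => #|` P|)); exists B.
  have LB := Lmin _ fB; have [L1 LK fLM hL] := fL.
  have [||[x [H [sH H1 eL]]]|sL] := @atom_coset_or_sidon _ K M L sK kM.
  - by [].
  - by move=> S /hK; clia.
  - have cL : #|` L| = #|` H| by rewrite eL card_translate.
    have eLM : L :+: M = translate x (H :+: M) by rewrite eL sumset_translatel.
    have cLM : #|` L :+: M| = #|` H :+: M| by rewrite eLM card_translate.
    have : same_coset H M.
      by apply: sidon_one_coset => //; rewrite sumsetC -cLM; move: hL; rewrite cL; clia.
    move=> /(gM _ sH) KH; case: fLM; rewrite eLM.
    apply: (@periodic_full _ _ _ H (x + (0 + m))) => //.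
      exact/periodic_translate/periodic_sumsetl/periodic_subgrp.
    by rewrite in_translate addrAC subrr add0r mem_sumset ?subgrp0.
  - have [L3|L3] := leqP #|` L| 2.
      have [x xL] : exists x, x \in L by apply/fset0Pn; rewrite -cardfs_gt0; clia.
      have cx := cardfsD1 x L; rewrite xL in cx.
      have [y] : exists y, y \in L `\ x by apply/fset0Pn; rewrite -cardfs_gt0; clia.
      rewrite in_fsetD1 => /andP[yx yL].
      by have := sidon_pair sM xL yL; rewrite eq_sym => /(_ yx); clia.
    have := sidon_triple sM L3; have := sidon_triple sL M2.
    by rewrite [M :+: L]sumsetC; clia.
have [N [sN cN] Nmin] : exists2 N, subgrp N /\ same_coset N M &
    forall P, subgrp P /\ same_coset P M -> (#|` N| <= #|` P|)%N.
  apply: (@ex_smallest _ (fun P : {fset G} => #|` P|)).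
  by have [F [sF cF _]] := hN; exists F.
have Nsub P : subgrp P -> same_coset P M -> {subset N <= P}.
  move=> sP cP; have e : N `&` P = N.
    apply: eq_fsub_card => [x|]; first by rewrite in_fsetI => /andP[].
    apply: Nmin; split; first exact: subgrpI.
    by move=> x y xA yA; rewrite in_fsetI cN // cP.
  by move=> x; rewrite -e in_fsetI => /andP[].
have ncB : ~ same_coset N B.
  have [F [sF cF nKF]] := hN.
  by move=> /(gB _ sN) KN; apply: nKF => k /KN; apply: Nsub.
have NK : {subset N <= K}.
  pose P := [fset x in N | x \in K].
  have PE x : (x \in P) = (x \in N) && (x \in K) by rewrite !inE.
  have sP : subgrp P.
    case: sK => h0 hB; split=> [|u v]; rewrite !PE ?(subgrp0 sN) ?h0 //.
    by move=> /andP[u1 u2] /andP[v1 v2]; rewrite (subgrpB sN) // hB.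
  have cP : same_coset P M by move=> x y xM yM; rewrite PE cN // MK.
  by move=> x /(Nsub _ sP cP); rewrite PE => /andP[].
have cMN := same_coset_card cN.
have N1 : N != triv by apply/negP => /eqP e; rewrite e card_triv in cMN; clia.
(* If the sum of a class [S0] of [B] with [M] is not [N]-periodic, then
   [|S0 + M| >= |S0| + |M| - 1]; hence adding [M] only translates the rest of [B],
   which is therefore [N]-periodic. *)
have [[b bB npb]|hper] := classic (exists2 b, b \in B & ~ periodic N ((B `&` translate b N) :+: M)).
  have pC : periodic N (translate b N) by apply: periodic_coset.
  set C := translate b N in npb pC; set S0 := B `&` C in npb; set S1 := B `\` C.
  have bS0 : b \in S0 by rewrite in_fsetI bB in_translate subrr subgrp0.
  have cS0 : same_coset N S0.
    apply: same_coset_sub (@same_coset_translate _ N b sN) => x.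
    by rewrite in_fsetI => /andP[].
  have S1n : S1 != fset0.
    apply/negP; rewrite fsetD_eq0 => /fsubsetP BC; apply: ncB.
    exact: same_coset_sub BC (@same_coset_translate _ N b sN).
  have big : (#|` S0| + #|` M| <= #|` S0 :+: M| + 1)%N.
    have [//|/Nsub h] := sidon_sumset sM M0 (mem_neq0 bS0).
    case: npb; apply: (@periodic_sub _ _ (stab (S0 :+: M))); last exact: stab_periodic.
    by apply/h/stab_subgrp/sumset_neq0; rewrite ?(mem_neq0 bS0).
  have cB : (#|` S0| + #|` S1| = #|` B|)%N by rewrite cardfsID.
  have cBM : (#|` S0 :+: M| + #|` S1 :+: M| = #|` M :+: B|)%N.
    rewrite -card_disjU; first by rewrite -sumsetUl fsetID sumsetC.
    move=> x /sumsetP[u [v [uS vM ->]]] /sumsetP[u' [v' [uS' vM' e]]].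
    move: uS'; rewrite in_fsetD => /andP[/negP uC _]; apply: uC.
    move: uS; rewrite in_fsetI => /andP[_ uC].
    rewrite (periodic_eq sN pC (y := u)) //.
    have -> : u' - u = v - v' by rewrite -[u'](addrK v') -e; zmod.
    exact: cN.
  have eS1 x : x \in M -> S1 :+: M = translate x S1.
    move=> xM; apply/esym/eq_fsub_card; last by rewrite card_translate; clia.
    by move=> y; rewrite in_translate => h; rewrite -(subrK x y) mem_sumset.
  have cS1 : same_coset (stab S1) M.
    move=> x y xM yM; apply/stabP => // z zS.
    have : z + x \in S1 :+: M by apply: mem_sumset.
    by rewrite (eS1 _ yM) in_translate addrA.
  have pS1 : periodic N S1.
    apply: (@periodic_sub _ _ (stab S1)); last exact: stab_periodic.
    exact/Nsub/cS1/stab_subgrp.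
  have eS : B `\` S0 = S1.
    by apply/fsetP => x; rewrite !in_fsetD in_fsetI; case: (x \in B); rewrite ?andbF.
  exists N, S0; split => //; split; rewrite ?eS ?(mem_neq0 bS0) //.
  by move=> x; rewrite in_fsetI => /andP[].
(* If there is no such class, then [M + B] contains a translate of [N + B], and
   comparison with [N] shows that [M] is a coset of [N], which is not Sidon. *)
have pMB : periodic N (M :+: B).
  move=> _ n /sumsetP[x [b [xM bB ->]]] nN.
  have : b + x + n \in (B `&` translate b N) :+: M.
    apply: NNPP => h; apply: hper; exists b => // /(_ (b + x) n) h'; apply: h; apply: h' => //.
    by apply: mem_sumset; rewrite // in_fsetI bB in_translate subrr subgrp0.
  rewrite [x + b]addrC [M :+: B]sumsetC => h; apply: sumset_subsetl h => y.
  by rewrite in_fsetI => /andP[].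
have sub : {subset translate m (N :+: B) <= M :+: B}.
  move=> x; rewrite in_translate => /sumsetP[n [b [nN bB e]]].
  have -> : x = m + b + n by rewrite -[x](subrK m) e; zmod.
  by apply: pMB => //; apply: mem_sumset.
have fN : ~ full K (N :+: B).
  move=> [s hs]; apply: fM; exists (m + s) => k /hs hk; apply: sub.
  by rewrite in_translate (_ : _ - m = s + k) //; zmod.
have NKc : in_one_coset K N by move=> x y /NK xK /NK yK; case: sK => _; apply.
have := kB _ (subgrp_neq0 sN) NKc fN; have := card_fsubset sub; rewrite card_translate => h1 h2.
have eM : M = translate m N.
  by apply: eq_fsub_card; [exact: same_coset_in|rewrite card_translate; clia].
have [d dN d0] := subgrp_nontriv sN N1; have := sM _ d0.
suff -> : M `&` translate d M = M by clia.
apply/fsetIidPl/fsubsetP => x; rewrite eM in_translate !in_translate => hx.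
have -> : x - d - m = (x - m) - d by zmod.
exact: subgrpB.
Qed.

Lemma fragment_translate K B M g : fragment K B (translate g M) <-> fragment K B M.
Proof.
suff h M' g' : fragment K B M' -> fragment K B (translate g' M').
  split; last exact: h.
  by move=> /(h _ (- g)); rewrite translateD addNr translate0.
case=> [M1 MK fM hM]; split; rewrite ?sumset_translatel ?card_translate //.
- exact: in_one_coset_translate.
- by move=> /full_translate.
Qed.

(** If some set has a boundary smaller than that of a point, then so does a
    subgroup, and it splits [A]; otherwise the atoms determine [B]. *)
Theorem ap_or_quasi_periodic_summand K A B : subgroup K -> in_one_coset K A -> in_one_coset K B ->
  (1 < #|` A|)%N -> (1 < #|` B|)%N -> aperiodic (A :+: B) ->
  (#|` A :+: B| + 1 <= #|` A| + #|` B|)%N -> generating K A -> generating K B ->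
  (forall S, full K S -> (#|` A| + #|` B| + maxn #|` A| #|` B| <= #|` S| + 1)%N) ->
  (exists r, ap r B) \/ quasi_periodic B \/ quasi_periodic A.
Proof.
move=> sK AK BK A1 B1 aAB hc gA gB hK.
have A0 : A != fset0 by rewrite -cardfs_gt0 ltnW.
have B0 : B != fset0 by rewrite -cardfs_gt0 ltnW.
have AB0 := sumset_neq0 A0 B0.
have hKA S : full K S -> (#|` A| + #|` B| + #|` A| <= #|` S| + 1)%N.
  by move=> /hK; have := leq_maxl #|` A| #|` B|; clia.
have hKB S : full K S -> (#|` A| + #|` B| + #|` B| <= #|` S| + 1)%N.
  by move=> /hK; have := leq_maxr #|` A| #|` B|; clia.
have fAB : ~ full K (A :+: B) by move=> /hKB; clia.
have ncH H P : subgrp H -> generating K P -> same_coset H P -> full K (H :+: B).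
  move=> sH gP /(gP _ sH) KH; have [b bB] := fset0Pn _ B0.
  apply: (@periodic_full _ _ _ H (0 + b)) => //; last by rewrite mem_sumset ?subgrp0.
  exact/periodic_sumsetl/periodic_subgrp.
have [kB|nkB] := classic (point_least K B).
  have fA : fragment K B A by [].
  have [M fM Mmin] : exists2 M, fragment K B M &
      forall X, fragment K B X -> (#|` M| <= #|` X|)%N.
    by apply: (@ex_smallest _ (fun P : {fset G} => #|` P|)); exists A.
  have MA := Mmin _ fA; have [M1 MK fMB hM] := fM.
  have [||[x [H [sH H1 eM]]]|sM] := @atom_coset_or_sidon _ K B M sK kB.
  - by [].
  - by move=> S /hKA; clia.
  - right; left; apply: (@coset_atom _ K A B H) => //.
      move=> h hH; have -> : h = (x + h) - x by zmod.
      by apply: MK; rewrite eM in_translate ?subrr ?subgrp0 // addrC addKr.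
    split; first by apply/(fragment_translate _ _ _ x); rewrite -eM.
    by move=> X /Mmin; rewrite eM card_translate.
  have [M3|M3] := leqP #|` M| 2; last first.
    by right; left; apply: (sidon_atom sK BK B1 gB kB fM sM M3) => S /hKB; clia.
  have [x xM] : exists x, x \in M by apply/fset0Pn; rewrite -cardfs_gt0; clia.
  have cx := cardfsD1 x M; rewrite xM in cx.
  have [y] : exists y, y \in M `\ x by apply/fset0Pn; rewrite -cardfs_gt0; clia.
  rewrite in_fsetD1 => /andP[yx yM].
  (* An atom with two elements says that [B] has a small boundary in direction [y - x]. *)
  have r0 : y - x != 0 by rewrite subr_eq0.
  have hr : (#|` B `|` translate (y - x) B| <= #|` B| + 1)%N.
    have : (#|` translate x (B `|` translate (y - x) B)| <= #|` M :+: B|)%N.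
      apply: card_fsubset => z; rewrite in_translate in_fsetU in_translate => /orP[] hz.
        by rewrite -(subrK x z) addrC mem_sumset.
      have -> : z = y + (z - x - (y - x)) by zmod.
      exact: mem_sumset.
    by rewrite card_translate; clia.
  have nst : ~ (forall z, z \in B -> z + (y - x) \in B).
    move=> st; case/eqP: r0; move: aAB => /(aperiodicP AB0); apply => z.
    by move=> /sumsetP[a [b [aA bB ->]]]; rewrite -addrA mem_sumset // st.
  by have [h|h] := ap_or_quasi_periodic r0 hr nst; [left; exists (y - x)|right; left].
(* If points do not have the least boundary, then the period of [X + B], for [X] of
   least boundary, is a subgroup of least boundary. *)
have [X1 [X10 X1K fX1 hX1]] : exists X, [/\ X != fset0, in_one_coset K X,
    ~ full K (X :+: B) & (#|` X :+: B| + 1 < #|` X| + #|` B|)%N].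
  apply: NNPP => hn; apply: nkB => X X0 XK fX; rewrite leqNgt; apply/negP => lt.
  by apply: hn; exists X.
have [X [X0 XK fX] Xmin] : exists2 X, [/\ X != fset0, in_one_coset K X & ~ full K (X :+: B)] &
    forall Y, [/\ Y != fset0, in_one_coset K Y & ~ full K (Y :+: B)] ->
      (#|` X :+: B| - #|` X| <= #|` Y :+: B| - #|` Y|)%N.
  by apply: (@ex_smallest _ (fun P : {fset G} => #|` P :+: B| - #|` P|)%N); exists X1.
have lX := leq_card_sumsetl X B0.
pose Q H := [/\ subgrp H, {subset H <= K}, ~ full K (H :+: B) &
                (#|` H :+: B| + #|` X| <= #|` X :+: B| + #|` H|)%N].
have [H [sH HK fH hH] Hmin] : exists2 H, Q H & forall P, Q P -> (#|` H| <= #|` P|)%N.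
  apply: (@ex_smallest _ (fun P : {fset G} => #|` P|)).
  have XB0 := sumset_neq0 X0 B0; have sF := stab_subgrp XB0.
  have [x xX] := fset0Pn _ X0.
  exists (stab (X :+: B)); split => //.
  - move=> f /(stabP _ XB0) hf; have [b bB] := fset0Pn _ B0.
    have /sumsetP[y [c [yX cB e]]] := hf _ (mem_sumset xX bB).
    have -> : f = (y - x) - (b - c) by rewrite -[LHS](addKr (x + b)) e; zmod.
    by case: sK => _; apply; [apply: XK|apply: BK].
  - move=> [s hs]; apply: fX; exists (x + s) => k /hs /sumsetP[f [b [fF bB e]]].
    have -> : x + s + k = x + b + f by rewrite -addrA e; zmod.
    by move/(stabP _ XB0): fF; apply; apply: mem_sumset.
  - by have := kneser_leq X0 B0; have := leq_card_closure X sF; clia.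
have lH := leq_card_sumsetl H B0.
have lbH : least_boundary K B H.
  split => // Y Y0 YK fY; have := Xmin Y (And3 Y0 YK fY).
  by have := leq_card_sumsetl Y B0; clia.
have hlt : (#|` H :+: B| + 1 < #|` H| + #|` B|)%N.
  by have := Xmin X1 (And3 X10 X1K fX1); have := leq_card_sumsetl X1 B0; clia.
have ncB : ~ same_coset H B by move=> /(ncH _ _ sH gB).
have ncA : ~ same_coset H A by move=> /(ncH _ _ sH gA).
have hHB : (#|` H :+: B| + 1 <= #|` H| + #|` B|)%N by clia.
have hAH := boundary_closure sK AK BK A0 B0 lbH ncB hKB hHB hc.
right; right; apply: (one_incomplete_class sK BK B0 lbH) => // P sP PH hP.
apply: Hmin; split => //; [by move=> p /PH /HK| |clia].
by move/(full_sub (sumset_subsetl PH)).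
Qed.

End LargeComplement.

(** * Unique representations *)

Section Representations.
Variable G : zmodType.
Implicit Types (A B C S U V W X Y Z H F P : {fset G}) (a b c d g h r x y z : G).

Definition uniq_rep A B a b : Prop :=
  [/\ a \in A, b \in B &
      forall a' b', a' \in A -> b' \in B -> a' + b' = a + b -> a' = a /\ b' = b].

Lemma uniq_repC A B a b : uniq_rep A B a b -> uniq_rep B A b a.
Proof.
case=> aA bB h; split => // b' a' b'B a'A; rewrite addrC [b + a]addrC.
by move=> /(h _ _ a'A b'B)[].
Qed.

Lemma nuP A B c p :
  (p \in [fset q in A `*` B | c == q.1 + q.2]) = [&& p.1 \in A, p.2 \in B & c == p.1 + p.2].
Proof. by rewrite !inE andbA. Qed.

Lemma nu_gt0 A B c : c \in A :+: B -> (0 < nu c A B)%N.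
Proof.
move=> /sumsetP[a [b [aA bB ->]]]; rewrite /nu cardfs_gt0; apply/fset0Pn.
by exists (a, b); rewrite nuP /= aA bB eqxx.
Qed.

Lemma nu_eq1P A B c : nu c A B = 1%N <-> exists a b, uniq_rep A B a b /\ c = a + b.
Proof.
split=> [/eqP /cardfs1P[[a b] e]|[a [b [[aA bB h] ec]]]].
  have : (a, b) \in [fset p in A `*` B | c == p.1 + p.2] by rewrite e in_fset1.
  rewrite nuP /= => /and3P[aA bB /eqP ec]; exists a, b; split => //.
  split => // a' b' a'A b'B e'.
  have : (a', b') \in [fset p in A `*` B | c == p.1 + p.2].
    by rewrite nuP /= a'A b'B ec e' eqxx.
  by rewrite e in_fset1 => /eqP[-> ->].
apply/eqP/cardfs1P; exists (a, b); apply/fsetP => -[a' b'].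
rewrite nuP in_fset1 /=; apply/and3P/eqP => [[a'A b'B /eqP e]|[-> ->]].
  by have [-> ->] := h a' b' a'A b'B (etrans (esym e) ec).
by rewrite ec.
Qed.

Lemma nu_leq A B c : B != fset0 -> (nu c A B <= #|` A| * #|` B|)%N.
Proof.
rewrite -cardfs_gt0 => B0; apply: leq_trans (leq_pmulr _ B0).
rewrite /nu; set X := [fset p in _ | _].
have inj : {in X &, injective (fun p : G * G => p.1)}.
  move=> [a b] [a' b']; rewrite !nuP /= => /and3P[_ _ /eqP e] /and3P[_ _ /eqP e'] ea.
  by move: e'; rewrite e -ea => /addrI ->.
rewrite -(card_in_imfset imfset_key inj) /=; apply: card_fsubset => a.
by move=> /imfsetP[p /=]; rewrite nuP => /and3P[pA _ _] ->.
Qed.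

Lemma bigmin_leq (s : seq G) (f : G -> nat) n c : c \in s ->
  (\big[minn/n]_(d <- s) f d <= f c)%N.
Proof.
elim: s => // d s IH; rewrite big_cons inE geq_min.
by case/orP => [/eqP->|/IH ->]; rewrite ?leqnn ?orbT.
Qed.

Lemma mu_leq A B c : c \in A :+: B -> (mu A B <= nu c A B)%N.
Proof. exact: bigmin_leq. Qed.

Lemma mu_attained A B : A != fset0 -> B != fset0 -> exists2 c, c \in A :+: B & mu A B = nu c A B.
Proof.
move=> A0 B0; have [c0 c0S] := fset0Pn _ (sumset_neq0 A0 B0).
have [c cS hc] : exists2 c, c \in A :+: B & forall d, d \in A :+: B -> (nu c A B <= nu d A B)%N.
  by apply: (@ex_smallest _ (fun c => nu c A B)); exists c0.
exists c => //; apply/eqP; rewrite eqn_leq mu_leq //= /mu big_seq.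
elim/big_ind : _ => [|x y hx hy|d dS]; [exact: nu_leq| |exact: hc].
by rewrite leq_min hx.
Qed.

Lemma mu_gt0 A B : A != fset0 -> B != fset0 -> (0 < mu A B)%N.
Proof. by move=> A0 B0; have [c cS ->] := mu_attained A0 B0; apply: nu_gt0. Qed.

Lemma mu_eq1P A B : A != fset0 -> B != fset0 ->
  mu A B = 1%N <-> exists a b, uniq_rep A B a b.
Proof.
move=> A0 B0; split=> [|[a [b hab]]].
  have [c cS ->] := mu_attained A0 B0; move=> /nu_eq1P[a [b [h _]]].
  by exists a, b.
have [aA bB _] := hab; apply/eqP; rewrite eqn_leq mu_gt0 // andbT.
apply: leq_trans (mu_leq (mem_sumset aA bB)) _.
by have /(_ A B (a + b)) [_ ->] := nu_eq1P; last by exists a, b.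
Qed.

Lemma mu_gt1P A B : A != fset0 -> B != fset0 ->
  (1 < mu A B)%N <-> ~ exists a b, uniq_rep A B a b.
Proof.
move=> A0 B0; rewrite -(mu_eq1P A0 B0); have := mu_gt0 A0 B0.
by case: (mu A B) => [|[|n]] // _; split.
Qed.

(** Reflected in [a + b], the part of [B] becomes a subset of the coset of [a] that
    meets the part of [A] in [a] only. *)
Lemma uniq_rep_card A B a b H : subgrp H -> uniq_rep A B a b ->
  (#|` A `&` translate a H| + #|` B `&` translate b H| <= #|` H| + 1)%N.
Proof.
move=> sH [aA bB h]; set X := A `&` _; set Y := B `&` _.
pose Y' := translate (a + b) (oppset Y).
have cY : #|` Y'| = #|` Y| by rewrite card_translate card_oppset.
rewrite -cY -cardfsUI; apply: leq_add.
  rewrite -(card_translate a H); apply: card_fsubset => x; rewrite in_fsetU => /orP[].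
    by rewrite in_fsetI => /andP[].
  rewrite !in_translate in_oppset in_fsetI in_translate => /andP[_].
  by rewrite -(subgrpNE _ sH) (_ : - _ = x - a) //; zmod.
rewrite -(cardfs1 a); apply: card_fsubset => x; rewrite in_fsetI in_fset1 => /andP[].
rewrite in_fsetI => /andP[xA _]; rewrite in_translate in_oppset in_fsetI => /andP[xB _].
by have [|-> //] := h _ _ xA xB; zmod.
Qed.

(** If the sum has a period [F], Kneser's bound loses up to [|F|] elements; these
    are recovered as holes of [A] and [B] in the [F]-cosets of [a] and [b]. *)
Lemma critical_geq A B : A != fset0 -> B != fset0 ->
  aperiodic (A :+: B) \/ (exists a b, uniq_rep A B a b) ->
  (#|` A| + #|` B| <= #|` A :+: B| + 1)%N.
Proof.
move=> A0 B0 [|[a [b hab]]]; first exact: kneser_aperiodic.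
have AB0 := sumset_neq0 A0 B0; set F := stab (A :+: B).
have sF : subgrp F := stab_subgrp AB0.
have kF : (#|` A :+: F| + #|` B :+: F| <= #|` A :+: B| + #|` F|)%N by apply: kneser.
have hc := uniq_rep_card sF hab; have [aA bB _] := hab.
have part X x : x \in X -> (#|` X| + #|` F| <= #|` X :+: F| + #|` X `&` translate x F|)%N.
  move=> xX; rewrite (closure_split X sF (@periodic_coset _ F x sF)).
  rewrite (card_closure_coset (a := x) sF).
  - by have := leq_card_closure (X `\` translate x F) sF; have := cardfsID (translate x F) X; clia.
  - apply: same_coset_sub (@same_coset_translate _ F x sF) => y.
    by rewrite in_fsetI => /andP[].
  - by rewrite in_fsetI xX in_translate subrr subgrp0.
by have := part _ _ aA; have := part _ _ bB; clia.
Qed.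

(** ** Finite subgroups as bundled closed predicates *)

Lemma subgrp_zmodClosed H : subgrp H -> exists Z : zmodClosed G, Z =i H.
Proof.
move=> sH; pose P : {pred G} := fun x => x \in H.
have hP : zmod_closed P.
  by split=> [|x y xH yH]; [apply: (subgrp0 sH)|apply: (subgrpB sH xH yH)].
pose Z : zmodClosed G := HB.pack P (GRing.isZmodClosed.Build G P hP).
by exists Z => x.
Qed.

Lemma zmodClosed_subgrp (Z : zmodClosed G) H : Z =i H -> subgrp H.
Proof.
move=> e; split; first by rewrite -e rpred0.
by move=> x y; rewrite -!e; apply: rpredB.
Qed.

End Representations.

(** * Critical pairs with an aperiodic sum *)

Section Aperiodic.
Variable G : zmodType.
Implicit Types (A B C S U V W X Y Z H K F P : {fset G}) (a b c d g h r x y z : G).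

Definition splits A B : Prop := exists A0 B0 H, decomp A B A0 B0 H.

Lemma splitsC A B : splits A B -> splits B A.
Proof. by move=> [A0 [B0 [H /decompC h]]]; exists B0, A0, H. Qed.

Lemma quasi_splits A B : A != fset0 -> aperiodic (A :+: B) ->
  (#|` A :+: B| + 1 <= #|` A| + #|` B|)%N -> quasi_periodic B -> splits A B.
Proof.
move=> A0 aAB hc [H [B0 [sH H1 qB]]].
by have [A1 [F h]] := quasi_decomp A0 sH H1 aAB hc qB; exists A1, B0, F.
Qed.

Lemma oppset_quasi_periodic B : quasi_periodic (oppset B) -> quasi_periodic B.
Proof.
move=> [H [S0 [sH H1 [h1 h2 h3 h4 h5]]]]; exists H, (oppset S0); split => //.
have e : B `\` oppset S0 = oppset (oppset B `\` S0).
  by apply/fsetP => x; rewrite in_oppset !in_fsetD !in_oppset opprK.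
split; rewrite ?e ?oppset_neq0 //.
- by move=> x; rewrite in_oppset => /h3; rewrite in_oppset opprK.
- move=> x d; rewrite !in_oppset => xS dH; rewrite opprD; apply: h4 => //.
  exact: subgrpN.
- move=> x y; rewrite !in_oppset => xS yS; rewrite subgrpBC //.
  have -> : y - x = - x - - y by zmod.
  exact: h5.
Qed.

Lemma oppset_ap B r : ap r (oppset B) -> ap (- r) B.
Proof.
move=> [z [e B0]]; exists (- z); split; last by rewrite -oppset_neq0.
apply/fsetP => x; have -> : (x \in B) = (- x \in oppset B) by rewrite in_oppset opprK.
rewrite e card_oppset; apply/progP/progP => -[i hi ei]; exists i => //.
  by rewrite mulNrn -[x]opprK ei opprD.
by rewrite ei mulNrn opprD !opprK.
Qed.

Lemma same_coset_oppset H B : same_coset H (oppset B) <-> same_coset H B.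
Proof.
suff h X : same_coset H X -> same_coset H (oppset X).
  by split; [move=> /h; rewrite oppsetK|apply: h].
move=> cX x y; rewrite !in_oppset => xX yX.
have -> : x - y = - y - - x by zmod.
exact: cX.
Qed.

(** The complement of [C - B] is [A] itself: a larger set would have the same sum
    with [B] as [A], against Kneser's bound. *)
Lemma dual_pair K A B a b : subgrp K -> K != triv -> same_coset K A -> same_coset K B ->
  a \in A -> b \in B -> aperiodic (A :+: B) -> (#|` A :+: B| + 1 <= #|` A| + #|` B|)%N ->
  let C := translate (a + b) K `\` (A :+: B) in C != fset0 ->
  [/\ C :+: oppset B = translate a K `\` A, aperiodic (C :+: oppset B) &
      (#|` C :+: oppset B| + 1 <= #|` C| + #|` oppset B|)%N].
Proof.
move=> sK K1 cA cB aA bB aAB hc C C0; set D := C :+: oppset B.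
have A0 := mem_neq0 aA; have B0 := mem_neq0 bB; have AB0 := sumset_neq0 A0 B0.
have ABT : {subset A :+: B <= translate (a + b) K}.
  apply/fsubsetP/sumset_sub => x y xA yB; rewrite in_translate.
  have -> : x + y - (a + b) = (x - a) + (y - b) by zmod.
  by apply: subgrpD => //; [apply: cA|apply: cB].
have cC : (#|` C| + #|` A :+: B| = #|` K|)%N by apply: card_coset_diff.
have AK : {subset A <= translate a K} by move=> x xA; rewrite in_translate; apply: cA.
have DK : {subset D <= translate a K}.
  apply/fsubsetP/sumset_sub => x y; rewrite in_fsetD !in_translate in_oppset => /andP[_ xK] yB.
  have -> : x + y - a = (x - (a + b)) - (- y - b) by zmod.
  by apply: subgrpB => //; apply: cB.
have DA x : x \in D -> x \in A -> False.
  move=> /sumsetP[c [y [cC' yB e]]] xA; move: cC'; rewrite in_fsetD => /andP[/negP h _].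
  apply: h; have -> : c = x + (- y) by rewrite e; zmod.
  by apply: mem_sumset => //; rewrite -in_oppset.
set A' := translate a K `\` D.
have AA' : {subset A <= A'}.
  by move=> x xA; rewrite in_fsetD AK // andbT; apply/negP => /DA; apply.
have eA'B : A' :+: B = A :+: B.
  apply/eqP; rewrite eqEfsubset; apply/andP; split; last first.
    by apply: sumsetSS => //; apply/fsubsetP.
  apply: sumset_sub => x y; rewrite in_fsetD in_translate => /andP[xD xK] yB.
  apply/negPn/negP => h; case/negP: xD.
  have -> : x = (x + y) + (- y) by zmod.
  apply: mem_sumset; last by rewrite in_oppset opprK.
  rewrite in_fsetD h in_translate; have -> : x + y - (a + b) = (x - a) + (y - b) by zmod.
  by apply: subgrpD => //; apply: cB.
have eA : A = A'.
  apply: eq_fsub_card => //; have A'0 : A' != fset0 by apply: (mem_neq0 (AA' _ aA)).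
  by have := kneser_aperiodic A'0 B0; rewrite eA'B => /(_ aAB); clia.
have eD : D = translate a K `\` A by rewrite eA fsetDK //; apply/fsubsetP.
have cD : (#|` D| + #|` A| = #|` K|)%N by rewrite eD; apply: card_coset_diff.
split => //; last by rewrite -/D card_oppset; clia.
have D0 : D != fset0 by apply: sumset_neq0; rewrite ?oppset_neq0.
apply/aperiodicP => // d hd; have [x xD] := fset0Pn _ D0.
have dD : d \in stab D by apply/stabP.
have dK : d \in K.
  have -> : d = (x + d - a) - (x - a) by zmod.
  by apply: subgrpB => //; rewrite -in_translate; apply: DK => //; apply: hd.
have hA y : y \in A -> y + d \in A.
  move=> yA; rewrite eA in_fsetD in_translate.
  have -> : y + d - a = (y - a) + d by zmod.
  have hya : y - a + d \in K by apply: subgrpD => //; apply: cA.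
  rewrite hya andbT; apply/negP => /(@stab_periodic _ D) /(_ (subgrpN (stab_subgrp D0) dD)).
  by rewrite addrK => /DA; apply.
move: aAB => /(aperiodicP AB0); apply => _ /sumsetP[y [z [yA zB ->]]].
by rewrite addrAC mem_sumset // hA.
Qed.

Lemma mem_subgroup K : subgrp K -> subgroup (mem K).
Proof. by case. Qed.

(** When [A] is the largest of [A], [B] and [C = K \ (A + B)], the pair
    [(C, -B)] has a large complement, namely [A]. *)
Lemma ap_or_quasi_periodic_dual K A B a b : subgrp K -> K != triv ->
  same_coset K A -> same_coset K B -> a \in A -> b \in B -> (1 < #|` B|)%N ->
  aperiodic (A :+: B) -> (#|` A :+: B| + 1 <= #|` A| + #|` B|)%N ->
  (forall F, subgrp F -> same_coset F B -> {subset K <= F}) ->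
  (#|` A :+: B| + 2 <= #|` K|)%N ->
  (#|` B| <= #|` A|)%N -> (#|` K| <= #|` A| + #|` A :+: B|)%N ->
  (exists r, ap r B) \/ quasi_periodic B.
Proof.
move=> sK K1 cA cB aA bB B1 aAB hc gB hK BA CA.
set C := translate (a + b) K `\` (A :+: B).
have cAB : same_coset K (A :+: B) by apply: same_coset_sumset.
have ABT := same_coset_in cAB (mem_sumset aA bB).
have cC : (#|` C| + #|` A :+: B| = #|` K|)%N by apply: card_coset_diff.
have C0 : C != fset0 by rewrite -cardfs_gt0; clia.
have [eD aD hD] := dual_pair sK K1 cA cB aA bB aAB hc C0; rewrite -/C in eD aD hD.
have B0 := mem_neq0 bB; have B'0 : oppset B != fset0 by rewrite oppset_neq0.
have qB' : quasi_periodic (oppset B) -> (exists r, ap r B) \/ quasi_periodic B.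
  by move=> /oppset_quasi_periodic; right.
have cCK : same_coset K C.
  apply: same_coset_sub (@same_coset_translate _ K (a + b) sK) => x.
  by rewrite in_fsetD => /andP[].
have gB' : generating (mem K) (oppset B).
  by move=> F sF /same_coset_oppset; apply: gB.
have kB : (#|` A| + #|` B| <= #|` A :+: B| + 1)%N.
  by apply: kneser_aperiodic => //; apply: mem_neq0 aA.
have [gC|ngC] := classic (generating (mem K) C); last first.
  have [F [sF cF nF]] : exists F, [/\ subgrp F, same_coset F C & ~ {subset K <= F}].
    apply: NNPP => hn; apply: ngC => F sF cF; apply: NNPP => nF.
    by apply: hn; exists F.
  apply: qB'; apply: (coset_summand sF cF _ _ aD hD); first by clia.
  by move=> /(gB' _ sF).
have [||||[r /oppset_ap h]|[h|[F [C1 [sF F1 qC]]]]] :=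
    @ap_or_quasi_periodic_summand _ (mem K) C (oppset B) (mem_subgroup sK) cCK _ _ _ aD hD gC gB'.
- by apply/same_coset_oppset.
- by clia.
- by rewrite card_oppset.
- move=> S [s hs]; have : (#|` K| <= #|` S|)%N.
    rewrite -(card_translate s K); apply: card_fsubset => x; rewrite in_translate.
    by move=> /hs; rewrite addrC subrK.
  by rewrite card_oppset; clia.
- by left; exists (- r).
- exact: qB'.
apply: qB'; have aD' : aperiodic (oppset B :+: C) by rewrite sumsetC.
have hD' : (#|` oppset B :+: C| + 1 <= #|` oppset B| + #|` C|)%N.
  by rewrite sumsetC [X in (_ <= X)%N]addnC.
have [B1' [L [[sL L1 _] [h1 h2 h3 h4] [p1 p2 q1 q2] hu _]]] := quasi_decomp B'0 sF F1 aD' hD' qC.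
have [_ C10 _ _ _] := qC.
exists L, B1'; split => //; split => //; apply/negP => /eqP e.
have eB : oppset B = B1'.
  by apply/eqP; rewrite eqEfsubset -fsetD_eq0 e eqxx; apply/fsubsetP.
have KL : {subset K <= L} by apply: gB' => //; rewrite eB.
have [c1 c1C] := fset0Pn _ C10; have [c0 c0C] := fset0Pn _ h2; have [y yB] := fset0Pn _ h1.
move: (c1C); rewrite in_fsetD => /andP[/negP n1 c1C'].
have [] := hu y c1 y c0 _ c1C' yB c0C; first by rewrite eB.
  have -> : y + c1 - (y + c0) = c1 - c0 by zmod.
  by apply/KL/cCK => //; apply: h4.
by move=> _ /n1.
Qed.

(** If [A + B] misses exactly one element [c] of a coset of [K], then [B] is the
    complement of [c - A].  When moreover some sum [c'] has a unique
    representation, [A] and [A + (c' - c)] differ in one element only. *)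
Lemma one_missing K A B a b : subgrp K -> same_coset K A -> same_coset K B ->
  a \in A -> b \in B -> aperiodic (A :+: B) ->
  #|` K| = (#|` A| + #|` B|)%N -> (#|` A :+: B| + 1 = #|` A| + #|` B|)%N ->
  elementary_IV A B \/ (exists r, ap r A) \/ quasi_periodic A.
Proof.
move=> sK cA cB aA bB aAB eK hc.
have cAB : same_coset K (A :+: B) by apply: same_coset_sumset.
have ABT := same_coset_in cAB (mem_sumset aA bB); set T := translate (a + b) K in ABT.
have A0 := mem_neq0 aA; have B0 := mem_neq0 bB; have AB0 := sumset_neq0 A0 B0.
have /eqP/cardfs1P[c eC] : #|` T `\` (A :+: B)| = 1%N.
  by have := card_coset_diff sK ABT; rewrite -/T; clia.
have : c \in T `\` (A :+: B) by rewrite eC in_fset1.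
rewrite in_fsetD in_translate => /andP[cN cT].
(* [A] and [c - B] are disjoint and fill the coset of [a]. *)
have cpl x : x - a \in K -> (x \in A) = (c - x \notin B).
  move=> xK; apply/idP/idP => [xA|].
    by apply: contra cN => /(mem_sumset xA); rewrite addrC subrK.
  set Y := translate c (oppset B).
  have hY z : (z \in Y) = (c - z \in B) by rewrite in_translate in_oppset opprB.
  have YK : {subset Y <= translate a K}.
    move=> z; rewrite hY in_translate => zB.
    have -> : z - a = (c - (a + b)) - (c - z - b) by zmod.
    by apply: subgrpB => //; apply: cB.
  have AK := same_coset_in cA aA.
  have cAY : #|` A `|` Y| = #|` K|.
    rewrite card_disjU ?card_translate ?card_oppset // => z zA; rewrite hY => zB.
    by case/negP: cN; have := mem_sumset zA zB; rewrite addrC subrK.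
  have eAY : A `|` Y = translate a K.
    apply: eq_fsub_card; last by rewrite card_translate cAY.
    by move=> z; rewrite in_fsetU => /orP[/AK|/YK].
  have : x \in A `|` Y by rewrite eAY in_translate.
  by rewrite in_fsetU hY => /orP[->|->].
have aS X Y : X != fset0 -> (forall d, (forall x, x \in X -> x + d \in X) ->
    (forall y, y \in Y -> y + d \in Y)) -> aperiodic Y -> Y != fset0 -> aperiodic X.
  move=> X0 h aY Y0; apply/aperiodicP => // d /h hd.
  by move: aY => /(aperiodicP Y0); apply.
have [mu2|nmu] := boolP (1 < mu A B)%N.
  left; have [Z ZE] := subgrp_zmodClosed sK.
  set H1 := translate (- a) A; set H2 := oppset (translate (a - c) B).
  have H1E x : (x \in H1) = (a + x \in A) by rewrite in_translate opprK addrC.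
  have H2E x : (x \in H2) = (c - a - x \in B).
    by rewrite in_oppset in_translate; congr (_ \in B); zmod.
  have H1K x : x \in H1 -> x \in K.
    by rewrite H1E => /cA /(_ aA); rewrite addrC addKr.
  have H2K x : x \in H2 -> x \in K.
    rewrite H2E => h; have -> : x = (c - (a + b)) - (c - a - x - b) by zmod.
    by apply: subgrpB => //; apply: cB.
  have H10 : H1 != fset0 by apply: (@mem_neq0 _ _ 0); rewrite H1E addr0.
  have H20 : H2 != fset0.
    by apply: (@mem_neq0 _ _ (c - a - b)); rewrite H2E (_ : _ - _ = b) //; zmod.
  exists a, (c - a), Z, H1, H2; split => //; first split => //.
  - apply: (aS H1 (A :+: B)) => // d hd _ /sumsetP[x [y [xA yB ->]]].
    rewrite addrAC mem_sumset //; have := hd (x - a); rewrite !H1E.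
    have -> : a + (x - a) = x by zmod.
    have -> : a + (x - a + d) = x + d by zmod.
    exact.
  - apply: (aS H2 (A :+: B)) => // d hd.
    have hd' y : y \in B -> y - d \in B.
      move=> yB; have := hd (c - a - y); rewrite !H2E.
      have -> : c - a - (c - a - y) = y by zmod.
      have -> : c - a - (c - a - y + d) = y - d by zmod.
      by apply.
    have e := stable_translate hd'.
    move=> _ /sumsetP[x [y [xA yB ->]]]; rewrite -addrA mem_sumset //.
    by move: yB; rewrite -{1}e in_translate opprK.
  - rewrite -fsetI_eq0; apply/eqP/fsetP => x; rewrite in_fsetI H1E H2E in_fset0.
    apply/negP => /andP[h1 h2]; move: (h1); rewrite cpl; last exact: cA.
    by rewrite (_ : c - (a + x) = c - a - x) ?h2 //; zmod.
  - move=> x; rewrite ZE in_fsetU; apply/idP/orP => [xK|[/H1K|/H2K] //].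
    rewrite H1E H2E cpl; last by rewrite addrC addKr.
    rewrite (_ : c - (a + x) = c - a - x); last by zmod.
    by case: (_ \in B); [right|left].
  - by rewrite /H1 translateD subrr translate0.
  - by rewrite /H2 oppsetK translateD (_ : c - a + (a - c) = 0) ?translate0 //; zmod.
right; have [a' [b' [a'A b'B hu]]] : exists a b, uniq_rep A B a b.
  by apply: NNPP => hn; case/negP: nmu; apply/mu_gt1P.
(* As [B] is the complement of [c - A], the unique representation says that [a'] is
   the only element of [A] outside [A + r]. *)
set r := a' + b' - c.
have r0 : r != 0.
  by rewrite subr_eq0; apply: contraNneq cN => <-; apply: mem_sumset.
have rK : r \in K.
  have -> : r = (a' + b' - (a + b)) - (c - (a + b)) by rewrite /r; zmod.
  by apply: subgrpB => //; apply: cAB; apply: mem_sumset.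
have hx x : x \in A -> (x - r \in A) = (a' + b' - x \notin B).
  move=> xA; rewrite cpl; last first.
    have -> : x - r - a = (x - a) - r by zmod.
    by apply: subgrpB => //; apply: cA.
  by have -> : c - (x - r) = a' + b' - x by rewrite /r; zmod.
have a'r : a' - r \notin A by rewrite hx // addrC addKr negbK.
have hp x : x \in A -> x != a' -> x - r \in A.
  move=> xA; rewrite hx //; apply: contraNN => xB.
  by have [|-> //] := hu x _ xA xB; rewrite addrC subrK.
have nst : ~ (forall x, x \in A -> x + r \in A).
  move=> st; case/negP: a'r; have e := stable_translate st.
  by move: a'A; rewrite -{1}e in_translate.
have hU : (#|` A `|` translate r A| <= #|` A| + 1)%N.
  have := cardfsID (translate r A) A; have := cardfsUI A (translate r A).
  have : (#|` A `\` translate r A| <= 1)%N.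
    rewrite -(cardfs1 a'); apply: card_fsubset => x; rewrite in_fsetD in_fset1 in_translate.
    by move=> /andP[xr xA]; apply: contraNT xr; apply: hp.
  by rewrite card_translate; clia.
by have [h|h] := ap_or_quasi_periodic r0 hU nst; [left; exists r|right].
Qed.

Lemma ap_elementary_or_splits A B r : A != fset0 -> (1 < #|` B|)%N -> ap r B ->
  aperiodic (A :+: B) -> (#|` A :+: B| + 1 <= #|` A| + #|` B|)%N ->
  elementary_II A B \/ splits A B.
Proof.
move=> A0 B1 hB aAB hc; have B0 : B != fset0 by rewrite -cardfs_gt0 ltnW.
have [hA|hA] := ap_summand A0 hB B1 aAB hc.
  by left; apply: (ap_elementary_II hA hB); apply: kneser_aperiodic.
by right; apply/splitsC/quasi_splits; rewrite // 1?sumsetC // addnC; clia.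
Qed.

Lemma elementary_IIC A B : elementary_II A B -> elementary_II B A.
Proof. by move=> [d [hA hB ho]]; exists d; split; rewrite // addnC. Qed.

Theorem aperiodic_critical A B : (1 < #|` A|)%N -> (1 < #|` B|)%N ->
  aperiodic (A :+: B) -> (#|` A :+: B| + 1 <= #|` A| + #|` B|)%N ->
  elementary A B \/ splits A B.
Proof.
move=> A1 B1 aAB hc.
have A0 : A != fset0 by rewrite -cardfs_gt0 ltnW.
have B0 : B != fset0 by rewrite -cardfs_gt0 ltnW.
have AB0 := sumset_neq0 A0 B0.
have aBA : aperiodic (B :+: A) by rewrite sumsetC.
have hc' : (#|` B :+: A| + 1 <= #|` B| + #|` A|)%N by rewrite sumsetC; clia.
have [a aA] := fset0Pn _ A0; have [b bB] := fset0Pn _ B0.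
have qB : quasi_periodic B -> elementary A B \/ splits A B.
  by move=> h; right; apply: quasi_splits.
have qA : quasi_periodic A -> elementary A B \/ splits A B.
  by move=> h; right; apply/splitsC/quasi_splits.
have pB : (exists r, ap r B) -> elementary A B \/ splits A B.
  move=> [r h]; have [h'|h'] := ap_elementary_or_splits A0 B1 h aAB hc; last by right.
  by left; apply: Or42.
have pA : (exists r, ap r A) -> elementary A B \/ splits A B.
  move=> [r h]; have [h'|h'] := ap_elementary_or_splits B0 A1 h aBA hc'.
    by left; apply/Or42/elementary_IIC.
  by right; apply: splitsC.
have [[F [sF cA ncB]]|nAB] := classic (exists F, [/\ subgrp F, same_coset F A & ~ same_coset F B]).
  by apply: qB; apply: (coset_summand sF cA A1 ncB).
have [[F [sF cB ncA]]|nBA] := classic (exists F, [/\ subgrp F, same_coset F B & ~ same_coset F A]).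
  by apply: qA; apply: (coset_summand sF cB B1 ncA).
have AtoB F : subgrp F -> same_coset F A -> same_coset F B.
  by move=> sF cA; apply: NNPP => ncB; apply: nAB; exists F.
have BtoA F : subgrp F -> same_coset F B -> same_coset F A.
  by move=> sF cB; apply: NNPP => ncA; apply: nBA; exists F.
have [[F [sF cF]]|nF] := classic (exists F, subgrp F /\ same_coset F A); last first.
  have fG S : ~ full (fun=> true) S.
    move=> [s hs]; apply: nF; exists (translate (- s) S).
    have h x : x \in translate (- s) S by rewrite in_translate opprK addrC hs.
    by split; [split => *; apply: h|move=> x y _ _; apply: h].
  have [||||||/pB //|[/qB //|/qA //]] := @ap_or_quasi_periodic_summand G (fun=> true) A B _ _ _ A1 B1 aAB hc.
  - by split.
  - by [].
  - by [].
  - by move=> F sF cF; case: nF; exists F.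
  - by move=> F sF /(BtoA _ sF) cF; case: nF; exists F.
  - by move=> S /fG.
have [K [sK cA] Kmin] : exists2 K, subgrp K /\ same_coset K A &
    forall P, subgrp P /\ same_coset P A -> (#|` K| <= #|` P|)%N.
  by apply: (@ex_smallest _ (fun P : {fset G} => #|` P|)); exists F.
have cB := AtoB _ sK cA.
have gA P : subgrp P -> same_coset P A -> {subset K <= P}.
  move=> sP cP; have e : K `&` P = K.
    apply: eq_fsub_card => [x|]; first by rewrite in_fsetI => /andP[].
    apply: Kmin; split; first exact: subgrpI.
    by move=> x y xA yA; rewrite in_fsetI cA // cP.
  by move=> x; rewrite -e in_fsetI => /andP[].
have gB P : subgrp P -> same_coset P B -> {subset K <= P}.
  by move=> sP /(BtoA _ sP); apply: gA.
have K1 : K != triv.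
  by apply/negP => /eqP e; have := same_coset_card cA; rewrite e card_triv; clia.
have cAB : same_coset K (A :+: B) by apply: same_coset_sumset.
have lt : (#|` A :+: B| < #|` K|)%N.
  rewrite ltnNge; apply/negP => hle; have [d dK /eqP[]] := subgrp_nontriv sK K1.
  have e : A :+: B = translate (a + b) K.
    apply: eq_fsub_card; last by rewrite card_translate.
    by apply: same_coset_in => //; apply: mem_sumset.
  apply/eqP; rewrite -in_triv; have /(aperiodic_stab AB0) <- := aAB.
  by apply: (sub_stab AB0) dK; rewrite e; apply: periodic_coset.
have kAB := kneser_aperiodic A0 B0 aAB.
have eAB : (#|` A :+: B| + 1 = #|` A| + #|` B|)%N by clia.
have [eK|nK] := eqVneq #|` K| (#|` A| + #|` B|)%N.
  have [h|[/pA|/qA]] := one_missing sK cA cB aA bB aAB eK eAB; [|by []|by []].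
  by left; apply: Or44.
have lt2 : (#|` A :+: B| + 2 <= #|` K|)%N by move: nK; clia.
have [CA|CA] := leqP (maxn #|` A| #|` B|) (#|` K| - #|` A :+: B|).
  have [||||||/pB //|[/qB //|/qA //]] := @ap_or_quasi_periodic_summand G (mem K) A B _ _ _ A1 B1 aAB hc.
  - exact: mem_subgroup.
  - by [].
  - by [].
  - by [].
  - by [].
  - move=> S [s hs]; have : (#|` K| <= #|` S|)%N.
      rewrite -(card_translate s K); apply: card_fsubset => x; rewrite in_translate.
      by move=> /hs; rewrite addrC subrK.
    by clia.
have [BA|AB] := leqP #|` B| #|` A|.
  have [|/pB //|/qB //] := ap_or_quasi_periodic_dual sK K1 cA cB aA bB B1 aAB hc gB lt2 BA.
  by move: CA; rewrite (maxn_idPl BA); clia.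
have [|||/pA //|/qA //] := ap_or_quasi_periodic_dual sK K1 cB cA bB aA A1 aBA hc' gA.
- by rewrite sumsetC.
- exact: ltnW.
- by move: CA; rewrite (maxn_idPr (ltnW AB)) [B :+: A]sumsetC; clia.
Qed.

End Aperiodic.

(** * Critical pairs with a periodic sum *)

Section Periodic.
Variable G : zmodType.
Implicit Types (A B C S U V W X Y Z H K F P D : {fset G}) (a b c d g h r x y z : G).

Lemma coset_part X F x : subgrp F -> x \in X ->
  [/\ x \in X `&` translate x F, same_coset F (X `&` translate x F) &
      #|` X :+: F| = (#|` (X `\` translate x F) :+: F| + #|` F|)%N].
Proof.
move=> sF xX; have h1 : x \in X `&` translate x F by rewrite in_fsetI xX in_translate subrr subgrp0.
have h2 : same_coset F (X `&` translate x F).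
  by apply: same_coset_sub (@same_coset_translate _ F x sF) => y; rewrite in_fsetI => /andP[].
split => //; rewrite (closure_split X sF (@periodic_coset _ F x sF)) addnC.
by rewrite (card_closure_coset sF h2 h1).
Qed.

Lemma setD_capD X Y : X `\` (X `&` Y) = X `\` Y.
Proof. by apply/fsetP => x; rewrite !in_fsetD in_fsetI; case: (x \in X); rewrite ?andbF. Qed.

(** If the period [F] of [A + B] is not trivial and [a + b] has a unique
    representation, then Kneser's bound shows that all the holes of [A] and [B]
    lie in the [F]-cosets of [a] and [b]. *)
Lemma uniq_rep_periodic A B a b : uniq_rep A B a b -> ~ aperiodic (A :+: B) ->
  (#|` A :+: B| + 1 <= #|` A| + #|` B|)%N ->
  splits A B \/ exists F, [/\ subgrp F, same_coset F A, same_coset F B &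
                           (#|` A| + #|` B| = #|` F| + 1)%N].
Proof.
move=> hab; have [aA bB hu] := hab; move=> nap hc.
have A0 := mem_neq0 aA; have B0 := mem_neq0 bB; have AB0 := sumset_neq0 A0 B0.
set F := stab (A :+: B); have sF : subgrp F := stab_subgrp AB0.
have F1 : F != triv by apply/negP => /eqP /(aperiodic_stab AB0).
have kF : (#|` A :+: F| + #|` B :+: F| <= #|` A :+: B| + #|` F|)%N by apply: kneser.
have hA0 := uniq_rep_card sF hab.
have [aX cX eX] := coset_part sF aA; have [bY cY eY] := coset_part sF bB.
have := cardfsID (translate a F) A; have := cardfsID (translate b F) B.
set X := A `&` translate a F in aX cX hA0 *; set Y := B `&` translate b F in bY cY hA0 *.
set V := A `\` translate a F in eX *; set W := B `\` translate b F in eY *.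
move=> cB cA; have lV := leq_card_closure V sF; have lW := leq_card_closure W sF.
have pV : periodic F V by apply: closure_card_periodic => //; clia.
have pW : periodic F W by apply: closure_card_periodic => //; clia.
have eV : A `\` X = V by apply: setD_capD.
have eW : B `\` Y = W by apply: setD_capD.
have [hVW|hVW] := boolP ((V == fset0) && (W == fset0)).
  right; exists F; move: hVW => /andP[/eqP V0 /eqP W0].
  have eAX : A = X by apply/eqP; rewrite eqEfsubset -fsetD_eq0 eV V0 eqxx fsubsetIl.
  have eBY : B = Y by apply/eqP; rewrite eqEfsubset -fsetD_eq0 eW W0 eqxx fsubsetIl.
  split => //; rewrite ?eAX ?eBY //.
  move: eX eY lV lW; rewrite V0 W0 cardfs0 => eX eY lV lW.
  move: cA cB; rewrite V0 W0 cardfs0; clia.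
left; exists X, Y, F; split.
- by split => //; rewrite eV eW; apply/orP; rewrite -negb_and.
- split; [exact: mem_neq0 aX|exact: mem_neq0 bY| |] => x; rewrite in_fsetI => /andP[] //.
- by rewrite eV eW.
- move=> a1 b1 a0 b0 a1A b1B a0X b0Y h.
  have {}h : a1 + b1 - (a + b) \in F.
    have -> : a1 + b1 - (a + b) = (a1 + b1 - (a0 + b0)) + ((a0 - a) + (b0 - b)) by zmod.
    by apply: subgrpD => //; apply: subgrpD => //; [apply: cX|apply: cY].
  have a1X : a1 \in X.
    rewrite in_fsetI a1A; apply/negPn/negP => a1N.
    have h1 : a + b - b1 \in V.
      rewrite (periodic_eq sF pV (y := a1)) ?in_fsetD ?a1N // subgrpBC //.
      by have -> : a1 - (a + b - b1) = a1 + b1 - (a + b) by zmod.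
    move: (h1); rewrite in_fsetD => /andP[h2 h3].
    have [|e _] := hu _ _ h3 b1B; first by rewrite subrK.
    by case/negP: h2; rewrite e in_translate subrr subgrp0.
  split => //; rewrite in_fsetI b1B in_translate.
  have -> : b1 - b = (a1 + b1 - (a + b)) - (a1 - a) by zmod.
  by apply: subgrpB => //; apply: cX.
- rewrite (periodic_closureE sF (@stab_periodic _ _)) eX eY.
  by rewrite (periodic_closureE sF pV) (periodic_closureE sF pW); clia.
Qed.

(** What does not follow [a] is stable under subtraction of [r], hence under [F],
    so that it would fill the coset if it were not empty. *)
Lemma cyclic_ap A F r a : subgrp F -> same_coset F A -> (#|` A| < #|` F|)%N -> a \in A ->
  (forall P, subgrp P -> r \in P -> {subset F <= P}) ->
  (forall x, x \in A -> x != a -> x - r \in A) -> ap r A.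
Proof.
move=> sF cA lt aA hF hA; have nper x D : x \in D -> (#|` D| < #|` F|)%N -> ~ (forall y, y \in D -> y - r \in D).
  move=> xD ltD st; have D0 := mem_neq0 xD; have sD := stab_subgrp D0.
  have rD : r \in stab D by rewrite -(subgrpNE _ sD); apply/stabP => // y /st.
  have := periodic_card_ge (periodic_sub (hF _ sD rD) (@stab_periodic _ D)) xD.
  by rewrite leqNgt ltD.
have ar : a - r \notin A.
  apply/negP => h; apply: (nper a A) => // x xA.
  by have [->|] := eqVneq x a; [|apply: hA].
have [S0 [aS0 S0A eS0 st]] := path_split aA ar hA.
have D0 : A `\` S0 = fset0.
  have [//|[x xD]] := fset_0Vmem (A `\` S0); case: (nper x (A `\` S0)) => //.
  by apply: leq_ltn_trans lt; apply/fsubset_leq_card/fsubsetDl.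
have e : A = S0 by apply/eqP; rewrite eqEfsubset -fsetD_eq0 D0 eqxx; apply/fsubsetP.
by exists a; split; [rewrite {1}e e|apply: mem_neq0 aA].
Qed.

(** Here [B] is [a + b] minus the complement of [A], together with [b].  If a
    second sum [a' + b'] has a unique representation, let [H] be the group
    generated by the difference [r] of the two sums.  Then [A] is [H]-periodic
    outside the coset of [a], as the only element without predecessor, [a'],
    lies in that coset. *)
Lemma full_coset A B a b F : subgrp F -> same_coset F A -> same_coset F B ->
  uniq_rep A B a b -> (#|` A| + #|` B| = #|` F| + 1)%N -> (1 < #|` A|)%N -> (1 < #|` B|)%N ->
  (#|` A :+: B| + 1 <= #|` A| + #|` B|)%N -> elementary A B \/ splits A B.
Proof.
move=> sF cA cB hab hcF A1 B1 hc; have [aA bB hu] := hab.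
have A0 := mem_neq0 aA; have B0 := mem_neq0 bB.
have kc : (#|` A| + #|` B| <= #|` A :+: B| + 1)%N by apply: critical_geq => //; right; exists a, b.
have eAB : A :+: B = translate (a + b) F.
  apply: eq_fsub_card; last by rewrite card_translate; clia.
  by apply: same_coset_in; [apply: same_coset_sumset|apply: mem_sumset].
(* The sets [A] and [a + b - B] meet in [a] only and together fill the coset. *)
have cover x : x - a \in F -> (x \in A) || (a + b - x \in B).
  set Y := translate (a + b) (oppset B).
  have YE z : (z \in Y) = (a + b - z \in B) by rewrite in_translate in_oppset opprB.
  have sub : {subset A `|` Y <= translate a F}.
    move=> z; rewrite in_fsetU YE in_translate => /orP[zA|zB]; first exact: cA.
    have -> : z - a = - (a + b - z - b) by zmod.
    by apply: subgrpN => //; apply: cB.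
  have eI : A `&` Y = [fset a].
    apply/fsetP => z; rewrite in_fsetI YE in_fset1; apply/andP/eqP => [[zA zB]|->].
      by have [|-> //] := hu _ _ zA zB; rewrite addrC subrK.
    by rewrite aA addrC addKr.
  have eU : A `|` Y = translate a F.
    apply: eq_fsub_card => //; rewrite card_translate.
    have := cardfsUI A Y; rewrite eI cardfs1 card_translate card_oppset; clia.
  by rewrite -in_translate -eU in_fsetU YE.
have both x : x \in A -> a + b - x \in B -> x = a.
  by move=> xA xB; have [|-> //] := hu _ _ xA xB; rewrite addrC subrK.
(* If no other sum has a unique representation, then the pair is of type III. *)
have [honly|hn] := classic (forall a' b', uniq_rep A B a' b' -> a' + b' = a + b).
  left; apply: Or43; have [Z ZE] := subgrp_zmodClosed sF.
  set H1 := [fset x in translate (- a) A | x != 0].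
  set H2 := [fset x in oppset (translate (- b) B) | x != 0].
  have H1E x : (x \in H1) = (a + x \in A) && (x != 0).
    by rewrite !inE /= in_translate opprK addrC.
  have H2E x : (x \in H2) = (b - x \in B) && (x != 0).
    by rewrite !inE /= in_oppset in_translate opprK addrC.
  exists a, b, Z, H1, H2; split.
  - split.
    + have [x xA] : exists x, x \in A `\ a.
        by apply/fset0Pn; rewrite -cardfs_gt0; move: A1; rewrite (cardfsD1 a) aA; clia.
      move: xA; rewrite in_fsetD1 => /andP[xa xA]; apply: (@mem_neq0 _ _ (x - a)).
      by rewrite H1E addrC subrK xA subr_eq0.
    + have [x xB] : exists x, x \in B `\ b.
        by apply/fset0Pn; rewrite -cardfs_gt0; move: B1; rewrite (cardfsD1 b) bB; clia.
      move: xB; rewrite in_fsetD1 => /andP[xb xB]; apply: (@mem_neq0 _ _ (b - x)).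
      by rewrite H2E subKr xB subr_eq0 eq_sym.
    + rewrite -fsetI_eq0; apply/eqP/fsetP => x; rewrite in_fsetI H1E H2E in_fset0.
      apply/negP => /andP[/andP[h1 x0] /andP[h2 _]]; case/eqP: x0.
      have : a + x = a by apply: both => //; rewrite (_ : _ - _ = b - x) //; zmod.
      by move=> e; rewrite -[x](addKr a) e addNr.
    + by rewrite H1E eqxx andbF.
    + by rewrite H2E eqxx andbF.
  - move=> x; rewrite ZE !in_fsetU in_fset1 H1E H2E; have [->|x0] := eqVneq x 0.
      by rewrite (subgrp0 sF) !orbT.
    rewrite !andbT orbF; apply/idP/orP => [xF|[h|h]].
    + have haF : a + x - a \in F by rewrite addrC addKr.
      have /orP[h|] := cover _ haF; [by left|right].
      by have -> : b - x = a + b - (a + x) by zmod.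
    + by have := cA _ _ h aA; rewrite addrC addKr.
    + by have := cB _ _ bB h; rewrite subKr.
  - apply/fsetP => x; rewrite in_translate in_fsetU in_fset1 H1E.
    rewrite (_ : a + (x - a) = x); last by zmod.
    by rewrite subr_eq0; case: eqVneq => [->|_]; rewrite ?aA ?andbT ?orbF ?orbT.
  - apply/fsetP => x; rewrite in_translate in_oppset in_fsetU in_fset1 H2E.
    rewrite (_ : b - - (x - b) = x); last by zmod.
    rewrite oppr_eq0 subr_eq0.
    by case: eqVneq => [->|_]; rewrite ?bB ?andbT ?orbF ?orbT.
  - move=> c; split=> [[_ /nu_eq1P[a' [b' [h ->]]]]|->]; first exact: honly.
    by split; [apply: mem_sumset|apply/nu_eq1P; exists a, b].
have [a' [b' [hab' ne]]] : exists a' b', uniq_rep A B a' b' /\ a' + b' <> a + b.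
  apply: NNPP => hn'; apply: hn => a' b' h; apply: NNPP => ne.
  by apply: hn'; exists a', b'.
have [a'A b'B hu'] := hab'; set r := a' + b' - (a + b).
have r0 : r != 0 by rewrite subr_eq0; apply/eqP.
have rF : r \in F.
  by apply: (same_coset_sumset sF cA cB); apply: mem_sumset.
(* The same complementarity for the second sum [a + b + r]. *)
have stepA x : x \in A -> x != a' -> x - r \in A.
  move=> xA xa'; have [|//|xB] := orP (cover (x - r) _).
    have -> : x - r - a = (x - a) - r by zmod.
    by apply: subgrpB => //; apply: cA.
  case/eqP: xa'; have e : a + b - (x - r) = a' + b' - x by rewrite /r; zmod.
  by rewrite e in xB; have [|-> //] := hu' _ _ xA xB; rewrite addrC subrK.
have stepB y : y \in B -> y != b' -> y - r \in B.
  move=> yB yb'; have [|xA|] := orP (cover (a + b - (y - r)) _).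
  - have -> : a + b - (y - r) - a = r - (y - b) by zmod.
    by apply: subgrpB => //; apply: cB.
  - case/eqP: yb'; have e : a + b - (y - r) = a' + b' - y by rewrite /r; zmod.
    by rewrite e in xA; have [|_ -> //] := hu' _ _ xA yB; rewrite subrK.
  - by rewrite subKr.
have [H [sH rH] Hmin] : exists2 H, subgrp H /\ r \in H &
    forall P, subgrp P /\ r \in P -> (#|` H| <= #|` P|)%N.
  by apply: (@ex_smallest _ (fun P : {fset G} => #|` P|)); exists F.
have Hsub P : subgrp P -> r \in P -> {subset H <= P}.
  move=> sP rP; have e : H `&` P = H.
    apply: eq_fsub_card => [x|]; first by rewrite in_fsetI => /andP[].
    by apply: Hmin; split; [apply: subgrpI|rewrite in_fsetI rH].
  by move=> x; rewrite -e in_fsetI => /andP[].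
have HF := Hsub _ sF rF; have H1 := nontriv_subgrp rH r0.
(* If [r] generates [F], then both sets are progressions with difference [r]. *)
have [leF|ltF] := leqP #|` F| #|` H|.
  left; apply: Or42; have eH := eq_fsub_card HF leF; rewrite eH in Hsub.
  have apA : ap r A by apply: (cyclic_ap sF cA _ a'A Hsub stepA); clia.
  have apB : ap r B by apply: (cyclic_ap sF cB _ b'B Hsub stepB); clia.
  exact: ap_elementary_II apA apB kc.
right; set C := translate a H; set D := A `\` C.
have pC : periodic H C by apply: periodic_coset.
have stD x : x \in D -> x - r \in D.
  rewrite !in_fsetD => /andP[xC xA].
  have xrC : x - r \notin C by rewrite (periodicE x sH pC (subgrpN sH rH)).
  rewrite xrC /=; have [e|xa'] := eqVneq x a'; last exact: stepA.
  apply/negPn/negP => xrA; case/negP: xC; rewrite {}e in xrA *.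
  (* If [a + r] is not in [A], then the path starting in [a'] contains [a]; in both
     cases [a'] lies in [C]. *)
  have [S0 [_ _ eS0 st]] := path_split a'A xrA stepA.
  have [arA|arA] := boolP (a + r \in A).
    have <- : a + r = a'.
      have [|-> //] := hu' _ b arA bB; rewrite /r; zmod.
    by rewrite in_translate addrC addKr.
  have aS0 : a \in S0.
    apply/negPn/negP => aN; case/negP: arA.
    have aD : a \in A `\` S0 by rewrite in_fsetD aN.
    have D0 := mem_neq0 aD; have sD := stab_subgrp D0.
    have rD : r \in stab (A `\` S0) by rewrite -(subgrpNE _ sD); apply/stabP => // y /st.
    by have := @stab_periodic _ _ _ _ aD rD; rewrite in_fsetD => /andP[].
  move: aS0; rewrite eS0 => /progP[i _ e].
  rewrite in_translate subgrpBC // {1}e addrC addKr.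
  exact: subgrpMn.
have pD : periodic H D.
  have [->|D0] := eqVneq D fset0; first by move=> x h; rewrite in_fset0.
  have sD := stab_subgrp D0; apply: (@periodic_sub _ _ (stab D)); last exact: stab_periodic.
  by apply: Hsub => //; rewrite -(subgrpNE _ sD); apply/stabP => // y /stD.
set E := translate b H; set W := B `\` E.
have pE : periodic H E by apply: periodic_coset.
have pW : periodic H W.
  move=> y h; rewrite !in_fsetD => /andP[yE yB] hH.
  rewrite (periodicE y sH pE hH) yE /=.
  have [|xA|] := orP (cover (a + b - (y + h)) _).
  - have -> : a + b - (y + h) - a = - (y - b) - h by zmod.
    by apply: subgrpB; [|apply: subgrpN => //; apply: cB|apply: HF].
  - have xD : a + b - (y + h) \in D.
      rewrite in_fsetD xA andbT; apply: contra yE; rewrite !in_translate => h1.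
      have -> : y - b = - (a + b - (y + h) - a) - h by zmod.
      by apply: subgrpB => //; apply: subgrpN.
    have := pD _ _ xD hH; rewrite (_ : a + b - (y + h) + h = a + b - y); last by zmod.
    rewrite in_fsetD => /andP[h1 h2]; case/negP: h1.
    have -> : a + b - y = a by apply: both => //; rewrite subKr.
    by rewrite in_translate subrr subgrp0.
  - by rewrite subKr.
have [aX cX eX] := coset_part sH aA; have [bY cY eY] := coset_part sH bB.
have := cardfsID C A; have := cardfsID E B.
rewrite -/C -/D in aX cX eX *; rewrite -/E -/W in bY cY eY *.
set X := A `&` C in aX cX *; set Y := B `&` E in bY cY *; move=> cBY cAX.
have eD : A `\` X = D by apply: setD_capD.
have eW : B `\` Y = W by apply: setD_capD.
have leXY : (#|` X| + #|` Y| <= #|` H| + 1)%N by apply: uniq_rep_card.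
(* With [leXY], the two incomplete parts contain exactly [|H| + 1] elements. *)
have geXY : (#|` H| + 1 <= #|` X| + #|` Y|)%N.
  set Y' := translate (a + b) (oppset Y).
  have Y'E z : (z \in Y') = (a + b - z \in Y) by rewrite in_translate in_oppset opprB.
  have -> : #|` Y| = #|` Y'| by rewrite card_translate card_oppset.
  rewrite -cardfsUI leq_add //.
    rewrite -(card_translate a H); apply: card_fsubset => z zC.
    move: (zC); rewrite in_translate => hz.
    rewrite in_fsetU Y'E !in_fsetI zC andbT; have := cover z (HF _ hz).
    case/orP => [-> //|->]; rewrite in_translate.
    by rewrite (_ : _ - b = - (z - a)) ?subgrpN ?orbT //; zmod.
  by apply: (@neq0_card _ _ a); rewrite in_fsetI aX Y'E addrC addKr.
exists X, Y, H; split.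
- split => //; rewrite eD eW; apply/orP; rewrite -negb_and; apply/negP => /andP[/eqP D0 /eqP W0].
  by move: cAX cBY; rewrite D0 W0 cardfs0; clia.
- split; [exact: mem_neq0 aX|exact: mem_neq0 bY| |] => x; rewrite in_fsetI => /andP[] //.
- by rewrite eD eW.
- move=> a1 b1 a0 b0 a1A b1B a0X b0Y h.
  have {}h : a1 + b1 - (a + b) \in H.
    have -> : a1 + b1 - (a + b) = (a1 + b1 - (a0 + b0)) + ((a0 - a) + (b0 - b)) by zmod.
    by apply: subgrpD => //; apply: subgrpD => //; [apply: cX|apply: cY].
  have a1X : a1 \in X.
    rewrite in_fsetI a1A; apply/negPn/negP => a1N.
    have h1 : a + b - b1 \in D.
      rewrite (periodic_eq sH pD (y := a1)) ?in_fsetD ?a1N // subgrpBC //.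
      by have -> : a1 - (a + b - b1) = a1 + b1 - (a + b) by zmod.
    move: (h1); rewrite in_fsetD => /andP[h2 h3].
    have [|e _] := hu _ _ h3 b1B; first by rewrite subrK.
    by case/negP: h2; rewrite e in_translate subrr subgrp0.
  split => //; rewrite in_fsetI b1B in_translate.
  have -> : b1 - b = (a1 + b1 - (a + b)) - (a1 - a) by zmod.
  by apply: subgrpB => //; apply: cX.
- have pAB : periodic H (A :+: B).
    by rewrite eAB; apply: (periodic_sub HF); apply: periodic_coset.
  rewrite (periodic_closureE sH pAB) eX eY (periodic_closureE sH pD) (periodic_closureE sH pW).
  by rewrite eAB card_translate; clia.
Qed.

End Periodic.

(** * Critical pairs *)

Section Critical.
Variable G : zmodType.
Implicit Types (A B C S U V W X Y Z H K F P D : {fset G}) (a b c d g h r x y z : G).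

Definition critical A B : Prop :=
  (#|` A :+: B| + 1 <= #|` A| + #|` B|)%N /\
  (aperiodic (A :+: B) \/ exists a b, uniq_rep A B a b).

Lemma critical_card A B : A != fset0 -> B != fset0 -> critical A B ->
  (#|` A :+: B| + 1 = #|` A| + #|` B|)%N.
Proof. by move=> A0 B0 [h1 /(critical_geq A0 B0)]; clia. Qed.

Lemma criticalE A B : A != fset0 -> B != fset0 ->
  ((#|` A :+: B| <= #|` A| + #|` B| - 1)%N /\ (aperiodic (A :+: B) \/ mu A B = 1%N))
    <-> critical A B.
Proof.
move=> A0 B0; have := A0; have := B0; rewrite -!cardfs_gt0 => b0 a0.
have e := mu_eq1P A0 B0; split=> -[h1 h2]; (split; first by clia).
  by case: h2 => [|/e]; [left|right].
by case: h2 => [|/e]; [left|right].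
Qed.

Theorem critical_elementary_or_splits A B : A != fset0 -> B != fset0 ->
  critical A B -> elementary A B \/ splits A B.
Proof.
move=> A0 B0 [hc hu].
have [A1|A1] := leqP #|` A| 1.
  left; apply: Or41; rewrite /elementary_I.
  by move: A1 A0 B0; rewrite -!cardfs_gt0; clia.
have [B1|B1] := leqP #|` B| 1.
  left; apply: Or41; rewrite /elementary_I.
  by move: B1 A0 B0; rewrite -!cardfs_gt0; clia.
have [ap|nap] := classic (aperiodic (A :+: B)); first exact: aperiodic_critical.
case: hu => [//|[a [b hab]]].
have [h|[F [sF cA cB e]]] := uniq_rep_periodic hab nap hc; first by right.
exact: full_coset sF cA cB hab e A1 B1 hc.
Qed.

(** The sums that do not come from [A0 + B0] form a periodic set. *)
Lemma decomp_sumset A B A0 B0 H : decomp A B A0 B0 H ->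
  exists R, [/\ periodic H R, A :+: B = R `|` (A0 :+: B0),
                forall x, x \in R -> x \in A0 :+: B0 :+: H -> False &
                forall a b, a \in A -> b \in B -> ~~ ((a \in A0) && (b \in B0)) -> a + b \in R].
Proof.
case=> [[sH _ _] [_ _ sA sB] [pA pB cA cB] hu _].
pose R := ((A `\` A0) :+: B) `|` (A :+: (B `\` B0)).
have RE a b : a \in A -> b \in B -> ~~ ((a \in A0) && (b \in B0)) -> a + b \in R.
  move=> aA bB; rewrite negb_and in_fsetU => /orP[h|h]; apply/orP; [left|right].
    by rewrite mem_sumset // in_fsetD h.
  by rewrite mem_sumset // in_fsetD h.
exists R; split => //.
- by apply: periodicU; [apply: periodic_sumsetl|apply: periodic_sumsetr].
- apply/fsetP => x; rewrite in_fsetU; apply/idP/orP => [|[]].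
  + move=> /sumsetP[a [b [aA bB ->]]].
    by have [/andP[h1 h2]|h] := boolP ((a \in A0) && (b \in B0)); [right; apply: mem_sumset|left; apply: RE].
  + rewrite in_fsetU => /orP[] /sumsetP[a [b [h1 h2 ->]]]; apply: mem_sumset => //.
      by move: h1; rewrite in_fsetD => /andP[].
    by move: h2; rewrite in_fsetD => /andP[].
  + by move=> /sumsetP[a [b [/sA h1 /sB h2 ->]]]; apply: mem_sumset.
- move=> x hx /(closureP _ _ sH)[_ /sumsetP[a0 [b0 [h1 h2 ->]]] h].
  move: hx; rewrite in_fsetU => /orP[] /sumsetP[a [b [aA bB e]]]; rewrite e in h.
    move: aA; rewrite in_fsetD => /andP[aN aA].
    by have [aY _] := hu _ _ _ _ aA bB h1 h2 h; rewrite aY in aN.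
  move: bB; rewrite in_fsetD => /andP[bN bB].
  by have [_ bY] := hu _ _ _ _ aA bB h1 h2 h; rewrite bY in bN.
Qed.

Lemma decomp_closure A B A0 B0 H : decomp A B A0 B0 H ->
  [/\ #|` A :+: H| = (#|` A `\` A0| + #|` H|)%N, #|` B :+: H| = (#|` B `\` B0| + #|` H|)%N,
      #|` A| = (#|` A `\` A0| + #|` A0|)%N & #|` B| = (#|` B `\` B0| + #|` B0|)%N].
Proof.
case=> [[sH _ _] [A00 B00 sA sB] [pA pB cA cB] _ _].
have part X X0 : X0 != fset0 -> {subset X0 <= X} -> periodic H (X `\` X0) -> same_coset H X0 ->
   #|` X :+: H| = (#|` X `\` X0| + #|` H|)%N /\ #|` X| = (#|` X `\` X0| + #|` X0|)%N.
  move=> X00 sX pX cX; have [x0 x0X] := fset0Pn _ X00.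
  have eX : X = (X `\` X0) `|` X0.
    by apply/fsetP => x; rewrite in_fsetU in_fsetD; case: (boolP (x \in X0)) => [/sX ->|_]; rewrite ?orbF.
  split; last first.
    by rewrite {1}eX card_disjU // => x; rewrite in_fsetD => /andP[/negP].
  rewrite {1}eX sumsetUl (periodic_closureE sH pX) card_disjU.
    by rewrite (card_closure_coset sH cX x0X).
  move=> x xD /(closureP _ _ sH)[y yX hy].
  have : y \in X `\` X0 by rewrite -(periodic_eq sH pX hy).
  by rewrite in_fsetD yX.
have [e1 e2] := part A A0 A00 sA pA cA; have [e3 e4] := part B B0 B00 sB pB cB.
by split.
Qed.

Lemma decomp_card A B A0 B0 H : decomp A B A0 B0 H ->
  (#|` A :+: B| + (#|` A0| + #|` B0|) = #|` A| + #|` B| + #|` A0 :+: B0|)%N.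
Proof.
move=> hd; have [R [pR eAB dR _]] := decomp_sumset hd.
have [e1 e2 e3 e4] := decomp_closure hd.
case: hd => [[sH _ _] [A00 B00 sA sB] [pA pB cA cB] _ hc].
have [x xS] := fset0Pn _ (sumset_neq0 A00 B00).
have cS : same_coset H (A0 :+: B0) by apply: same_coset_sumset.
have cR : #|` A :+: B| = (#|` R| + #|` A0 :+: B0|)%N.
  by rewrite eAB card_disjU // => y yR /(mem_closure sH) /(dR _ yR).
have cRH : #|` A :+: B :+: H| = (#|` R| + #|` H|)%N.
  rewrite eAB sumsetUl (periodic_closureE sH pR) card_disjU //.
  by rewrite (card_closure_coset sH cS xS).
by rewrite cRH e1 e2 in hc; rewrite cR e3 e4; clia.
Qed.

(** The pair of the incomplete parts inherits criticality.  If a sum with a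
    unique representation comes from a full coset, then the incomplete part it
    is combined with is a single element. *)
Lemma decomp_critical A B A0 B0 H : decomp A B A0 B0 H -> critical A B -> critical A0 B0.
Proof.
move=> hd hc; have [R [pR eAB dR RE]] := decomp_sumset hd; have eC := decomp_card hd.
have [[sH H1 _] [A00 B00 sA sB] [pA pB cA cB] hu _] := hd.
have [a0 a0A] := fset0Pn _ A00; have [b0 b0B] := fset0Pn _ B00.
have An : A != fset0 := mem_neq0 (sA _ a0A); have Bn : B != fset0 := mem_neq0 (sB _ b0B).
have eAB' := critical_card An Bn hc.
split; first by clia.
case: hc => _ [ap|[a [b [aA bB hab]]]].
  left; have S0 := sumset_neq0 A00 B00; apply/aperiodicP => // d hds.
  have [x xS] := fset0Pn _ S0.
  have cS : same_coset H (A0 :+: B0) by apply: same_coset_sumset.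
  have dH : d \in H.
    have -> : d = x + d - x by zmod.
    by apply: cS => //; apply: hds.
  apply: (aperiodic0 ap (x := a0 + b0)); first by rewrite mem_sumset ?sA ?sB.
  move=> y; rewrite eAB !in_fsetU => /orP[yR|/hds ->]; last by rewrite orbT.
  by rewrite (pR _ _ yR dH).
right; have [d dH d0] := subgrp_nontriv sH H1.
have [a0A'|a0A'] := boolP (a \in A0); have [b0B'|b0B'] := boolP (b \in B0).
- exists a, b; split => // a' b' /sA h1 /sB h2; exact: hab.
- have bD : b \in B `\` B0 by rewrite in_fsetD b0B'.
  have single x : x \in A0 -> x = a.
    move=> xA; have := pB _ (- (x - a)) bD (subgrpN sH (cA _ _ xA a0A')).
    rewrite in_fsetD => /andP[_ h]; have [|-> //] := hab _ _ (sA _ xA) h; zmod.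
  exists a, b0; split => // a' b' /single -> b'B /addrI ->; by [].
- have aD : a \in A `\` A0 by rewrite in_fsetD a0A'.
  have single x : x \in B0 -> x = b.
    move=> xB; have := pA _ (- (x - b)) aD (subgrpN sH (cB _ _ xB b0B')).
    rewrite in_fsetD => /andP[_ h]; have [|_ -> //] := hab _ _ h (sB _ xB); zmod.
  exists a0, b; split => // a' b' a'A /single -> /addIr ->; by [].
- have aD : a \in A `\` A0 by rewrite in_fsetD a0A'.
  have bD : b \in B `\` B0 by rewrite in_fsetD b0B'.
  have := pA _ _ aD dH; have := pB _ _ bD (subgrpN sH dH).
  rewrite !in_fsetD => /andP[_ h1] /andP[_ h2].
  have [|e _] := hab _ _ h2 h1; first by zmod.
  by case/eqP: d0; rewrite -[d](addKr a) e addNr.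
Qed.

(** Conversely, criticality of the incomplete parts implies that of the pair:
    the sum of the incomplete parts is the only incomplete coset in [A + B], and
    hence is preserved by any period. *)
Lemma critical_decomp A B A0 B0 H : decomp A B A0 B0 H -> critical A0 B0 -> critical A B.
Proof.
move=> hd hc0; have [R [pR eAB dR RE]] := decomp_sumset hd; have eC := decomp_card hd.
have [[sH H1 _] [A00 B00 sA sB] [pA pB cA cB] hu _] := hd.
have e0 := critical_card A00 B00 hc0.
have [a0 a0A] := fset0Pn _ A00; have [b0 b0B] := fset0Pn _ B00.
split; first by clia.
case: hc0 => _ [ap|[a [b [aA bB hab]]]]; last first.
  right; exists a, b; split; [exact: sA|exact: sB|] => a' b' a'A b'B e.
  have [|h1 h2] := hu _ _ _ _ a'A b'B aA bB; first by rewrite e subrr subgrp0.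
  exact: hab.
left; have S0 := sumset_neq0 A00 B00.
have AB0 : A :+: B != fset0 by apply: sumset_neq0; [apply: (mem_neq0 (sA _ a0A))|apply: (mem_neq0 (sB _ b0B))].
apply/aperiodicP => // d hds.
have cS : same_coset H (A0 :+: B0) by apply: same_coset_sumset.
have e := stable_translate hds.
have nS : ~ periodic H (A0 :+: B0).
  move=> pS; have [h hH /eqP[]] := subgrp_nontriv sH H1; apply/eqP.
  rewrite -in_triv; have /(aperiodic_stab S0) <- := ap.
  exact: (sub_stab S0 pS).
have [x [h [xS hH xh]]] : exists x h, [/\ x \in A0 :+: B0, h \in H & x + h \notin A0 :+: B0].
  apply: NNPP => hn; apply: nS => x h xS hH; apply/negPn/negP => hN.
  by apply: hn; exists x, h.
have xhN : x + h \notin A :+: B.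
  rewrite eAB in_fsetU negb_or xh andbT; apply/negP => hR; apply: (dR _ hR).
  by apply/closureP => //; exists x; rewrite // addrC addKr.
have memAB y : (y + d \in A :+: B) = (y \in A :+: B).
  by rewrite -{1}e in_translate addrK.
have xdS y : y \in A :+: B -> y + h \notin A :+: B -> y \in A0 :+: B0.
  rewrite {1}eAB in_fsetU => /orP[yR|//]; rewrite eAB in_fsetU => /negP[].
  by rewrite pR.
have xAB : x \in A :+: B by rewrite eAB in_fsetU xS orbT.
have xdS' : x + d \in A0 :+: B0.
  by apply: xdS; rewrite ?memAB // addrAC memAB.
have dH : d \in H.
  have -> : d = x + d - x by zmod.
  exact: cS.
apply: (aperiodic0 ap xS) => y yS.
have yAB : y + d \in A :+: B by rewrite memAB eAB in_fsetU yS orbT.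
move: yAB; rewrite eAB in_fsetU => /orP[hR|//]; case: (dR _ hR).
by apply/closureP => //; exists y; rewrite // addrC addKr.
Qed.

(** ** Elementary pairs *)

Lemma arith_prog_ap r S : arith_prog r S -> ap r S.
Proof.
move=> [g [k [k0 ho eS]]]; have e : S = prog (g + r) r k.
  rewrite eS; apply/fsetP => x; apply/imfsetP/progP => /= -[i hi ->].
    move: hi; rewrite mem_iota add1n => /andP[i1 i2]; exists i.-1; first by move: i1 i2; clia.
    by rewrite -[in LHS](prednK i1) natmulS; zmod.
  by exists i.+1; rewrite ?mem_iota //= natmulS; zmod.
have cS : #|` S| = k.
  rewrite e; apply: card_prog => i j ij jk; apply/negP => /eqP h.
  have : (0 < j - i)%N by rewrite subn_gt0.
  by move=> /ho /(_ h); move: jk; clia.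
exists (g + r); split; first by rewrite cS.
by rewrite -cardfs_gt0 cS.
Qed.

Lemma elementary_critical A B : A != fset0 -> B != fset0 -> elementary A B -> critical A B.
Proof.
move=> A0 B0; have := A0; have := B0; rewrite -!cardfs_gt0 => b0 a0.
have [a aA] := fset0Pn _ A0; have [b bB] := fset0Pn _ B0.
case=> [h|[d [hA hB ho]]|[g1 [g2 [Z [H1 [H2 [[h1 h2 h3 h4 h5] eH eA eB hc]]]]]]|].
- have [cA|cB] : #|` A| = 1%N \/ #|` B| = 1%N by move: h; rewrite /elementary_I; clia.
    have /eqP/cardfs1P[x eA] := cA; rewrite eA -/(translate x B).
    split; first by rewrite card_translate cardfs1; clia.
    right; exists x, b; split; rewrite ?in_fset1 // => a' b'; rewrite in_fset1 => /eqP -> _.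
    by move/addrI ->.
  have /eqP/cardfs1P[x eB] := cB; rewrite eB.
  split; first by rewrite sumsetC -/(translate x A) card_translate cardfs1; clia.
  right; exists a, x; split; rewrite ?in_fset1 // => a' b' _; rewrite in_fset1 => /eqP ->.
  by move/addIr ->.
- have [z [eA _]] := arith_prog_ap hA; have [w [eB _]] := arith_prog_ap hB.
  have zA : z \in A by rewrite eA; apply/progP; exists 0%N; rewrite ?mulr0n ?addr0.
  have wB : w \in B by rewrite eB; apply/progP; exists 0%N; rewrite ?mulr0n ?addr0.
  split.
    have : (#|` A :+: B| <= #|` A| + #|` B| - 1)%N.
      apply: leq_trans (leq_card_prog (z + w) d _); apply: card_fsubset => x.
      move=> /sumsetP[x1 [x2 [+ + ->]]]; rewrite {1}eA {1}eB.
      move=> /progP[i hi ->] /progP[j hj ->]; apply/progP; exists (i + j)%N.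
        by move: hi hj; clia.
      by rewrite natmulD; zmod.
    by clia.
  right; exists z, w; split => // x1 x2; rewrite {1}eA {1}eB.
  move=> /progP[i hi ->] /progP[j hj ->] e.
  have e' : d *+ (i + j) = 0.
    rewrite natmulD; have -> : d *+ i + d *+ j = (z + d *+ i + (w + d *+ j)) - (z + w) by zmod.
    by rewrite e subrr.
  have ij : (i + j = 0)%N.
    case: (posnP (i + j)) => [//|/ho /(_ e')]; move: hi hj; clia.
  have [-> ->] : i = 0%N /\ j = 0%N by clia.
  by rewrite !mulr0n !addr0.
- have [_ /nu_eq1P[x [y [hxy _]]]] := (hc (g1 + g2)).2 (erefl _).
  split; last by right; exists x, y.
  set F := H1 `|` H2 `|` [fset 0] in eH; have sF : subgrp F := zmodClosed_subgrp eH.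
  have cF : #|` F| = (#|` H1| + #|` H2| + 1)%N.
    rewrite card_disjU ?cardfs1 => [|t]; last first.
      by rewrite in_fset1 in_fsetU => /orP[t1|t1] /eqP e; [rewrite -e t1 in h4|rewrite -e t1 in h5].
    by rewrite card_disjU // => t t1 t2; move/fdisjointP: h3 => /(_ t t1); rewrite t2.
  have cA : #|` A| = (#|` H1| + 1)%N.
    rewrite eA card_translate card_disjU ?cardfs1 // => t t1; rewrite in_fset1 => /eqP e.
    by rewrite -e t1 in h4.
  have cB : #|` B| = (#|` H2| + 1)%N.
    rewrite eB card_translate card_oppset card_disjU ?cardfs1 // => t t1; rewrite in_fset1 => /eqP e.
    by rewrite -e t1 in h5.
  have : (#|` A :+: B| <= #|` F|)%N.
    rewrite -(card_translate (g1 + g2) F); apply: card_fsubset => _ /sumsetP[p [q [+ + ->]]].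
    rewrite eA eB !in_translate in_oppset => hp hq.
    have -> : p + q - (g1 + g2) = (p - g1) - (- (q - g2)) by zmod.
    apply: subgrpB => //; rewrite /F !in_fsetU.
      by move: hp; rewrite in_fsetU => /orP[->|->]; rewrite ?orbT.
    by move: hq; rewrite in_fsetU => /orP[->|->]; rewrite ?orbT.
  by clia.
- move=> [g1 [g2 [Z [H1 [H2 [[h1 h2 h3 h4 h5] eH eA eB hmu]]]]]].
  set F := H1 `|` H2 in eH; have sF : subgrp F := zmodClosed_subgrp eH.
  have cF : #|` F| = (#|` H1| + #|` H2|)%N.
    by rewrite card_disjU // => t t1 t2; move/fdisjointP: h5 => /(_ t t1); rewrite t2.
  have H1F t : t \in H1 -> t \in F by move=> ht; rewrite in_fsetU ht.
  have H2F t : t \in H2 -> t \in F by move=> ht; rewrite in_fsetU ht orbT.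
  have AE t : (g1 + t \in A) = (t \in H1) by rewrite eA in_translate addrC addKr.
  have BE t : (g2 - t \in B) = (t \in H2) by rewrite eB in_translate in_oppset (_ : - _ = t) //; zmod.
  have eS : A :+: B = translate (g1 + g2) (F `\ 0).
    apply/fsetP => x; rewrite in_translate in_fsetD1; apply/idP/andP.
      move=> /sumsetP[p [q [pA qB ->]]].
      have hp : p - g1 \in H1 by rewrite -AE (_ : _ + _ = p) //; zmod.
      have hq : g2 - q \in H2 by rewrite -BE subKr.
      have -> : p + q - (g1 + g2) = (p - g1) - (g2 - q) by zmod.
      split; last by apply: (subgrpB sF); [apply: H1F|apply: H2F].
      rewrite subr_eq0; apply/negP => /eqP e; move/fdisjointP: h5 => /(_ _ hp).
      by rewrite e hq.
    set t := x - (g1 + g2) => -[t0 tF]; apply/negPn/negP => hN.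
    have st s : s \in H2 -> s + t \in H2.
      move=> sH; have : s + t \in F by apply: subgrpD => //; apply: H2F.
      rewrite in_fsetU => /orP[h|//]; case/negP: hN.
      have -> : x = (g1 + (s + t)) + (g2 - s) by rewrite /t; zmod.
      by rewrite mem_sumset ?AE ?BE.
    by case/eqP: t0; move: h4 => /(aperiodicP h2); apply.
  have F0 : (0 : G) \in F by apply: subgrp0.
  have cS : (#|` A :+: B| + 1 = #|` F|)%N.
    by rewrite eS card_translate [in RHS](cardfsD1 0 F) F0 addnC.
  split.
    by rewrite cS cF eA eB !card_translate card_oppset.
  left; apply/aperiodicP => [|t ht]; first exact: sumset_neq0.
  have tF : t \in F.
    have -> : t = (a + b + t - (g1 + g2)) - (a + b - (g1 + g2)) by zmod.
    have hF y : y \in A :+: B -> y - (g1 + g2) \in F.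
      by rewrite eS in_translate in_fsetD1 => /andP[].
    by apply: subgrpB => //; apply: hF; [apply: ht|]; apply: mem_sumset.
  (* The period would move the missing element [g1 + g2]. *)
  apply/eqP/negPn/negP => t0; have := ht (g1 + g2 - t).
  rewrite subrK eS !in_translate !in_fsetD1 subrr eqxx /=.
  have -> : g1 + g2 - t - (g1 + g2) = - t by zmod.
  by rewrite oppr_eq0 t0 subgrpNE // tF => /(_ isT).
Qed.

(** In a pair of type II, moving one step along one progression and one step back
    along the other leaves the sum unchanged; so the two representations could
    not both be unique if [A] had a second element. *)
Lemma elementary_II_two_uniq A B a b b' : elementary_II A B ->
  uniq_rep A B a b -> uniq_rep A B a b' -> b != b' -> #|` A| = 1%N.
Proof.
move=> [d [hA hB ho]]; have [z [eA A0]] := arith_prog_ap hA; have [w [eB B0]] := arith_prog_ap hB.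
have k0 : (0 < #|` A|)%N by rewrite cardfs_gt0.
have l0 : (0 < #|` B|)%N by rewrite cardfs_gt0.
have pA x : x \in A -> exists2 i, (i < #|` A|)%N & x = z + d *+ i by rewrite {1}eA => /progP.
have pB x : x \in B -> exists2 i, (i < #|` B|)%N & x = w + d *+ i by rewrite {1}eB => /progP.
suff wl b1 b2 i j1 j2 : (i < #|` A|)%N -> (j2 < #|` B|)%N -> (j1 < j2)%N -> a = z + d *+ i ->
    b1 = w + d *+ j1 -> b2 = w + d *+ j2 -> uniq_rep A B a b1 -> uniq_rep A B a b2 -> #|` A| = 1%N.
  move=> h1 h2; have [/pA[i hi ei] /pB[j hj ej] _] := h1; have [_ /pB[j' hj' ej'] _] := h2.
  move=> nb.
  have [lt|lt|e] := ltngtP j j'.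
  - exact: (wl b b' i j j').
  - exact: (wl b' b i j' j).
  - by case/eqP: nb; rewrite ej ej' e.
move=> hi hj2 lt ea e1 e2 [aA b1B u1] [_ b2B u2].
have d0 : d = 0 -> #|` A| = 1%N.
  by move=> d0; have := ho 1%N isT; rewrite mulr1n => /(_ d0); clia.
have [lti|gei] := ltnP i.+1 #|` A|.
  apply: d0; have e2' : b2 = w + d *+ j2.-1 + d by rewrite e2 -{1}(ltn_predK lt) natmulS; zmod.
  have [] := u2 (a + d) (b2 - d).
  - by rewrite eA; apply/progP; exists i.+1; rewrite // natmulS ea; zmod.
  - rewrite eB; apply/progP; exists j2.-1; first by move: lt hj2; clia.
    by rewrite e2'; zmod.
  - by zmod.
  - by move=> e _; rewrite -[d](addKr a) e addNr.
case: (posnP i) => [i0|i0]; first by move: gei; rewrite i0; clia.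
apply: d0; have ea' : a = z + d *+ i.-1 + d by rewrite ea -{1}(prednK i0) natmulS; zmod.
have [] := u1 (a - d) (b1 + d).
- rewrite eA; apply/progP; exists i.-1; first by move: i0 hi; clia.
  by rewrite ea'; zmod.
- rewrite eB; apply/progP; exists j1.+1; first by move: lt hj2; clia.
  by rewrite natmulS e1; zmod.
- by zmod.
- by move=> _ e; rewrite -[d](addKr b1) e addNr.
Qed.

(** In types III and IV at most one sum has a unique representation. *)
Lemma elementary_two_uniq A B a b b' : elementary A B ->
  uniq_rep A B a b -> uniq_rep A B a b' -> b != b' -> #|` A| = 1%N.
Proof.
move=> he h1 h2 nb; have [aA bB _] := h1; have [_ b'B _] := h2.
have A0 := mem_neq0 aA; have B0 := mem_neq0 bB.
have B2 : (1 < #|` B|)%N.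
  rewrite ltnNge; apply/negP => B1; case/eqP: nb.
  have /eqP/cardfs1P[t e] : #|` B| = 1%N by move: B0 B1; rewrite -cardfs_gt0; clia.
  by move: bB b'B; rewrite e !in_fset1 => /eqP -> /eqP ->.
case: he => [h|h|[g1 [g2 [Z [H1 [H2 [_ _ _ _ hc]]]]]]|[g1 [g2 [Z [H1 [H2 [_ _ _ _ hm]]]]]]].
- by move: h; rewrite /elementary_I; move: B2; clia.
- exact: elementary_II_two_uniq h h1 h2 nb.
- case/eqP: nb; have u y : uniq_rep A B a y -> a + y = g1 + g2.
    move=> hy; apply/hc; split; first by case: hy => ? ? _; apply: mem_sumset.
    by apply/nu_eq1P; exists a, y.
  by apply: (@addrI _ a); rewrite (u _ h1) (u _ h2).
- by have := (mu_gt1P A0 B0).1 hm; case; exists a, b.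
Qed.

Lemma elementary_two_uniq_r A B a a' b : elementary A B ->
  uniq_rep A B a b -> uniq_rep A B a' b -> a != a' -> #|` B| = 1%N.
Proof.
move=> he h1 h2 na; have [aA bB _] := h1; have [a'A _ _] := h2.
have A0 := mem_neq0 aA; have B0 := mem_neq0 bB.
have A2 : (1 < #|` A|)%N.
  rewrite ltnNge; apply/negP => A1; case/eqP: na.
  have /eqP/cardfs1P[t e] : #|` A| = 1%N by move: A0 A1; rewrite -cardfs_gt0; clia.
  by move: aA a'A; rewrite e !in_fset1 => /eqP -> /eqP ->.
case: he => [h|h|[g1 [g2 [Z [H1 [H2 [_ _ _ _ hc]]]]]]|[g1 [g2 [Z [H1 [H2 [_ _ _ _ hm]]]]]]].
- by move: h; rewrite /elementary_I; move: A2; clia.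
- exact: elementary_II_two_uniq (elementary_IIC h) (uniq_repC h1) (uniq_repC h2) na.
- case/eqP: na; have u y : uniq_rep A B y b -> y + b = g1 + g2.
    move=> hy; apply/hc; split; first by case: hy => ? ? _; apply: mem_sumset.
    by apply/nu_eq1P; exists y, b.
  by apply: (@addIr _ b); rewrite (u _ h1) (u _ h2).
- by have := (mu_gt1P A0 B0).1 hm; case; exists a, b.
Qed.

End Critical.

(** * Quotients *)

Section Quotients.
Variables (G : zmodType) (Z : zmodClosed G) (H : {fset G}).
Hypothesis eZ : Z =i H.
Implicit Types (A B C S U V : {fset G}) (a b x y : G).

Local Notation p := (\pi_{quot Z}%qT).
Local Notation qi := (quot_image Z).

Lemma quot_subgrp : subgrp H.
Proof. exact: zmodClosed_subgrp eZ. Qed.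

Let sH := quot_subgrp.

Lemma pi_eq x y : (p x == p y) = (x - y \in H).
Proof. by rewrite -eZ Quotient.idealrBE. Qed.

Lemma pi_add x y : p (x + y) = p x + p y.
Proof. by rewrite raddfD. Qed.

Lemma pi_sub x y : p (x - y) = p x - p y.
Proof. by rewrite raddfB. Qed.

Lemma pi_repr (q : {quot Z}) : exists x, q = p x.
Proof. by exists (repr q); rewrite reprK. Qed.

Lemma quot_imageP S (q : {quot Z}) : reflect (exists2 x, x \in S & q = p x) (q \in qi S).
Proof. exact: (iffP (imfsetP _ _ _ _)). Qed.

Lemma mem_quot_image S x : x \in S -> p x \in qi S.
Proof. by move=> xS; apply/quot_imageP; exists x. Qed.

Lemma pi_in_quot_image S x : (p x \in qi S) = (x \in S :+: H).
Proof.
apply/quot_imageP/(closureP _ _ sH) => -[y yS e]; exists y => //.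
  by rewrite -pi_eq e.
by apply/eqP; rewrite pi_eq.
Qed.

Lemma quot_image_neq0 S : S != fset0 -> qi S != fset0.
Proof. by move=> /fset0Pn[x xS]; apply: (mem_neq0 (mem_quot_image xS)). Qed.

Lemma quot_image_sumset A B : qi (A :+: B) = qi A :+: qi B.
Proof.
apply/fsetP => q; apply/quot_imageP/sumsetP => [[_ /sumsetP[a [b [aA bB ->]]] ->]|].
  by exists (p a), (p b); rewrite !mem_quot_image // pi_add.
move=> [_ [_ [/quot_imageP[a aA ->] /quot_imageP[b bB ->] ->]]].
by exists (a + b); rewrite ?pi_add ?mem_sumset.
Qed.

Lemma card_quot_image S : (#|` S :+: H| = #|` qi S| * #|` H|)%N.
Proof.
move: {2}_.+1 (ltnSn #|` S|) => n; elim: n S => // n IH S Sn.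
have [->|/fset0Pn[x xS]] := eqVneq S fset0.
  have -> : qi fset0 = fset0 by apply/fsetP => q; apply/quot_imageP; case=> y; rewrite in_fset0.
  have -> : fset0 :+: H = fset0 by apply/fsetP => y; rewrite in_fset0; apply/sumsetP => -[u [v [+ _ _]]]; rewrite in_fset0.
  by rewrite !cardfs0.
have [h1 h2 ->] := coset_part sH xS; set S1 := S `\` translate x H.
have lt : (#|` S1| < n)%N.
  have := cardfsID (translate x H) S; have := neq0_card h1.
  by rewrite -/S1; move: Sn; clia.
have -> : qi S = qi S1 `|` [fset p x].
  apply/fsetP => q; rewrite in_fsetU in_fset1; apply/quot_imageP/orP => [[y yS ->]|[/quot_imageP[y]|/eqP ->]].
  - have [hy|hy] := boolP (y - x \in H); first by right; rewrite pi_eq.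
    by left; rewrite mem_quot_image // in_fsetD in_translate hy.
  - by rewrite in_fsetD => /andP[_ yS] ->; exists y.
  - by exists x.
rewrite card_disjU ?cardfs1 ?IH ?mulnDl ?mul1n // => q; rewrite in_fset1 => /quot_imageP[y + ->].
by rewrite in_fsetD in_translate pi_eq => /andP[/negP].
Qed.

Lemma in_cosetE S : in_coset Z S <-> same_coset H S.
Proof.
split=> [[q hq] x y xS yS|hS]; first by rewrite -pi_eq !hq.
have [->|/fset0Pn[x xS]] := eqVneq S fset0; first by exists 0.
by exists (p x) => y yS; apply/eqP; rewrite pi_eq hS.
Qed.

Lemma union_of_cosetsE S : union_of_cosets Z S <-> periodic H S.
Proof.
split=> [[C hC] x d xS dH|pS].
  have e : p (x + d) = p x by apply/eqP; rewrite pi_eq addrAC subrr add0r.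
  by rewrite hC e -hC.
exists (fun q : {quot Z} => q \in qi S) => x.
by rewrite unfold_in pi_in_quot_image (periodic_closureE sH pS).
Qed.

Lemma quot_image_coset S x : same_coset H S -> x \in S -> qi S = [fset p x].
Proof.
move=> cS xS; apply/fsetP => q; rewrite in_fset1; apply/quot_imageP/eqP => [[y yS ->]|->].
  by apply/eqP; rewrite pi_eq cS.
by exists x.
Qed.

(** A decomposition along [H] says that the images of [A] and [B] satisfy
    equality in the bound for critical pairs, and that the incomplete cosets meet
    in a sum with a unique representation. *)
Lemma decomp_quot A B A0 B0 a b : decomp A B A0 B0 H -> a \in A0 -> b \in B0 ->
  uniq_rep (qi A) (qi B) (p a) (p b) /\
  (#|` qi A :+: qi B| + 1 = #|` qi A| + #|` qi B|)%N.
Proof.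
case=> [_ [_ _ sA sB] [_ _ cA cB] hu hc] aA bB; split.
  split; rewrite ?mem_quot_image ?sA ?sB // => _ _ /quot_imageP[x xA ->] /quot_imageP[y yB ->] e.
  have [|hx hy] := hu x y a b xA yB aA bB; first by rewrite -pi_eq !pi_add e.
  by split; apply/eqP; rewrite pi_eq; [apply: cA|apply: cB].
move: hc; rewrite !card_quot_image quot_image_sumset -mulnDl -{2}[#|` H|]mul1n -mulnDl.
by move/eqP; rewrite eqn_pmul2r ?(subgrp_card_gt0 sH) // => /eqP.
Qed.

Lemma decompI A B A0 B0 a b : H != triv -> A `\` A0 != fset0 \/ B `\` B0 != fset0 ->
  {subset A0 <= A} -> {subset B0 <= B} -> periodic H (A `\` A0) -> periodic H (B `\` B0) ->
  same_coset H A0 -> same_coset H B0 -> a \in A0 -> b \in B0 ->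
  uniq_rep (qi A) (qi B) (p a) (p b) ->
  (#|` qi A :+: qi B| + 1 = #|` qi A| + #|` qi B|)%N -> decomp A B A0 B0 H.
Proof.
move=> H1 hn sA sB pA pB cA cB aA bB [_ _ hu] hc.
have inX X X0 x y : periodic H (X `\` X0) -> x \in X -> y \in X0 -> p x = p y -> x \in X0.
  move=> pX xX yX /eqP; rewrite pi_eq => h; apply/negPn/negP => xN.
  have : y \in X `\` X0 by rewrite -(periodic_eq sH pX h) in_fsetD xN.
  by rewrite in_fsetD yX.
split => //; first by split; rewrite ?(mem_neq0 aA) ?(mem_neq0 bB).
  move=> x y a' b' xA yB a'A b'B; rewrite -pi_eq !pi_add => /eqP e.
  have ea : p a' = p a by apply/eqP; rewrite pi_eq cA.
  have eb : p b' = p b by apply/eqP; rewrite pi_eq cB.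
  have [|||ex ey] := hu (p x) (p y); rewrite ?mem_quot_image ?e ?ea ?eb //.
  by split; [apply: (inX A _ x a)|apply: (inX B _ y b)].
by rewrite !card_quot_image quot_image_sumset -{2}[#|` H|]mul1n -!mulnDl hc.
Qed.

(** The preimage of [Q] under the projection, in a form that shows that it is
    finite. *)
Definition lift (Q : {fset {quot Z}}) : {fset G} := [fset repr q | q in Q] :+: H.

Lemma in_lift Q x : (x \in lift Q) = (p x \in Q).
Proof.
apply/(closureP _ _ sH)/idP => [[_ /imfsetP[q /= qQ ->]]|pQ].
  by rewrite -pi_eq reprK => /eqP ->.
by exists (repr (p x)); [apply/imfsetP; exists (p x)|rewrite -pi_eq reprK].
Qed.

Lemma card_lift Q : (#|` lift Q| = #|` Q| * #|` H|)%N.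
Proof.
have pL : periodic H (lift Q).
  by move=> x d; rewrite !in_lift pi_add => xQ dH; rewrite (_ : p d = 0) ?addr0 //; apply/eqP; rewrite -(raddf0 p) pi_eq subr0.
rewrite -[in LHS](periodic_closureE sH pL) card_quot_image; congr (#|` _| * _)%N.
apply/fsetP => q; have [x ->] := pi_repr q.
by rewrite pi_in_quot_image (periodic_closureE sH pL) in_lift.
Qed.

Lemma sumset_lift S Q : S :+: lift Q = lift (qi S :+: Q).
Proof.
apply/fsetP => x; rewrite in_lift; apply/sumsetP/sumsetP => [[s [t [sS + ->]]]|].
  by rewrite in_lift => tQ; exists (p s), (p t); rewrite mem_quot_image ?pi_add.
move=> [_ [q [/quot_imageP[s sS ->] qQ e]]]; exists s, (x - s); rewrite sS in_lift pi_sub e.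
by rewrite addrC addKr subrKC; split.
Qed.

Lemma lift_subgrp Q : subgrp Q -> subgrp (lift Q).
Proof.
move=> sQ; split=> [|x y]; rewrite !in_lift ?pi_sub; last exact: (subgrpB sQ).
by rewrite raddf0 subgrp0.
Qed.

(** If the incomplete cosets of [A] and [B] modulo [H] lie in the incomplete
    parts of a decomposition of the images, then that decomposition lifts. *)
Lemma decomp_lift A B A0 B0 X0 Y0 (Q : {fset {quot Z}}) a b :
  decomp A B A0 B0 H -> decomp (qi A) (qi B) X0 Y0 Q ->
  a \in A0 -> b \in B0 -> p a \in X0 -> p b \in Y0 ->
  decomp A B (A `&` lift X0) (B `&` lift Y0) (lift Q).
Proof.
move=> [[_ H1 _] [_ _ sA sB] [pA pB cA cB] _ _].
move=> [[sQ Q1 hn] [_ _ sX sY] [pX pY cX cY] hu hc] aA bB aX bY.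
have sL := lift_subgrp sQ.
have D S S0 (X : {fset {quot Z}}) x : (x \in S `\` (S `&` lift X)) = (x \in S) && (p x \notin X).
  by rewrite setD_capD in_fsetD in_lift andbC.
have per S S0 (X : {fset {quot Z}}) s : {subset S0 <= S} -> periodic H (S `\` S0) -> same_coset H S0 ->
    periodic Q (qi S `\` X) -> s \in S0 -> p s \in X -> periodic (lift Q) (S `\` (S `&` lift X)).
  move=> sS pS cS pQ sS0 sX' x d; rewrite !D // in_lift => /andP[xS xN] dQ.
  have : p x + p d \in qi S `\` X by apply: pQ; rewrite // in_fsetD xN mem_quot_image.
  rewrite -pi_add in_fsetD => /andP[hN]; rewrite hN andbT => /quot_imageP[y yS e].
  have yD : y \in S `\` S0.
    rewrite in_fsetD yS andbT; apply/negP => yS0; case/negP: hN; rewrite e.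
    by rewrite (_ : p y = p s) //; apply/eqP; rewrite pi_eq cS.
  have := pS y (x + d - y) yD; rewrite -pi_eq e eqxx addrC subrK in_fsetD => /(_ isT) /andP[].
  by [].
have same S (X : {fset {quot Z}}) : same_coset Q X -> same_coset (lift Q) (S `&` lift X).
  by move=> cX' x y; rewrite !in_fsetI !in_lift pi_sub => /andP[_ h1] /andP[_ h2]; apply: cX'.
have non S (X : {fset {quot Z}}) : qi S `\` X != fset0 -> S `\` (S `&` lift X) != fset0.
  move=> /fset0Pn[q]; rewrite in_fsetD => /andP[qN /quot_imageP[x xS e]]; apply: (@mem_neq0 _ _ x).
  by rewrite D // xS -e.
split.
- split => //; last by case: hn => h; [left|right]; apply: non.
  apply/negP => /eqP e; have [h hH] := subgrp_nontriv sH H1; rewrite -in_triv -e in_lift.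
  rewrite (_ : p h = 0) ?(subgrp0 sQ) //; apply/eqP; rewrite -(raddf0 p) pi_eq subr0 //.
- split; last 2 first.
  + by move=> x; rewrite in_fsetI => /andP[].
  + by move=> x; rewrite in_fsetI => /andP[].
  + by apply: (@mem_neq0 _ _ a); rewrite in_fsetI in_lift sA.
  + by apply: (@mem_neq0 _ _ b); rewrite in_fsetI in_lift sB.
- by split; [apply: (per A A0 X0 a)|apply: (per B B0 Y0 b)|apply: same|apply: same].
- move=> x y x' y' xA yB; rewrite !in_fsetI !in_lift => /andP[x'A x'X] /andP[y'B y'Y].
  rewrite pi_sub !pi_add xA yB /=; apply: hu => //; exact: mem_quot_image.
- by rewrite !sumset_lift quot_image_sumset !card_lift -!mulnDl hc.
Qed.

(** If the second part of a uniquely represented sum [a + b] lies in a full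
    coset, then [a] is the only element of its coset, so its image takes part in
    two uniquely represented sums of the quotient.  The hypothesis [htop] thus
    forces the image of [A] to be a point. *)
Lemma decomp_uniq_rep_outside A B A0 B0 a b : decomp A B A0 B0 H ->
  (forall x y y' : {quot Z}, uniq_rep (qi A) (qi B) x y -> uniq_rep (qi A) (qi B) x y' -> y != y' ->
     #|` qi A| = 1%N) ->
  uniq_rep A B a b -> b \notin B0 -> #|` A| = 1%N.
Proof.
move=> hd htop [aA bB hu] bN; have [[_ H1 _] [_ B00 sA sB] [pA pB cA cB] _ _] := hd.
have bD : b \in B `\` B0 by rewrite in_fsetD bN.
have [b0 b0B] := fset0Pn _ B00.
have [h hH h0] := subgrp_nontriv sH H1.
have aA0 : a \in A0.
  apply/negPn/negP => aN; have aD : a \in A `\` A0 by rewrite in_fsetD aN.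
  have := pA _ _ aD hH; have := pB _ _ bD (subgrpN sH hH).
  rewrite !in_fsetD => /andP[_ h1] /andP[_ h2].
  have [|e _] := hu _ _ h2 h1; first by zmod.
  by case/eqP: h0; rewrite -[h](addKr a) e addNr.
have single x : x \in A0 -> x = a.
  move=> xA; have := pB _ (- (x - a)) bD (subgrpN sH (cA _ _ xA aA0)).
  rewrite in_fsetD => /andP[_ h1]; have [|-> //] := hu _ _ (sA _ xA) h1; zmod.
have [u0 _] := decomp_quot hd aA0 b0B.
have u1 : uniq_rep (qi A) (qi B) (p a) (p b).
  split; rewrite ?mem_quot_image // => _ _ /quot_imageP[x xA ->] /quot_imageP[y yB ->] e.
  have xA0 : x \in A0.
    apply/negPn/negP => xN; have xD : x \in A `\` A0 by rewrite in_fsetD xN.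
    have hxy : - (x + y - (a + b)) \in H by apply: subgrpN => //; rewrite -pi_eq !pi_add e.
    have := pA _ _ xD hxy; rewrite in_fsetD => /andP[xN' h1].
    have [|ea _] := hu _ _ h1 yB; first by zmod.
    by rewrite ea aA0 in xN'.
  by move: e; rewrite (single _ xA0) => /addrI ->.
have q1 : #|` qi A| = 1%N.
  apply: (htop _ _ _ u0 u1); rewrite pi_eq; apply/negP => hb.
  have : b0 \in B `\` B0 by rewrite (periodic_eq sH pB hb).
  by rewrite in_fsetD b0B.
have /eqP/cardfs1P[q eq] := q1.
have oneq x : x \in A -> p x = q by move=> /mem_quot_image; rewrite eq in_fset1 => /eqP.
suff -> : A = [fset a] by rewrite cardfs1.
apply/fsetP => x; rewrite in_fset1; apply/idP/eqP => [xA|-> //]; apply: single.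
apply/negPn/negP => xN; have xD : x \in A `\` A0 by rewrite in_fsetD xN.
have hxa : a - x \in H by rewrite -pi_eq !oneq.
have := pA _ _ xD hxa; rewrite addrC subrK in_fsetD aA0 //.
Qed.

End Quotients.

(** * The structure of critical pairs *)

Lemma decomp_card_subgroup (G : zmodType) (A B A0 B0 H : {fset G}) : decomp A B A0 B0 H ->
  (#|` H| <= #|` A| + #|` B|)%N.
Proof.
move=> hd; have [_ _ cA cB] := decomp_closure hd.
have [[_ _ hn] _ [pA pB _ _] _ _] := hd.
by case: hn => /fset0Pn[x xD]; [have := periodic_card_ge pA xD|have := periodic_card_ge pB xD];
  move: cA cB; clia.
Qed.

Lemma decomp_quot_smaller (G : zmodType) (Z : zmodClosed G) (A B A0 B0 H : {fset G}) :
  Z =i H -> decomp A B A0 B0 H ->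
  (#|` quot_image Z A| + #|` quot_image Z B| < #|` A| + #|` B|)%N.
Proof.
move=> eZ hd; have [eA eB cA cB] := decomp_closure hd.
have [[sH H1 hn] [A00 B00 _ _] _ _ _] := hd.
have hH := subgrp_card_gt1 sH H1; move: A00 B00; rewrite -!cardfs_gt0 => A00 B00.
rewrite (card_quot_image eZ) in eA; rewrite (card_quot_image eZ) in eB.
have half n d h : (1 < h)%N -> (n * h = d + h)%N -> (n.-1 * 2 <= d)%N /\ (0 < n)%N.
  move=> h1; case: n => [|n] /=; first by rewrite mul0n => e; move: e h1; clia.
  by rewrite mulSn [(d + h)%N]addnC => /addnI <-; rewrite leq_mul2l h1 orbT.
have [hA qA] := half _ _ _ hH eA; have [hB qB] := half _ _ _ hH eB.
by case: hn; rewrite -!cardfs_gt0 => hn; move: hn hA qA hB qB cA cB A00 B00; clia.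
Qed.

(** Among the decompositions of the pair take one with the largest subgroup [H].
    If the image pair modulo [H] decomposed again, then either that
    decomposition would lift to one with a larger subgroup, or one of the images
    would be a point. *)
Theorem critical_structure (G : zmodType) (A B : {fset G}) : A != fset0 -> B != fset0 ->
  critical A B ->
  elementary A B \/ exists A0 B0 H (Z : zmodClosed G),
    [/\ decomp A B A0 B0 H, Z =i H & elementary (quot_image Z A) (quot_image Z B)].
Proof.
move: {2}_.+1 (ltnSn (#|` A| + #|` B|)%N) => n.
elim: n G A B => // n IH G A B An A0 B0 hc.
have [he|hs] := critical_elementary_or_splits A0 B0 hc; [by left|right].
have [|H [X0 [Y0 hd]] hmax] := @ex_smallest _
  (fun H : {fset G} => (#|` A| + #|` B| - #|` H|)%N) (fun H => exists X0 Y0, decomp A B X0 Y0 H).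
  by case: hs => X0 [Y0 [H hd]]; exists H, X0, Y0.
have [[sH H1 _] [X00 Y00 _ _] _ _ _] := hd.
have [Z eZ] := subgrp_zmodClosed sH.
have [a aX] := fset0Pn _ X00; have [b bY] := fset0Pn _ Y00.
exists X0, Y0, H, Z; split => //.
have lt := decomp_quot_smaller eZ hd; have [hu hq] := decomp_quot eZ hd aX bY.
have qA := quot_image_neq0 Z A0; have qB := quot_image_neq0 Z B0.
have [|he|[X1 [Y1 [Q [Z' [hd' eZ' htop]]]]]] := IH _ _ _ (leq_trans lt An) qA qB.
- by split; [rewrite hq|right; exists (\pi_{quot Z}%qT a), (\pi_{quot Z}%qT b)].
- by [].
have [aX1|aX1] := boolP (\pi_{quot Z}%qT a \in X1); last first.
  apply: Or41; rewrite /elementary_I (decomp_uniq_rep_outside eZ' (decompC hd') _ (uniq_repC hu) aX1).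
    by apply/minn_idPr; rewrite cardfs_gt0.
  by move=> x y y' h1 h2; apply: elementary_two_uniq_r htop (uniq_repC h1) (uniq_repC h2).
have [bY1|bY1] := boolP (\pi_{quot Z}%qT b \in Y1); last first.
  apply: Or41; rewrite /elementary_I (decomp_uniq_rep_outside eZ' hd' _ hu bY1).
    by apply/minn_idPl; rewrite cardfs_gt0.
  by move=> x y y' h1 h2; apply: elementary_two_uniq htop h1 h2.
have hL := decomp_lift eZ hd hd' aX bY aX1 bY1.
have cL := decomp_card_subgroup hL.
have : (#|` A| + #|` B| - #|` H| <= #|` A| + #|` B| - #|` lift H Q|)%N by apply: hmax; do 2 eexists; exact: hL.
have [[sQ Q1 _] _ _ _ _] := hd'.
have : (#|` H| * 2 <= #|` lift H Q|)%N.
  by rewrite (card_lift eZ) mulnC leq_mul2r (subgrp_card_gt1 sQ Q1) orbT.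
by have := subgrp_card_gt0 sH; move: cL; clia.
Qed.

Theorem theorem2 (G : zmodType) (A B : {fset G})
    (hA : A != fset0) (hB : B != fset0) :
  ((#|` sumset A B| <= #|` A| + #|` B| - 1)%N /\
   (aperiodic (sumset A B) \/ mu A B = 1%N))
  <->
  (elementary A B \/
   exists (A0 B0 : {fset G}) (H : zmodClosed G),
     [/\ [/\ A0 != fset0, B0 != fset0, A0 `<=` A & B0 `<=` B],
         [/\ finite_subgroup H, (exists2 x : G, x \in H & x != 0) &
             exists y : G, y \notin H],
         [/\ in_coset H A0, in_coset H B0,
             #|` sumset A0 B0| = (#|` A0| + #|` B0| - 1)%N &
             aperiodic (sumset A0 B0) \/ mu A0 B0 = 1%N],
         union_of_cosets H (A `\` A0) /\ union_of_cosets H (B `\` B0) &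
         elementary (quot_image H A) (quot_image H B) /\
         exists2 q : {quot H},
           quot_image H (sumset A0 B0) = [fset q] &
           nu q (quot_image H A) (quot_image H B) = 1%N]).
Proof.
rewrite (criticalE hA hB); split=> [hc|[he|]].
- have [he|[A0 [B0 [H [Z [hd eZ he]]]]]] := critical_structure hA hB hc; first by left.
  right; exists A0, B0, Z; have hc0 := decomp_critical hd hc.
  have [[sH H1 hn] [A00 B00 sA sB] [pA pB cA cB] _ _] := hd.
  have [a aA] := fset0Pn _ A00; have [b bB] := fset0Pn _ B00.
  have [h1 h2] := (criticalE A00 B00).2 hc0; have e0 := critical_card A00 B00 hc0.
  have [hu hq] := decomp_quot eZ hd aA bB.
  split.
  + by split => //; apply/fsubsetP.
  + split; first by exists H.
      by have [h hH h0] := subgrp_nontriv sH H1; exists h; rewrite ?eZ.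
    (* [A0] lies in one coset and is disjoint from the non-empty union of cosets
       [A \ A0], so there are at least two cosets. *)
    have out X X0 x : same_coset H X0 -> periodic H (X `\` X0) -> x \in X0 -> X `\` X0 != fset0 ->
        exists y, y \notin Z.
      move=> cX pX xX /fset0Pn[y yD]; exists (x - y); rewrite eZ; apply/negP => hxy.
      by have := pX _ _ yD hxy; rewrite addrC subrK in_fsetD xX.
    by case: hn => hn; [apply: (out A A0 a)|apply: (out B B0 b)].
  + split => //; [exact/(in_cosetE eZ)|exact/(in_cosetE eZ)|by move: e0; clia].
  + by split; apply/(union_of_cosetsE eZ).
  + split => //; exists (\pi_{quot Z}%qT (a + b)).
      by apply: (quot_image_coset eZ); [apply: same_coset_sumset|apply: mem_sumset].
    by apply/nu_eq1P; exists (\pi_{quot Z}%qT a), (\pi_{quot Z}%qT b); rewrite (pi_add Z).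
- exact: elementary_critical.
move=> [A0 [B0 [Z [[A00 B00 sA sB] [[H eZ] [h hZ h0] _] [iA iB e0 hm] [pA pB] [he [q eq nq]]]]]].
have hc0 : critical A0 B0 by apply/(criticalE A00 B00); rewrite e0.
have sH := zmodClosed_subgrp eZ.
have [/andP[/eqP DA /eqP DB]|hn] := boolP ((A `\` A0 == fset0) && (B `\` B0 == fset0)).
  have full (X X0 : {fset G}) : X0 `<=` X -> X `\` X0 = fset0 -> X = X0.
    by move=> sX /eqP; rewrite fsetD_eq0 => hX; apply/eqP; rewrite eqEfsubset hX.
  by rewrite (full A A0) // (full B B0).
have [a aA] := fset0Pn _ A00; have [b bB] := fset0Pn _ B00.
have [x [y [hxy ex]]] := (nu_eq1P _ _ _).1 nq.
have eab : \pi_{quot Z}%qT a + \pi_{quot Z}%qT b = x + y.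
  have := mem_quot_image Z (mem_sumset aA bB); rewrite eq in_fset1 -ex => /eqP <-.
  by rewrite (pi_add Z).
have [_ _ hu] := hxy.
have aq : \pi_{quot Z}%qT a \in quot_image Z A by apply/mem_quot_image/(fsubsetP sA).
have bq : \pi_{quot Z}%qT b \in quot_image Z B by apply/mem_quot_image/(fsubsetP sB).
have [ea eb] := hu _ _ aq bq eab.
apply: (critical_decomp _ hc0 (H := H)).
apply: (decompI eZ (a := a) (b := b)) => //.
- by apply/eqP => e; case/eqP: h0; apply/eqP; rewrite -in_triv -e -eZ.
- by move: hn; rewrite negb_and => /orP.
- exact/fsubsetP.
- exact/fsubsetP.
- exact/(union_of_cosetsE eZ).
- exact/(union_of_cosetsE eZ).
- exact/(in_cosetE eZ).
- exact/(in_cosetE eZ).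
- by rewrite ea eb.
- have qA := quot_image_neq0 Z hA; have qB := quot_image_neq0 Z hB.
  exact: critical_card qA qB (elementary_critical qA qB he).
Qed.
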